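(* Let $N\ge 1$ be an integer, $1<p<\infty$ and $0<r_0<r_1$. Let $B_1=B(0,r_1)\subset\mathbb{R}^N$, let $\mathcal{F}$ be the family of all domains of the form $\Omega=B_1\setminus\overline{B_0}$, where $B_0$ is an open ball of radius $r_0$ with $\overline{B_0}\subset B_1$, and put $\Omega_0=B(0,r_1)\setminus\overline{B(0,r_0)}$. Then the minimum value of the $p$-torsional rigidity functional $\Omega\mapsto E(\Omega)$ on $\mathcal{F}$ is attained at $\Omega=\Omega_0$ and only there (i.e. only when the balls are concentric): $E(\Omega_0)\le E(\Omega)$ for all $\Omega\in\mathcal{F}$, with equality only if $\Omega=\Omega_0$.
   Context: $B(a,r)$ denotes the open Euclidean ball of centre $a$ and radius $r$ in $\mathbb{R}^N$. The $p$-Laplacian is $\Delta_p f=\mathrm{div}(|\nabla f|^{p-2}\nabla f)$. For a bounded open set $\Omega\subset\mathbb{R}^N$, let $y\in W^{1,p}_0(\Omega)$ be the unique weak solution of $-\Delta_p y=1$ in $\Omega$, $y=0$ on $\partial\Omega$. The $p$-torsional rigidity of $\Omega$ is $E(\Omega):=\int_\Omega|\nabla y|^p\,dx=\int_\Omega y\,dx$. *)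

(* Defs.v *)
From HB Require Import structures.
From mathcomp Require Import all_boot all_order all_algebra.
From mathcomp Require Import all_classical all_reals all_analysis.
Import Order.TTheory GRing.Theory Num.Theory.
Import numFieldNormedType.Exports.

Set Implicit Arguments.
Unset Strict Implicit.
Unset Printing Implicit Defensive.

Local Open Scope classical_set_scope.
Local Open Scope ring_scope.

Definition measure_rV_display : measure_display.
Proof. exact: default_measure_display. Qed.

(* The product (equivalently, Borel) sigma-algebra on R^n, generated by the
   coordinates; the library only provides it on n.-tuple R, which carries no
   normed-space structure. *)
Section measurable_rV.
Context {R : realType} {n : nat}.

Let coord (i : 'I_n) (x : 'rV[R]_n) : measurableTypeR R := x ord0 i.

Let rV_set0 : g_sigma_preimage coord set0.
Proof. exact: sigma_algebra0. Qed.

Let rV_setC A : g_sigma_preimage coord A -> g_sigma_preimage coord (~` A).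
Proof. exact: sigma_algebraC. Qed.

Let rV_bigcup (F : (set 'rV[R]_n)^nat) :
  (forall i, g_sigma_preimage coord (F i)) ->
  g_sigma_preimage coord (\bigcup_i (F i)).
Proof. exact: sigma_algebra_bigcup. Qed.

HB.instance Definition _ := @isMeasurable.Build measure_rV_display
  'rV[R]_n (g_sigma_preimage coord) rV_set0 rV_setC rV_bigcup.

Lemma measurable_coord (i : 'I_n) :
  measurable_fun [set: 'rV[R]_n] (fun x : 'rV[R]_n => x ord0 i).
Proof.
move=> _ Y mY; rewrite setTI; apply: sub_sigma_algebra => /=.
rewrite -bigcup_seq/=; exists i => /=; first by rewrite mem_index_enum.
by exists Y => //; rewrite setTI.
Qed.

Lemma measurable_fun_coord d (T : measurableType d) (f : T -> 'rV[R]_n) :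
  (forall i, measurable_fun [set: T] (fun t => f t ord0 i)) ->
  measurable_fun [set: T] f.
Proof.
move=> mf.
suff H : g_sigma_preimage (fun i => coord i \o f) `<=` measurable.
  by rewrite g_sigma_preimage_comp in H => _ A mA; apply: H; exists A.
apply: smallest_sub; first exact: sigma_algebra_measurable.
move=> A; rewrite -bigcup_seq/= => -[i _ [B mB <-]].
exact: mf.
Qed.

End measurable_rV.

Section lebesgue_rV.
Context {R : realType}.

Definition rV_cons n (xv : R * 'rV[R]_n) : 'rV[R]_n.+1 :=
  row_mx (const_mx xv.1 : 'rV[R]_1) xv.2.

Definition rV_uncons n (w : 'rV[R]_n.+1) : R * 'rV[R]_n :=
  (w ord0 ord0, @rsubmx _ 1 1 n w).

Lemma rV_consK n : cancel (@rV_cons n) (@rV_uncons n).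
Proof.
move=> [x v]; rewrite /rV_uncons /rV_cons /= row_mxKr; congr pair.
rewrite (_ : ord0 = @lshift 1 n ord0); last exact: val_inj.
by rewrite (@row_mxEl _ 1 1 n) mxE.
Qed.

Lemma measurable_rV_cons n : measurable_fun setT (@rV_cons n).
Proof.
apply: measurable_fun_coord => i; rewrite /rV_cons.
case: (@splitP 1 n i) => j ij.
- rewrite (_ : i = @lshift 1 n j); last exact: val_inj.
  rewrite (_ : (fun t => _) = fst); first exact: measurable_fst.
  by apply/funext => t; rewrite (@row_mxEl _ 1 1 n) mxE.
- rewrite (_ : i = @rshift 1 n j); last exact: val_inj.
  rewrite (_ : (fun t => _) = (fun v : 'rV[R]_n => v ord0 j) \o snd).
    exact: measurableT_comp (measurable_coord j) measurable_snd.
  by apply/funext => t; rewrite (@row_mxEr _ 1 1 n).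
Qed.

Lemma measurable_rV_uncons n : measurable_fun setT (@rV_uncons n).
Proof.
apply/measurable_fun_pair; first exact: measurable_coord.
apply: measurable_fun_coord => i.
rewrite (_ : (fun t => _) = fun w : 'rV[R]_n.+1 => w ord0 (@rshift 1 n i)).
  exact: measurable_coord.
by apply/funext => w; rewrite mxE.
Qed.

Section step.
Variables (n : nat) (mu : {sigma_finite_measure set 'rV[R]_n -> \bar R}).

Definition rV_measure_step : set 'rV[R]_n.+1 -> \bar R :=
  pushforward (lebesgue_measure \x mu)%E (@rV_cons n).

Let rV_measure_step0 : rV_measure_step set0 = 0%E.
Proof. by rewrite /rV_measure_step /pushforward preimage_set0 measure0. Qed.

Let rV_measure_step_ge0 A : (0 <= rV_measure_step A)%E.
Proof. by rewrite /rV_measure_step /pushforward measure_ge0. Qed.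

Let rV_measure_step_additive : semi_sigma_additive rV_measure_step.
Proof.
pose m := measure_function_pushforward__canonical__measure_function_Measure
  (lebesgue_measure \x mu)%E (@measurable_rV_cons n).
exact: (@measure_semi_sigma_additive _ _ _ m).
Qed.

HB.instance Definition _ := isMeasure.Build _ _ _ rV_measure_step
  rV_measure_step0 rV_measure_step_ge0 rV_measure_step_additive.

Let rV_measure_step_sigma_finite : sigma_finite setT rV_measure_step.
Proof.
have /sigma_finiteP[F [TF ndF Foo]] :=
  sigma_finiteT (@lebesgue_measure R : {sigma_finite_measure set _ -> \bar _}).
have /sigma_finiteP[G [TG ndG Goo]] := sigma_finiteT mu.
exists (fun k => @rV_uncons n @^-1` (F k `*` G k)).
  rewrite -preimage_bigcup (_ : \bigcup_k _ = setT) ?preimage_setT//.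
  rewrite -subTset => -[x y] _.
  have [k _ Fkx] : (\bigcup_i F i) x by rewrite -TF.
  have [l _ Gly] : (\bigcup_i G i) y by rewrite -TG.
  exists (maxn k l) => //; split => /=.
  - by move: x Fkx; exact/subsetPset/ndF/leq_maxl.
  - by move: y Gly; exact/subsetPset/ndG/leq_maxr.
move=> k; have [mF Fk] := Foo k; have [mG Gk] := Goo k.
have mFG : measurable (F k `*` G k) by exact: measurableX.
split; first by rewrite -[X in measurable X]setTI; exact: measurable_rV_uncons.
rewrite /rV_measure_step /pushforward -comp_preimage.
rewrite (_ : _ \o _ = id) ?preimage_id; last first.
  by apply/funext => x; exact: rV_consK.
by rewrite product_measure1E// lte_mul_pinfty// ge0_fin_numE.
Qed.

HB.instance Definition _ := Measure_isSigmaFinite.Build _ _ _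
  rV_measure_step rV_measure_step_sigma_finite.
End step.

(* Lebesgue measure on R^n: the n-fold product of the one-dimensional one. *)
Fixpoint lebesgue_rV (n : nat) :
    {sigma_finite_measure set 'rV[R]_n -> \bar R} :=
  match n with
  | 0 => dirac (0 : 'rV[R]_0)
  | n'.+1 => rV_measure_step (lebesgue_rV n')
  end.

End lebesgue_rV.

Section torsion.
Context {R : realType} {N : nat}.
Notation V := 'rV[R]_N.
Notation mu := (@lebesgue_rV R N).
Implicit Types (p : R) (Om : set V) (u v phi : V -> R) (g h : V -> V).

(* The library norm on 'rV[R]_N is the sup norm; it induces the same topology. *)
Definition dotv (x y : V) : R := \sum_(i < N) x ord0 i * y ord0 i.
Definition enorm (x : V) : R := Num.sqrt (dotv x x).
Definition eball (a : V) (r : R) : set V := [set x | enorm (x - a) < r].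

Definition partial (i : 'I_N) (f : V -> R) (x : V) : R :=
  'D_(delta_mx ord0 i) f x.
Definition grad (f : V -> R) (x : V) : V := \row_i partial i f x.

Fixpoint Ck (k : nat) (f : V -> R) : Prop :=
  match k with
  | 0 => continuous f
  | k'.+1 => continuous f /\
      forall i : 'I_N, (forall x, derivable f x (delta_mx ord0 i)) /\
                       Ck k' (partial i f)
  end.
Definition smooth f : Prop := forall k, Ck k f.

Definition test_function Om phi : Prop :=
  [/\ smooth phi, compact (closure [set x | phi x != 0]) &
      closure [set x | phi x != 0] `<=` Om].

Definition Lp Om p u : Prop :=
  measurable_fun Om u /\ (\int[mu]_(x in Om) (`|u x| `^ p)%:E < +oo)%E.
Definition Lp_vec Om p g : Prop :=
  measurable_fun Om g /\ (\int[mu]_(x in Om) (enorm (g x) `^ p)%:E < +oo)%E.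

Definition weak_gradient Om u g : Prop :=
  forall phi, test_function Om phi -> forall i : 'I_N,
    \int[mu]_(x in Om) (u x * partial i phi x) =
    - \int[mu]_(x in Om) (g x ord0 i * phi x).

(* A Sobolev function is handled together with (a version of) its weak
   gradient: [sobolev Om p u g] says that u is in W^{1,p}(Om) with
   weak gradient g. *)
Definition sobolev Om p u g : Prop :=
  [/\ Lp Om p u, Lp_vec Om p g & weak_gradient Om u g].

(* W^{1,p}_0(Om) is the closure of C_c^oo(Om) in W^{1,p}(Om). *)
Definition sobolev0 Om p u g : Prop :=
  sobolev Om p u g /\
  forall e : R, 0 < e -> exists2 phi, test_function Om phi &
    (\int[mu]_(x in Om) (`|phi x - u x| `^ p)%:E +
     \int[mu]_(x in Om) (enorm (grad phi x - g x) `^ p)%:E < e%:E)%E.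

(* Weak solution of -Delta_p u = 1 in Om, u = 0 on the boundary. The junk value
   of 0 `^ (p - 2) is harmless: where g x = 0 the factor dotv (g x) (h x) is 0,
   in accordance with the convention |0|^(p-2) 0 = 0 when p < 2. *)
Definition torsion_solution Om p u g : Prop :=
  sobolev0 Om p u g /\
  forall v h, sobolev0 Om p v h ->
    \int[mu]_(x in Om) (enorm (g x) `^ (p - 2) * dotv (g x) (h x)) =
    \int[mu]_(x in Om) v x.

(* The solution is unique up to null sets; [get] selects a representative of
   it, together with its weak gradient. *)
Definition torsion_function p Om : (V -> R) * (V -> V) :=
  get [set ug | torsion_solution Om p ug.1 ug.2].

Definition torsional_rigidity p Om : R :=
  \int[mu]_(x in Om) (enorm ((torsion_function p Om).2 x) `^ p).

Definition annulus r0 r1 (c : V) : set V :=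
  eball 0 r1 `\` closure (eball c r0).

Definition annuli r0 r1 : set (set V) :=
  [set Om | exists2 c : V, closure (eball c r0) `<=` eball 0 r1 &
                           Om = annulus r0 r1 c].

End torsion.

(* Main.v *)
(* The rigidity of [Om] is [- p / (p - 1)] times the infimum [torsion_energy p Om] of
   [1/p int |grad phi|^p - int phi] over test functions [phi]: by uniform convexity
   minimizing sequences are Cauchy, and their limit solves the Euler-Lagrange equation.

   Reflect one coordinate about the midpoint of two values [c'_i], [c_i] with
   [|c'_i| < |c_i|], and replace [phi] by the larger of [phi] and its reflection on the
   side of the hole at [c'], and by the smaller one on the side of the hole at [c].
   This polarization preserves the energy and turns functions supported in the annulus
   with hole at [c'] into functions supported in the one with hole at [c], so the infimum
   decreases as the hole moves away from the centre one coordinate at a time. Max and min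
   are smoothed, at the cost of an arbitrarily small amount of energy, in order to stay
   within test functions.

   Strictness: the torsion function of the concentric annulus is explicit, radial, and has
   a strict maximum on a sphere. Polarizing it towards [t e_i] either directly, or in two
   steps through [k t e_i], would yield, in case of equal energies, two minimizing sequences
   for the same annulus; these differ by a fixed amount near the point where the second one
   keeps the maximal value, which contradicts uniform convexity. *)
Require Import Defs.
From mathcomp Require Import all_boot all_order all_algebra.
From mathcomp Require Import all_classical all_reals all_analysis.
From mathcomp Require Import measurable_realfun.
From mathcomp Require Import ring lra.
Import Order.TTheory GRing.Theory Num.Theory.
Import numFieldNormedType.Exports.

Set Implicit Arguments.
Unset Strict Implicit.
Unset Printing Implicit Defensive.

Local Open Scope classical_set_scope.
Local Open Scope ring_scope.

(** * Lebesgue measure on row vectors *)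

(** A Sobolev function is given here only as a limit of test functions, so the comparison is carried
    out on test functions, where polarization, truncation and integration by parts are elementary.
    Limits serve to show that a solution exists and that every solution has energy
    [torsion_energy p Om], whichever one [get] selects. Nonnegativity has to be arranged beforehand:
    the minimum of two functions is supported in the intersection of their supports only if neither
    takes negative values. Uniform convexity is required for every [p > 1]; it is derived from
    compactness and homogeneity, up to a small multiple of the Dirichlet integrals, which stay
    bounded along minimizing sequences. In the strict case all pointwise information comes from the
    concentric torsion function; about the displaced annulus only the Cauchy property of minimizing
    sequences enters. The explicit concentric function is not smooth for general [p], hence its
    regularized profile. *)

Section lebesgue_rV_facts.
Context {R : realType}.

Lemma measurable_fun_translation (h : R) :
  measurable_fun [set: measurableTypeR R] (fun t : measurableTypeR R => t + h : measurableTypeR R).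
Proof. exact: measurable_funD. Qed.

Lemma measurable_fun_reflection (h : R) :
  measurable_fun [set: measurableTypeR R] (fun t : measurableTypeR R => h - t : measurableTypeR R).
Proof. exact: measurable_funB. Qed.

Lemma lebesgue_measure_translation (h : R) (A : set R) : measurable A ->
  pushforward lebesgue_measure (fun t : measurableTypeR R => t + h : measurableTypeR R) A
  = lebesgue_measure A.
Proof.
move=> mA; have mh := measurable_fun_translation h.
apply/esym/lebesgue_measure_unique => //= _ [[a b]] _ <-.
rewrite /pushforward.
rewrite (_ : _ @^-1` _ = `]a - h, b - h]%classic); last first.
  by apply/seteqP; split => t /=; rewrite !in_itv/= ltrBlDr lerBrDr.
rewrite !lebesgue_measure_itv/= !lte_fin ltrD2r.
by case: ifP => // _; rewrite -!EFinB; congr EFin; ring.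
Qed.

Lemma lebesgue_measure_reflection (h : R) (A : set R) : measurable A ->
  pushforward lebesgue_measure (fun t : measurableTypeR R => h - t : measurableTypeR R) A
  = lebesgue_measure A.
Proof.
move=> mA; have mh := measurable_fun_reflection h.
apply/esym/lebesgue_measure_unique => //= _ [[a b]] _ <-.
rewrite /pushforward.
rewrite (_ : _ @^-1` _ = `[h - b, h - a[%classic); last first.
  by apply/seteqP; split => t /=; rewrite !in_itv/=; lra.
rewrite !lebesgue_measure_itv/= !lte_fin.
have -> : (h - b < h - a) = (a < b) by apply/idP/idP; lra.
by case: ifP => // _; rewrite -!EFinB; congr EFin; ring.
Qed.

Lemma measurable_forall_ord d (T : measurableType d) n (P : 'I_n -> set T) :
  (forall i, measurable (P i)) -> measurable [set x | forall i, P i x].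
Proof.
move=> mP; rewrite -[X in measurable X]setCK; apply: measurableC.
rewrite (_ : ~` _ = \bigcup_i ~` P i); last first.
  apply/seteqP; split => x /=; first by move/existsNP => [i Hi]; exists i.
  by move=> [i _ Hi] H; exact/Hi/H.
by apply: countable_bigcupT_measurable => // i; exact: measurableC.
Qed.

Definition coordwise n (f : 'I_n -> R -> R) (x : 'rV[R]_n) : 'rV[R]_n :=
  \row_i f i (x ord0 i).

Lemma measurable_coordwise n (f : 'I_n -> R -> R) :
  (forall i, measurable_fun [set: measurableTypeR R] (f i : measurableTypeR R -> measurableTypeR R)) ->
  measurable_fun setT (coordwise f).
Proof.
move=> mf; apply: measurable_fun_coord => i.
rewrite (_ : (fun t => _) = f i \o (fun t : 'rV[R]_n => t ord0 i)).
  exact: measurableT_comp (mf i) (measurable_coord i).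
by apply/funext => t; rewrite mxE.
Qed.

(** By induction on [n], following the recursion of [lebesgue_rV]: on a rectangle both sides split
    into a factor for the first coordinate and one for the others, and the product measure is
    determined by its values on rectangles. The instances are translations and reflections of
    coordinates. *)
Lemma lebesgue_rV_coordwise n (f : 'I_n -> R -> R) :
  (forall i, measurable_fun [set: measurableTypeR R] (f i : measurableTypeR R -> measurableTypeR R)) ->
  (forall i (A : set R), measurable A ->
    lebesgue_measure ((f i : measurableTypeR R -> measurableTypeR R) @^-1` A) = lebesgue_measure A) ->
  forall A : set 'rV[R]_n, measurable A ->
    lebesgue_rV n (coordwise f @^-1` A) = lebesgue_rV n A.
Proof.
elim: n f => [|n IH] f mf lf A mA /=.
  congr (dirac _ _); apply/seteqP; split => x /=;
    by rewrite (_ : coordwise f x = x)//; apply/rowP => -[].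
rewrite /rV_measure_step /pushforward/=.
pose f0 := f ord0; pose f' i := f (lift ord0 i).
have mf' i := mf (lift ord0 i).
have lf' i := lf (lift ord0 i).
pose F (xv : measurableTypeR R * 'rV[R]_n) : measurableTypeR R * 'rV[R]_n :=
  (f0 xv.1 , coordwise f' xv.2).
have mF : measurable_fun setT F.
  apply/measurable_fun_pair => /=.
    exact: measurableT_comp (mf ord0) measurable_fst.
  exact: measurableT_comp (measurable_coordwise mf') measurable_snd.
have E (xv : R * 'rV[R]_n) : coordwise f (rV_cons xv) = rV_cons (F xv).
  apply/rowP => i; rewrite mxE /rV_cons.
  case: (@splitP 1 n i) => j ij.
  - rewrite (_ : i = @lshift 1 n j); last exact: val_inj.
    rewrite !(@row_mxEl _ 1 1 n) !mxE /= /f0; congr (f _ _).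
    by apply: val_inj; case: j {ij} => -[].
  - rewrite (_ : i = @rshift 1 n j); last exact: val_inj.
    rewrite !(@row_mxEr _ 1 1 n) !mxE /f'; congr (f _ _).
    exact: val_inj.
rewrite (_ : _ @^-1` _ = F @^-1` (@rV_cons R n @^-1` A)); last first.
  by apply/seteqP; split => x /=; rewrite E.
set B := @rV_cons R n @^-1` A.
have mB : measurable B.
  by rewrite -[X in measurable X]setTI; exact: measurable_rV_cons.
pose m := measure_function_pushforward__canonical__measure_function_Measure
  (@lebesgue_measure R \x lebesgue_rV n)%E mF.
apply/esym; apply: (@product_measure_unique _ _ _ _ _ _ _ m) => // C D mC mD.
rewrite /m /= /pushforward.
rewrite (_ : _ @^-1` _ = ((f0 : measurableTypeR R -> measurableTypeR R) @^-1` C) `*` (coordwise f' @^-1` D)) //.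
rewrite product_measure1E//.
- congr (_ * _)%E; [exact: (lf ord0)|exact: IH].
- by rewrite -[X in measurable X]setTI; exact: mf.
- by rewrite -[X in measurable X]setTI; exact: measurable_coordwise.
Qed.

Lemma lebesgue_rV_box n (a b : R) : a <= b ->
  measurable [set x : 'rV[R]_n | forall i, a < x ord0 i < b] /\
  lebesgue_rV n [set x | forall i, a < x ord0 i < b] = (((b - a) ^+ n)%:E)%E.
Proof.
move=> ab; have mbox k : measurable [set x : 'rV[R]_k | forall i, a < x ord0 i < b].
  apply: measurable_forall_ord => i.
  rewrite [X in measurable X](_ : _ = (fun x : 'rV[R]_k => x ord0 i : measurableTypeR R) @^-1` `]a, b[%classic).
    rewrite -[X in measurable X]setTI; exact: measurable_coord.
  by apply/seteqP; split => x /=; rewrite in_itv.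
split=> //.
elim: n => [|n IH] /=.
  by rewrite diracE mem_set// => -[].
rewrite /rV_measure_step /pushforward/=.
rewrite (_ : _ @^-1` _ = `]a, b[%classic `*` [set x : 'rV[R]_n | forall i, a < x ord0 i < b]).
  rewrite product_measure1E//; last exact: mbox.
  have -> : lebesgue_measure_lebesgue_measure__canonical__measure_function_Measure R
      `]a, b[%classic = (b - a)%:E.
    rewrite /= lebesgue_measure_itv/= lte_fin; case: ltP => // ba.
    by rewrite (_ : b = a) ?subrr//; apply: le_anti; rewrite ab ba.
  by rewrite exprS EFinM; congr (_ * _)%E; exact: IH.
apply/seteqP; split => -[t x] /= H; [split|].
- have := H ord0; rewrite in_itv/= /rV_cons (_ : ord0 = @lshift 1 n ord0); last exact: val_inj.
  by rewrite (@row_mxEl _ 1 1 n) mxE.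
- by move=> i; have := H (@rshift 1 n i); rewrite /rV_cons (@row_mxEr _ 1 1 n).
- move=> i; rewrite /rV_cons.
  case: (@splitP 1 n i) => j ij.
  - rewrite (_ : i = @lshift 1 n j); last exact: val_inj.
    by rewrite (@row_mxEl _ 1 1 n) mxE; case: H; rewrite in_itv.
  - rewrite (_ : i = @rshift 1 n j); last exact: val_inj.
    by rewrite (@row_mxEr _ 1 1 n); case: H.
Qed.

Lemma ball_rVE n (x : 'rV[R]_n) (e : R) : 0 < e ->
  ball x e = [set y | forall i, `|x ord0 i - y ord0 i| < e].
Proof.
move=> e0; apply/seteqP; split=> y /=.
  by move=> [_ H] i; exact: H.
by move=> H; split => // i j; rewrite (ord1 i); exact: H.
Qed.

Lemma measurable_ball_rV n (x : 'rV[R]_n) (e : R) : measurable (ball x e).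
Proof.
have [e0|e0] := ltP 0 e; last first.
  rewrite (_ : ball x e = set0)//; apply/seteqP; split => // y [].
  by move=> /lt_le_trans/(_ e0); rewrite ltxx.
rewrite ball_rVE//.
apply: measurable_forall_ord => i.
rewrite [X in measurable X](_ : _ = (fun y : 'rV[R]_n => y ord0 i : measurableTypeR R) @^-1` (ball (x ord0 i) e))//.
rewrite -[X in measurable X]setTI; apply: measurable_coord => //.
exact: measurable_ball.
Qed.

(** The sigma-algebra is generated by the coordinates, so an open set is written as a countable
    union of sets described by coordinates: sup-norm balls with rational centre and radius
    [1 / (k + 1)]. *)
Lemma measurable_open_rV n (U : set 'rV[R]_n) : open U -> measurable U.
Proof.
move=> oU.
pose c (q : 'rV[rat]_n) : 'rV[R]_n := map_mx ratr q.
pose B (z : 'rV[rat]_n * nat) : set 'rV[R]_n := ball (c z.1) (z.2.+1%:R^-1).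
rewrite (_ : U = \bigcup_(z in [set z | B z `<=` U]) B z).
  rewrite bigcup_mkcond; apply: countable_bigcupT_measurable => // z.
  by case: ifP => // _; exact: measurable_ball_rV.
apply/seteqP; split => x; last by move=> [z zU]; exact: zU.
move=> Ux; have /nbhs_ballP[e /= e0 eU] : nbhs x U by exact: open_nbhs_nbhs.
(* With a radius below [e / 2], a ball whose centre is closer to [x] than its radius contains [x]
   and stays within [e] of it. *)
have [k _ /= kE] : \forall k \near \oo, k.+1%:R^-1 < e / 2.
  by apply: near_infty_natSinv_lt (PosNum (divr_gt0 e0 (ltr0n _ 2))).
have ke := kE k (leqnn k); set d := k.+1%:R^-1 in ke.
have d0 : 0 < d :> R by rewrite /d invr_gt0 ltr0n.
have : forall i, exists q : rat, `|x ord0 i - ratr q| < d.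
  move=> i; have [q] := @rat_in_itvoo R (x ord0 i - d) (x ord0 i + d) ltac:(lra).
  by rewrite in_itv/= => H; exists q; rewrite ltr_norml; lra.
move=> /choice[q qE].
exists (\row_i q i, k) => /=.
  apply: subset_trans eU => y.
  rewrite /B/= -/d !ball_rVE// => H i.
  have := H i; have := qE i; rewrite /c !mxE => h1 h2.
  rewrite (_ : _ - _ = (x ord0 i - ratr (q i)) + (ratr (q i) - y ord0 i)); last by ring.
  apply: le_lt_trans (ler_normD _ _) _; lra.
rewrite /B /= -/d ball_rVE//= => i; rewrite /c !mxE distrC; exact: qE.
Qed.

Lemma continuous_measurable_rV n (f : 'rV[R]_n -> R) :
  continuous f -> measurable_fun setT f.
Proof.
move=> cf; apply: (measurability _ (RGenOpens.measurableE R)) => _ [_ [a [b ->]] <-].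
rewrite setTI; apply: measurable_open_rV.
by apply: open_comp => //; exact: interval_open.
Qed.

End lebesgue_rV_facts.

(** * Calculus of smooth functions *)

Section one_variable_calculus.
Context {R : realType}.

Lemma near_dist (x d : R) (P : R -> Prop) : 0 < d ->
  (forall y, `|y - x| < d -> P y) -> \forall y \near x, P y.
Proof.
move=> d0 H; apply/nbhs_ballP; exists d => //= y.
by rewrite /ball/= distrC; exact: H.
Qed.

(** Turns a directional derivative into an ordinary one along a line, so that the one-variable chain
    rule and mean value theorem apply. *)
Lemma is_derive_lineP (V : normedModType R) (f : V -> R) (x v : V) (d : R) :
  is_derive x v f d <-> is_derive (0 : R) 1 (fun h : R => f (h *: v + x)) d.
Proof.
have E : 'D_v f x = 'D_1 (fun h : R => f (h *: v + x)) 0.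
  rewrite /derive; set g1 := fun h => h^-1 *: _; set g2 := fun h => h^-1 *: _.
  suff -> : g1 = g2 by [].
  by apply/funext => h; rewrite /g1 /g2 /= addr0 scale0r add0r [_%:A]mulr1.
split=> -[H <-].
  by rewrite E; exact: (DeriveDef ((derivable1P f x v).1 H) erefl).
by rewrite -E; exact: (DeriveDef ((derivable1P f x v).2 H) erefl).
Qed.

Lemma is_derive_comp_line (V : normedModType R) (F : R -> R) (f : V -> R) (x v : V) (dF d : R) :
  is_derive (f x) 1 F dF -> is_derive x v f d -> is_derive x v (F \o f) (dF * d).
Proof.
move=> HF /is_derive_lineP Hf; apply/is_derive_lineP.
rewrite (_ : (fun h => _) = F \o (fun h : R => f (h *: v + x)))//.
by apply: is_derive1_comp => //=; rewrite scale0r add0r.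
Qed.

Lemma is_derive_prod (V : normedModType R) (f g : V -> R) (x v : V) (a b : R) :
  is_derive x v f a -> is_derive x v g b ->
  is_derive x v (fun y => f y * g y) (f x * b + g x * a).
Proof. by move=> Hf Hg; exact: is_deriveM. Qed.

Lemma is_derive_add (V : normedModType R) (f g : V -> R) (x v : V) (a b : R) :
  is_derive x v f a -> is_derive x v g b ->
  is_derive x v (fun y => f y + g y) (a + b).
Proof. by move=> Hf Hg; exact: is_deriveD. Qed.

Lemma is_derive_const (V : normedModType R) (c : R) (x v : V) :
  is_derive x v (fun=> c) 0.
Proof. exact: is_derive_cst. Qed.

Lemma is_derive_pow (j : nat) (u : R) :
  is_derive u 1 (fun x : R => x ^+ j) (j%:R * u ^+ j.-1).
Proof.
have Hid : is_derive u 1 (@id R) 1 by exact: is_derive_id.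
have := is_deriveX j Hid; rewrite exprfctE => /is_derive_eq; apply.
by rewrite /GRing.scale/= mulr1.
Qed.

(** A quadratic bound makes the difference quotient at most [C |h|]. It serves for [flat] at [0],
    where the exponential formula breaks off. *)
Lemma is_derive_small (f : R -> R) (C : R) :
  (forall h, `|h| <= 1 -> `|f h| <= C * h ^+ 2) -> is_derive (0 : R) 1 f 0.
Proof.
move=> fC.
have f0 : f 0 = 0.
  by apply/eqP; rewrite -normr_le0 (le_trans (fC 0 _))// ?normr0// expr0n mulr0.
have C0 : 0 <= C.
  by have := fC 1; rewrite normr1 expr1n mulr1 => /(_ (lexx _)); exact: le_trans.
have L : h^-1 *: ((f \o shift 0) (h *: 1) - f 0) @[h --> 0^'] --> (0 : R).
  apply/cvgrPdist_le => e e0; near=> h.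
  have h0 : h != 0 by near: h; exact: nbhs_dnbhs_neq.
  have hle : `|h| <= Num.min 1 (e / (C + 1)).
    near: h; apply: dnbhs0_le; rewrite lt_min ltr01/= divr_gt0//; lra.
  move: hle; rewrite le_min => /andP[h1 h2].
  rewrite sub0r normrN /= f0 subr0 addr0 [_%:A]mulr1 [X in `|X|]/GRing.scale/= normrM normfV.
  rewrite ler_pdivrMl ?normr_gt0//.
  apply: le_trans (fC h h1) _; rewrite -real_normK ?num_real// expr2 mulrCA ler_wpM2l//.
  apply: le_trans (_ : C * (e / (C + 1)) <= _); first by rewrite ler_wpM2l.
  by rewrite mulrCA ler_piMr ?(ltW e0)// ler_pdivrMr ?mul1r; lra.
have D : derivable f (0 : R) (1 : R) by apply/cvg_ex; exists 0.
by apply: DeriveDef => //; exact/cvg_lim.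
Unshelve. all: by end_near. Qed.

Lemma continuous_is_derive (f df : R -> R) :
  (forall x : R, is_derive x 1 f (df x)) -> continuous f.
Proof.
move=> fd x; apply: differentiable_continuous; apply/derivable1_diffP.
by case: (fd x).
Qed.

Lemma continuous_powR_pos (a t : R) : 0 < t -> {for t, continuous (fun u => u `^ a)}.
Proof.
move=> t0; apply: differentiable_continuous; apply/derivable1_diffP.
by case: (is_derive1_powR a t0).
Qed.

Lemma continuous_normr_powR (p : R) : 0 < p -> continuous (fun t : R => `|t| `^ p).
Proof.
move=> p0 t; have [->|t0] := eqVneq t 0; last first.
  apply: (@continuous_comp _ _ _ (fun t : R => `|t|) (fun u => u `^ p)).
    exact: norm_continuous.
  by apply: continuous_powR_pos; rewrite normr_gt0.
apply/cvgrPdist_le => e e0.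
have d0 : 0 < e `^ p^-1 by exact: powR_gt0.
have H : \forall u \near nbhs (0 : R), `|u| <= e `^ p^-1 by apply: (near_dist d0) => u; rewrite subr0; exact: ltW.
apply: filterS H => u ule.
rewrite normr0 powR0 ?gt_eqF// sub0r normrN ger0_norm ?powR_ge0//.
have -> : e = (e `^ p^-1) `^ p by rewrite -powRrM mulVf ?gt_eqF// powRr1// ltW.
by apply: ge0_ler_powR => //; rewrite ?nnegrE ?powR_ge0 ?(ltW p0).
Qed.

End one_variable_calculus.

Section continuity.
Context {R : realType} {T : topologicalType}.
Implicit Types (f g : T -> R).

Lemma cont_cst (c : R) : continuous (fun _ : T => c).
Proof. by move=> x; exact: cvg_cst. Qed.

Lemma cont_add f g : continuous f -> continuous g -> continuous (fun x => f x + g x).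
Proof. by move=> cf cg x; apply: cvgD; [exact: cf|exact: cg]. Qed.

Lemma cont_opp f : continuous f -> continuous (fun x => - f x).
Proof. by move=> cf x; apply: cvgN; exact: cf. Qed.

Lemma cont_sub f g : continuous f -> continuous g -> continuous (fun x => f x - g x).
Proof. by move=> cf cg; apply: cont_add => //; exact: cont_opp. Qed.

Lemma cont_mul f g : continuous f -> continuous g -> continuous (fun x => f x * g x).
Proof. by move=> cf cg x; apply: cvgM; [exact: cf|exact: cg]. Qed.

Lemma cont_comp (F : R -> R) f : continuous F -> continuous f -> continuous (fun x => F (f x)).
Proof. by move=> cF cf x; apply: continuous_comp; [exact: cf|exact: cF]. Qed.

Lemma cont_sum (I : Type) (r : seq I) (F : I -> T -> R) :
  (forall i, continuous (F i)) -> continuous (fun x => \sum_(i <- r) F i x).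
Proof.
move=> cF; rewrite (_ : (fun x => _) = \sum_(i <- r) F i); last first.
  by apply/funext => x; rewrite fct_sumE.
elim/big_rec : _ => [|i g _ cg]; first exact: cont_cst.
exact: (cont_add (cF i) cg).
Qed.

Lemma cont_at_mul f g (x : T) : continuous_at x f -> continuous_at x g ->
  continuous_at x (fun y => f y * g y).
Proof. by move=> cf cg; apply: cvgM. Qed.

Lemma cont_id : continuous (fun x : T => x).
Proof. by move=> x; exact: cvg_id. Qed.

Lemma continuous_squeeze0 f g (x : T) : {for x, continuous g} -> g x = 0 ->
  (forall y, `|f y| <= g y) -> {for x, continuous f}.
Proof.
move=> cg gx fg; rewrite /prop_for /continuous_at in cg *.
have fx : f x = 0 by apply/eqP; rewrite -normr_le0 -gx.
rewrite fx; rewrite gx in cg.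
apply: (@squeeze_cvgr _ _ _ _ (fun y => - g y) g) => //.
  by apply: nearW => y; rewrite -ler_norml.
by rewrite -oppr0; apply: cvgN.
Qed.

Lemma continuous_near_eq f g (x : T) : (\forall y \near x, f y = g y) ->
  {for x, continuous f} -> {for x, continuous g}.
Proof.
move=> fg; rewrite /prop_for /continuous_at (nbhs_singleton fg).
by apply: cvg_trans; exact: near_eq_cvg.
Qed.

End continuity.

Lemma cont_compose (S T U : topologicalType) (F : S -> T) (G : T -> U) :
  continuous F -> continuous G -> continuous (fun x : S => G (F x)).
Proof. by move=> cF cG x; apply: (@continuous_comp _ _ _ F G); [exact: cF|exact: cG]. Qed.

(** * A smooth approximation of the positive part *)

Section flat.
Context {R : realType}.
Implicit Types (k u : R) (j : nat).

(** The derivative of [u^-j exp (- k / u)] combines the same functions with [j + 1] and [j + 2], so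
    the family over all [j] is closed under differentiation. [softcut] is built on [j = 0]; the
    other indices carry the induction in [Ck_flat]. *)
Definition flat k j u : R := if 0 < u then u ^- j * expR (- (k / u)) else 0.

(** Comparing [expR (k / u)] with the single term of order [j + 2] of its series leaves exactly the
    factor [u ^+ 2] that [is_derive_small] asks for. *)
Lemma flat_bound k j : 0 < k -> exists2 C, 0 <= C & forall u, `|flat k j u| <= C * u ^+ 2.
Proof.
move=> k0; exists (((j.+2)`!)%:R / k ^+ j.+2).
  by rewrite divr_ge0// exprn_ge0// ltW.
move=> u; rewrite /flat; case: ifPn => u0; last first.
  by rewrite normr0 mulr_ge0 ?sqr_ge0// divr_ge0// exprn_ge0// ltW.
rewrite ger0_norm ?mulr_ge0 ?expR_ge0 ?invr_ge0 ?exprn_ge0 ?(ltW u0)//.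
have H : (k / u) ^+ j.+2 / (j.+2)`!%:R <= expR (k / u).
  by apply: le_trans (expR_ge1Dxn j.+1 _); rewrite ?lerDr// divr_ge0 ?ltW.
rewrite expRN -ler_pdivlMl ?invr_gt0 ?exprn_gt0// invrK.
rewrite -[leRHS]invrK lef_pV2 ?posrE ?expR_gt0//; last first.
  by rewrite invr_gt0 mulr_gt0 ?exprn_gt0// mulr_gt0 ?divr_gt0 ?exprn_gt0// ltr0n fact_gt0.
apply: le_trans H; rewrite le_eqVlt; apply/orP; left; apply/eqP.
rewrite expr_div_n -addn2 !exprD; field.
by rewrite !expf_neq0 ?gt_eqF// ltr0n fact_gt0.
Qed.

Lemma is_derive_flat k j u : 0 < k ->
  is_derive u 1 (flat k j) (- j%:R * flat k j.+1 u + k * flat k j.+2 u).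
Proof.
move=> k0; have [u0|u0|->] := ltgtP u 0.
- rewrite /flat !ifF ?le_gtF ?(ltW u0)// !mulr0 addr0.
  apply: (near_eq_is_derive _ (is_derive_const 0 u 1)).
  have u0' : 0 < - u by rewrite oppr_gt0.
  apply: (near_dist u0') => x; rewrite ltr_norml => /andP[_ xu].
  by rewrite ifF//; apply: le_gtF; lra.
- have un0 : u != 0 by rewrite gt_eqF.
  have Hid : is_derive u 1 (@id R) 1 by exact: is_derive_id.
  have D1 : is_derive u 1 (fun x : R => - (k / x)) (k / u ^+ 2).
    have := is_derive_prod (is_derive_const (- k) u 1) (@is_deriveV R id u 1 1 un0 Hid).
    rewrite (_ : (fun y : R => _) = (fun x : R => - (k / x))); last first.
      by apply/funext => x; rewrite mulNr.
    by move/is_derive_eq; apply; rewrite mulr0 addr0 /GRing.scale/= mulr1 mulrNN.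
  have D2 : is_derive u 1 (fun x : R => expR (- (k / x))) (expR (- (k / u)) * (k / u ^+ 2)).
    exact: (@is_derive1_comp R expR).
  have D3 : is_derive u 1 (fun x : R => x ^- j) (- (u ^+ j) ^- 2 * (j%:R * u ^+ j.-1)).
    have uj : u ^+ j != 0 by rewrite expf_neq0.
    have := @is_deriveV R (fun x => x ^+ j) u _ 1 uj (is_derive_pow j u).
    by move/is_derive_eq; apply.
  have D := is_derive_prod D3 D2.
  apply: (@near_eq_is_derive _ _ _ _ _ _ _ _ _ (is_derive_eq D _)).
    apply: (near_dist u0) => x; rewrite ltr_norml => /andP[xu _].
    by rewrite /flat ifT//; lra.
  rewrite /flat u0.
  clear D D3 D2; case: j => [|j].
    by rewrite !expr0 !invr1 mulr0n mul0r !mulr0 oppr0 mul0r; field.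
  rewrite /= !exprS; field.
  by rewrite expf_neq0.
- have [C C0 HC] := flat_bound j k0.
  apply: is_derive_eq; first by apply: (@is_derive_small _ _ C) => h _; exact: HC.
  by rewrite /flat ltxx !mulr0 addr0.
Unshelve. all: by end_near. Qed.

(* A smooth approximation of [max 0 u]: [u * exp (- k / u)] for [u > 0]. *)
Definition softcut k u : R := u * flat k 0 u.

Lemma softcut_le0 k u : u <= 0 -> softcut k u = 0.
Proof. by move=> u0; rewrite /softcut /flat ltNge u0 mulr0. Qed.

Lemma softcut_ge0 k u : 0 <= softcut k u.
Proof.
rewrite /softcut /flat; case: ifPn => u0; rewrite ?mulr0// expr0 invr1 mul1r.
by rewrite mulr_ge0 ?expR_ge0// ltW.
Qed.

Definition dsoftcut k u : R := flat k 0 u + k * flat k 1 u.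

Lemma is_derive_softcut k u : 0 < k -> is_derive u 1 (softcut k) (dsoftcut k u).
Proof.
move=> k0; have H := is_derive_prod (@is_derive_id _ _ u 1) (is_derive_flat 0 u k0).
apply: (is_derive_eq (H : is_derive u 1 (softcut k) _)); rewrite /dsoftcut /flat; case: ifPn => u0.
  by rewrite !expr0 mulr1 !expr2 expr1; field; rewrite gt_eqF.
by ring.
Qed.

(** For [u > 0] the derivative is [(1 + k / u) exp (- k / u)], and [1 + x <= exp x] bounds it by
    [1]. Hence composition with [softcut] never lengthens a gradient. *)
Lemma dsoftcut_itv k u : 0 < k -> 0 <= dsoftcut k u <= 1.
Proof.
move=> k0; rewrite /dsoftcut /flat; case: ifPn => u0; last by rewrite mulr0 addr0 lexx ler01.
rewrite expr0 invr1 mul1r expr1 mulrA -[X in X + _]mul1r -mulrDl.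
have ku : 0 < k / u by rewrite divr_gt0.
rewrite mulr_ge0 ?expR_ge0//=; last by lra.
by rewrite expRN ler_pdivrMr ?expR_gt0// mul1r expR_ge1Dx.
Qed.

(** Multiply [1 - k / u <= exp (- k / u) <= 1] by [u]. *)
Lemma softcut_near k u : 0 < k -> 0 <= u -> u - k <= softcut k u <= u.
Proof.
move=> k0; rewrite le_eqVlt => /predU1P[<-|u0].
  by rewrite softcut_le0// lexx andbT; lra.
rewrite /softcut /flat u0 expr0 invr1 mul1r.
have ku : 0 < k / u by rewrite divr_gt0.
apply/andP; split; last by rewrite ler_piMr ?(ltW u0)// expR_le1; lra.
have := expR_ge1Dx (- (k / u)) => H.
have : u * (1 + - (k / u)) <= u * expR (- (k / u)) by rewrite ler_wpM2l// ltW.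
by apply: le_trans; rewrite le_eqVlt; apply/orP; left; apply/eqP; field; rewrite gt_eqF.
Qed.

End flat.

(** * Functions of class C^k, gluing and reflections *)

Section smooth_functions.
Context {R : realType} {N : nat}.
Notation V := 'rV[R]_N.
Notation e_ i := (delta_mx ord0 i : V).
Implicit Types (f g s : V -> R) (k : nat) (x : V) (i : 'I_N).

Lemma is_derive_partial f g i x : is_derive x (e_ i) f (g x) -> partial i f x = g x.
Proof. by move=> [_ <-]. Qed.

Lemma Ck_continuous k f : Ck k f -> continuous f.
Proof. by case: k => [|k] // []. Qed.

Lemma Ck_is_derive k f i x : Ck k.+1 f -> is_derive x (e_ i) f (partial i f x).
Proof. by move=> [_ /(_ i)[/(_ x) H _]]; exact: (DeriveDef H erefl). Qed.

Lemma Ck_partial k f i : Ck k.+1 f -> Ck k (partial i f).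
Proof. by move=> [_ /(_ i)[]]. Qed.

(** Differentiability and the value of [partial] come together from [is_derive], so that each
    closure property below reduces to one differentiation rule and an induction on [k]. *)
Lemma CkS k f (df : 'I_N -> V -> R) : continuous f ->
  (forall i x, is_derive x (e_ i) f (df i x)) -> (forall i, Ck k (df i)) ->
  Ck k.+1 f.
Proof.
move=> cf fd Cdf; split => // i; split => [x|]; first by case: (fd i x).
rewrite (_ : partial i f = df i)//; apply/funext => x; exact: is_derive_partial.
Qed.

Lemma CkW k f : Ck k.+1 f -> Ck k f.
Proof.
elim: k f => [|k IH] f Hf; first exact: Ck_continuous Hf.
apply: (CkS (df := partial^~ f)); first exact: Ck_continuous Hf.
  by move=> i x; exact: Ck_is_derive Hf.
by move=> i; apply: IH; exact: Ck_partial.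
Qed.

Lemma Ck_const k (c : R) : Ck k (fun _ : V => c).
Proof.
elim: k c => [|k IH] c; first exact: cont_cst.
apply: (CkS (df := fun _ _ => 0)); first exact: cont_cst.
by move=> i; exact: IH.
Qed.

Lemma CkD k f g : Ck k f -> Ck k g -> Ck k (fun x => f x + g x).
Proof.
elim: k f g => [|k IH] f g Hf Hg; first exact: cont_add Hf Hg.
apply: (CkS (df := fun i x => partial i f x + partial i g x)).
- exact: cont_add (Ck_continuous Hf) (Ck_continuous Hg).
- by move=> i x; exact: is_derive_add (Ck_is_derive i x Hf) (Ck_is_derive i x Hg).
- by move=> i; apply: IH; exact: Ck_partial.
Qed.

Lemma CkM k f g : Ck k f -> Ck k g -> Ck k (fun x => f x * g x).
Proof.
elim: k f g => [|k IH] f g Hf Hg; first exact: cont_mul Hf Hg.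
apply: (CkS (df := fun i x => f x * partial i g x + g x * partial i f x)).
- exact: cont_mul (Ck_continuous Hf) (Ck_continuous Hg).
- by move=> i x; exact: is_derive_prod (Ck_is_derive i x Hf) (Ck_is_derive i x Hg).
- by move=> i; apply: CkD; apply: IH; by [exact: CkW|exact: Ck_partial].
Qed.

Lemma CkZ k (c : R) f : Ck k f -> Ck k (fun x => c * f x).
Proof. by move=> Hf; apply: CkM => //; exact: Ck_const. Qed.

Lemma Ck_sum k n (F : 'I_n -> V -> R) : (forall j, Ck k (F j)) ->
  Ck k (fun x => \sum_j F j x).
Proof.
move=> HF; rewrite (_ : (fun x => _) = \sum_j F j); last first.
  by apply/funext => x; rewrite fct_sumE.
elim/big_rec : _ => [|j g _ Hg]; first exact: Ck_const.
exact: (CkD (HF j) Hg).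
Qed.

Lemma is_derive_coord i j x :
  is_derive x (e_ i) (fun y : V => y ord0 j) ((j == i)%:R : R).
Proof.
apply/is_derive_lineP.
rewrite (_ : (fun h => _) = (fun h : R => x ord0 j + (j == i)%:R * h)); last first.
  by apply/funext => h; rewrite !mxE eqxx/= addrC mulrC.
have := is_derive_add (is_derive_const (x ord0 j) 0 (1 : R))
  (is_derive_prod (is_derive_const ((j == i)%:R : R) (0 : R) 1) (is_derive_id 0 (1 : R))).
by move/is_derive_eq; apply; rewrite !mulr0 add0r mulr1 addr0.
Qed.

Lemma Ck_coord k j : Ck k (fun y : V => y ord0 j).
Proof.
case: k => [|k]; first exact: coord_continuous.
apply: (CkS (df := fun i _ => (j == i)%:R)); first exact: coord_continuous.
  by move=> i x; exact: is_derive_coord.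
by move=> i; exact: Ck_const.
Qed.

Lemma Ck_comp k (F dF : R -> R) f : (forall x, is_derive (f x) 1 F (dF (f x))) ->
  Ck k (dF \o f) -> Ck k.+1 f -> Ck k.+1 (F \o f).
Proof.
move=> FdF HdF Hf; apply: (CkS (df := fun i x => dF (f x) * partial i f x)).
- move=> x; apply: continuous_comp; first exact: Ck_continuous Hf x.
  by apply: differentiable_continuous; apply/derivable1_diffP; case: (FdF x).
- by move=> i x; exact: is_derive_comp_line (FdF x) (Ck_is_derive i x Hf).
- by move=> i; apply: CkM => //; exact: Ck_partial.
Qed.

Lemma Ck_powR k (a : R) f : (forall x, 0 < f x) -> Ck k f ->
  Ck k (fun x => f x `^ a).
Proof.
move=> f0; elim: k a => [|k IH] a Hf.
  move=> x; apply: (@continuous_comp _ _ _ f (fun u => u `^ a)); first exact: Hf.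
  exact: continuous_powR_pos.
apply: (CkS (df := fun i x => a * f x `^ (a - 1) * partial i f x)).
- move=> x; apply: (@continuous_comp _ _ _ f (fun u => u `^ a)).
    exact: Ck_continuous Hf x.
  exact: continuous_powR_pos.
- move=> i x; exact: (@is_derive_comp_line _ _ (fun u => u `^ a) _ _ _ _ _ (is_derive1_powR _ (f0 x)) (Ck_is_derive i x Hf)).
- move=> i; apply: CkM; last exact: Ck_partial.
  by apply: CkZ; apply: IH; exact: CkW.
Qed.

(** [j] varies in the induction on [k], because differentiation raises it. *)
Lemma Ck_flat k (c : R) j f : 0 < c -> Ck k f -> Ck k (flat c j \o f).
Proof.
move=> c0; elim: k j => [|k IH] j Hf.
  move=> x; apply: continuous_comp; first exact: Hf.
  exact: (continuous_is_derive (fun u => is_derive_flat j u c0)).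
apply: (Ck_comp (dF := fun u => - j%:R * flat c j.+1 u + c * flat c j.+2 u)) => //.
  by move=> x; exact: is_derive_flat.
by apply: CkD; apply: CkZ; apply: IH; exact: CkW.
Qed.

Lemma Ck_softcut k (c : R) f : 0 < c -> Ck k f -> Ck k (softcut c \o f).
Proof. by move=> c0 Hf; apply: CkM => //; exact: Ck_flat. Qed.

Lemma is_derive_glue f s i x d : is_derive x (e_ i) f d ->
  (\forall y \near x, f y = 0) \/ (\forall y \near x, s y = s x) ->
  is_derive x (e_ i) (fun x => s x * f x) (s x * d).
Proof.
move=> Hf [Hx|Hx].
  have Z : is_derive x (e_ i) (fun _ : V => 0 : R) 0 by exact: is_derive_const.
  have -> : d = 0.
    have [_ <-] := Hf; apply: (@is_derive_partial _ (fun=> 0)).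
    by apply: near_eq_is_derive Z; apply: filterS Hx => y ->.
  rewrite mulr0; apply: near_eq_is_derive Z.
  by apply: filterS Hx => y ->; rewrite mulr0.
have := is_derive_prod (is_derive_const (s x) x (e_ i)) Hf.
rewrite mulr0 addr0; apply: near_eq_is_derive.
by apply: filterS Hx => y ->.
Qed.

(** [s] may jump, but only where [f] vanishes on a neighbourhood; elsewhere it is locally constant
    and acts as a scalar. It will be the sign that tells the two sides of a mirror apart. *)
Lemma Ck_glue k f s : Ck k f ->
  (forall x, (\forall y \near x, f y = 0) \/ (\forall y \near x, s y = s x)) ->
  Ck k (fun x => s x * f x).
Proof.
have C f' : continuous f' ->
    (forall x, (\forall y \near x, f' y = 0) \/ (\forall y \near x, s y = s x)) ->
    continuous (fun x => s x * f' x).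
  move=> cf' H x; have [Hx|Hx] := H x.
    apply: (@continuous_near_eq _ _ (fun=> 0)); last exact: cont_cst.
    by apply: filterS Hx => y ->; rewrite mulr0.
  have cs : continuous (fun y : V => s x * f' y).
    by apply: cont_mul => //; exact: cont_cst.
  apply: (@continuous_near_eq _ _ (fun y => s x * f' y)); last exact: cs.
  by apply: filterS Hx => y ->.
elim: k f => [|k IH] f Hf H; first exact: C.
have D i x : is_derive x (e_ i) (fun x => s x * f x) (s x * partial i f x).
  exact: is_derive_glue (Ck_is_derive i x Hf) (H x).
apply: (CkS (df := fun i x => s x * partial i f x)) => //.
  exact: C (Ck_continuous Hf) H.
move=> i; apply: IH; first exact: Ck_partial.
move=> x; have [Hx|Hx] := H x; [left|by right].
(* The dichotomy passes to [partial i f]: if [f] vanishes near [x], it vanishes near every point of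
   some neighbourhood of [x], and its partial derivatives are [0] there. *)
apply: filterS (nbhs_interior Hx) => y Hy.
apply: (@is_derive_partial _ (fun=> 0)).
apply: near_eq_is_derive (is_derive_const 0 y (e_ i)).
by apply: filterS Hy => z ->.
Qed.

(** The reflection in the hyperplane where coordinate [i] equals [h / 2]. Being [coordwise], it
    preserves the measure by [lebesgue_rV_coordwise]. *)
Definition flip i (h : R) x : V := coordwise (fun j t => if j == i then h - t else t) x.

Lemma flipE i h x j : flip i h x ord0 j = if j == i then h - x ord0 j else x ord0 j.
Proof. by rewrite mxE. Qed.

Lemma flipK i h : involutive (flip i h).
Proof.
by move=> x; apply/rowP => j; rewrite !flipE; have [_|_] := eqVneq j i => //; rewrite opprB addrC subrK.
Qed.

Lemma is_derive_flip i h j x f d : is_derive (flip i h x) (e_ j) f d ->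
  is_derive x (e_ j) (f \o flip i h) ((-1) ^+ (j == i) * d).
Proof.
move=> /is_derive_lineP H; apply/is_derive_lineP.
rewrite (_ : (fun t => _) = (fun t : R => f (t *: e_ j + flip i h x)) \o (fun t : R => (-1) ^+ (j == i) * t)).
  have D : is_derive (0 : R) 1 (fun t : R => (-1) ^+ (j == i) * t) ((-1) ^+ (j == i)).
    have := is_derive_prod (is_derive_const ((-1) ^+ (j == i) : R) (0 : R) 1) (is_derive_id 0 (1 : R)).
    by move/is_derive_eq; apply; rewrite mulr1 mulr0 addr0.
  have := @is_derive1_comp R (fun t : R => f (t *: e_ j + flip i h x)) _ 0 d _ _ D.
  by rewrite mulr0 mulrC; apply.
apply/funext => t /=; congr f; apply/rowP => l; rewrite !(mxE, flipE) eqxx/=.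
have [->|ji] := eqVneq j i; have [->|li] := eqVneq l i.
- by rewrite expr1; ring.
- by rewrite !mulr0.
- by rewrite (eq_sym i) (negbTE ji) expr0 /= mulr0n; ring.
- by rewrite expr0 mul1r.
Qed.

Lemma continuous_rV (T : topologicalType) (F : T -> V) :
  (forall j, continuous (fun t => F t ord0 j)) -> continuous F.
Proof.
move=> cF t; apply/cvgrPdist_lt => e e0.
have : forall j, \forall u \near t, `|F t ord0 j - F u ord0 j| < e.
  by move=> j; have /cvgrPdist_lt/(_ e e0) := cF j t.
move=> /filter_forall H; apply: filterS H => u Hu.
have /seteqP[_ /(_ (F u) Hu)] := ball_rVE (F t) e0.
by rewrite -ball_normE.
Qed.

Lemma continuous_coord (T : topologicalType) (F : T -> V) j :
  continuous F -> continuous (fun t : T => F t ord0 j).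
Proof.
move=> cF t; apply: (@continuous_comp _ _ _ F (fun x : V => x ord0 j)); first exact: cF.
exact: coord_continuous.
Qed.

Lemma continuous_addv (v : V) : continuous (fun x : V => v + x).
Proof.
apply: continuous_rV => j.
rewrite (_ : (fun t : V => _) = (fun t : V => v ord0 j + t ord0 j)).
  by apply: cont_add; [exact: cont_cst|exact: coord_continuous].
by apply/funext => t; rewrite !mxE.
Qed.

Lemma continuous_flip i h : continuous (flip i h).
Proof.
apply: continuous_rV => j; under eq_fun do rewrite flipE.
case: eqP => _; last exact: coord_continuous.
by apply: cont_sub; [exact: cont_cst|exact: coord_continuous].
Qed.

Lemma Ck_flip k i h f : Ck k f -> Ck k (f \o flip i h).
Proof.
elim: k f => [|k IH] f Hf.
  by move=> x; apply: continuous_comp; [exact: continuous_flip|exact: Hf].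
apply: (CkS (df := fun j x => (-1) ^+ (j == i) * partial j f (flip i h x))).
- move=> x; apply: continuous_comp; first exact: continuous_flip.
  exact: Ck_continuous Hf _.
- by move=> j x; apply: is_derive_flip; exact: (Ck_is_derive j _ Hf).
- by move=> j; apply: CkZ; apply: (IH (partial j f)); exact: Ck_partial.
Qed.

End smooth_functions.

(** * Convexity of powers of the Euclidean norm *)

Section powers.
Context {R : realType}.
Implicit Types (a b p t : R).

Lemma young_powR p a b : 1 < p -> 0 <= a -> 0 <= b ->
  a `^ (p - 1) * b <= (1 - p^-1) * a `^ p + p^-1 * b `^ p.
Proof.
move=> p1 a0 b0; have p0 : 0 < p by lra.
have q0 : 0 < p / (p - 1) by rewrite divr_gt0//; lra.
have pq : (p / (p - 1))^-1 + p^-1 = 1 by field; apply/andP; split; lra.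
have := conjugate_powR (powR_ge0 a (p - 1)) b0 q0 p0 pq.
rewrite -powRrM (_ : (p - 1) * (p / (p - 1)) = p); last by field; lra.
rewrite (_ : (p / (p - 1))^-1 = 1 - p^-1); last by field; apply/andP; split; lra.
by rewrite [X in _ <= X + _]mulrC [X in _ <= _ + X]mulrC.
Qed.

Lemma powR_succ p a : 1 < p -> 0 <= a -> a `^ (p - 1) * a = a `^ p.
Proof.
move=> p1; rewrite le_eqVlt => /predU1P[<-|a0].
  by rewrite mulr0 powR0//; lra.
by rewrite -[X in _ * X](powRr1 (ltW a0)) -powRD ?subrK// (gt_eqF a0) implybT.
Qed.

(** The mean value theorem on the two halves of the interval compares the increments of the power
    through its derivative, which is strictly increasing. *)
Lemma strict_midpoint_powR p a b : 1 < p -> 0 <= a -> 0 <= b -> a != b ->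
  ((a + b) / 2) `^ p < (a `^ p + b `^ p) / 2.
Proof.
move=> p1; wlog ab : a b / a < b.
  move=> H a0 b0; rewrite neq_lt => /orP[ab|ab].
    by apply: H => //; rewrite lt_eqF.
  by rewrite addrC [X in _ < X / 2]addrC; apply: H => //; rewrite lt_eqF.
move=> a0 b0 _; set m := (a + b) / 2.
have am : a < m by rewrite /m; lra.
have mb : m < b by rewrite /m; lra.
(* The absolute value makes the power continuous on the whole line, so that the endpoint [a = 0] is
   covered. *)
have cp : continuous (fun t : R => `|t| `^ p) by apply: continuous_normr_powR; lra.
have M c d : 0 <= c -> c < d -> exists2 x, c < x < d &
    d `^ p - c `^ p = p * x `^ (p - 1) * (d - c).
  move=> c0 cd.
  have D x : x \in `]c, d[ -> is_derive x 1 (fun t : R => `|t| `^ p) (p * x `^ (p - 1)).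
    rewrite in_itv/= => /andP[cx xd]; have x0 : 0 < x by lra.
    apply: near_eq_is_derive (is_derive1_powR p x0).
    apply: (near_dist x0) => y; rewrite ltr_norml => /andP[yx _].
    by rewrite ger0_norm//; lra.
  have [x] := MVT cd D (continuous_subspaceT cp).
  rewrite in_itv/= => cxd; rewrite !ger0_norm//; last lra.
  by move=> E; exists x.
have [x /andP[ax xm] Ex] := M _ _ a0 am.
have m0 : 0 <= m by lra.
have [y /andP[my yb] Ey] := M _ _ m0 mb.
have xy : x `^ (p - 1) < y `^ (p - 1).
  by apply: gt0_ltr_powR; rewrite ?nnegrE; lra.
have : p * x `^ (p - 1) * (m - a) < p * y `^ (p - 1) * (b - m).
  have -> : b - m = m - a by rewrite /m; lra.
  by rewrite ltr_pM2r ?subr_gt0// ltr_pM2l//; lra.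
lra.
Qed.

(** If [|t| <= e] the first term suffices; otherwise [(|t| / e)^(p - 1) >= 1] and the second one
    does. A linear term is thereby controlled by a small constant and a [p]th power. *)
Lemma normr_le_powR p (e t : R) : 1 < p -> 0 < e ->
  `|t| <= e + e `^ (1 - p) * `|t| `^ p.
Proof.
move=> p1 e0; have [te|te] := leP `|t| e.
  by rewrite (le_trans te)// lerDl mulr_ge0 ?powR_ge0.
have t0 : 0 < `|t| by lra.
apply: (@le_trans _ _ (e `^ (1 - p) * `|t| `^ p)); last by rewrite lerDr ltW.
rewrite -(powR_succ p1 (ltW t0)) mulrA.
have h : 1 <= e `^ (1 - p) * `|t| `^ (p - 1).
  have -> : 1 - p = - (p - 1) by ring.
  rewrite powRN mulrC ler_pdivlMr ?powR_gt0// mul1r.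
  by apply: ge0_ler_powR; rewrite ?nnegrE; lra.
by rewrite -[leLHS]mul1r ler_wpM2r// ltW.
Qed.

Lemma tangent_aux p A B X : 1 < p -> X <= (1 - p^-1) * A + p^-1 * B ->
  A + p * (X - A) <= B.
Proof.
move=> p1 H; have p0 : 0 < p by lra.
have : p * X <= p * ((1 - p^-1) * A + p^-1 * B) by rewrite ler_pM2l.
have -> : p * ((1 - p^-1) * A + p^-1 * B) = (p - 1) * A + B by field; rewrite gt_eqF.
lra.
Qed.

End powers.

Section euclidean.
Context {R : realType} {N : nat}.
Notation V := 'rV[R]_N.
Implicit Types (x y z a b : V) (p t : R).

Lemma dotvC x y : dotv x y = dotv y x.
Proof. by apply: eq_bigr => i _; rewrite mulrC. Qed.

Lemma dotvDl x y z : dotv (x + y) z = dotv x z + dotv y z.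
Proof. by rewrite -big_split; apply: eq_bigr => i _; rewrite mxE mulrDl. Qed.

Lemma dotvZl t x y : dotv (t *: x) y = t * dotv x y.
Proof. by rewrite mulr_sumr; apply: eq_bigr => i _; rewrite mxE mulrA. Qed.

Lemma dotvDr x y z : dotv x (y + z) = dotv x y + dotv x z.
Proof. by rewrite dotvC dotvDl !(dotvC _ x). Qed.

Lemma dotvZr t x y : dotv x (t *: y) = t * dotv x y.
Proof. by rewrite dotvC dotvZl dotvC. Qed.

Lemma dotvNr x y : dotv x (- y) = - dotv x y.
Proof. by rewrite -scaleN1r dotvZr mulN1r. Qed.

Lemma dotvNl x y : dotv (- x) y = - dotv x y.
Proof. by rewrite dotvC dotvNr dotvC. Qed.

Lemma dotv0l x : dotv 0 x = 0.
Proof. by rewrite -(scale0r 0) dotvZl mul0r. Qed.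

Lemma dotv_ge0 x : 0 <= dotv x x.
Proof. by apply: sumr_ge0 => i _; rewrite -expr2 sqr_ge0. Qed.

Lemma enorm_ge0 x : 0 <= enorm x.
Proof. exact: sqrtr_ge0. Qed.

Lemma enorm_sq x : enorm x ^+ 2 = dotv x x.
Proof. by rewrite sqr_sqrtr// dotv_ge0. Qed.

Lemma enorm0 : enorm (0 : V) = 0.
Proof. by rewrite /enorm dotv0l sqrtr0. Qed.

Lemma enormZ t x : enorm (t *: x) = `|t| * enorm x.
Proof.
by rewrite /enorm dotvZl dotvZr mulrA -expr2 sqrtrM ?sqr_ge0// sqrtr_sqr.
Qed.

Lemma enormN x : enorm (- x) = enorm x.
Proof. by rewrite -scaleN1r enormZ normrN1 mul1r. Qed.

Lemma coord_le_enorm x i : `|x ord0 i| <= enorm x.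
Proof.
rewrite -sqrtr_sqr /enorm ler_wsqrtr// /dotv (bigD1 i)//= expr2 lerDl.
by apply: sumr_ge0 => j _; rewrite -expr2 sqr_ge0.
Qed.

Lemma enorm_eq0 x : enorm x = 0 -> x = 0.
Proof.
move=> x0; apply/rowP => i; rewrite mxE; apply/eqP; rewrite -normr_le0.
by rewrite -x0 coord_le_enorm.
Qed.

Lemma CauchySchwarz x y : dotv x y <= enorm x * enorm y.
Proof.
have [/enorm_eq0 ->|x0] := eqVneq (enorm x) 0; first by rewrite dotv0l enorm0 mul0r.
have [/enorm_eq0 ->|y0] := eqVneq (enorm y) 0; first by rewrite dotvC dotv0l enorm0 mulr0.
have xp : 0 < enorm x by rewrite lt_neqAle eq_sym x0 enorm_ge0.
have yp : 0 < enorm y by rewrite lt_neqAle eq_sym y0 enorm_ge0.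
have := dotv_ge0 (enorm y *: x - enorm x *: y).
rewrite dotvDl dotvNl !dotvDr !dotvNr !dotvZl !dotvZr (dotvC y x) -!enorm_sq => H.
have : 0 <= (enorm x * enorm y) * (enorm x * enorm y - dotv x y).
  set A := enorm x in H *; set B := enorm y in H *; nra.
by rewrite pmulr_rge0 ?mulr_gt0// subr_ge0.
Qed.

Lemma normr_dotv x y : `|dotv x y| <= enorm x * enorm y.
Proof.
rewrite ler_norml CauchySchwarz andbT lerNl -dotvNl -(enormN x).
exact: CauchySchwarz.
Qed.

Lemma enormD x y : enorm (x + y) <= enorm x + enorm y.
Proof.
rewrite -(@ler_pXn2r _ 2)// ?nnegrE ?addr_ge0 ?enorm_ge0//.
rewrite enorm_sq dotvDl !dotvDr (dotvC y x) sqrrD -!enorm_sq.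
have := CauchySchwarz x y; lra.
Qed.

Lemma enorm_le_sum x : enorm x <= \sum_i `|x ord0 i|.
Proof.
rewrite -[leRHS]ger0_norm ?sumr_ge0// -sqrtr_sqr /enorm ler_wsqrtr//.
rewrite expr2 mulr_suml /dotv; apply: ler_sum => i _.
apply: le_trans (ler_norm _) _; rewrite normrM ler_wpM2l//.
by rewrite (bigD1 i)//= lerDl sumr_ge0.
Qed.

Lemma parallelogram x y :
  enorm (2^-1 *: (x + y)) ^+ 2 =
  (enorm x ^+ 2 + enorm y ^+ 2) / 2 - (enorm (x - y) / 2) ^+ 2.
Proof.
rewrite expr_div_n !enorm_sq dotvZl dotvZr !dotvDl !dotvDr !dotvNl !dotvNr (dotvC y x).
by field.
Qed.

Lemma continuous_dotv (T : topologicalType) (f g : T -> V) :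
  continuous f -> continuous g -> continuous (fun t : T => dotv (f t) (g t)).
Proof.
by move=> cf cg; apply: cont_sum => i; apply: cont_mul; exact: continuous_coord.
Qed.

Lemma continuous_enorm : continuous (@enorm R N).
Proof.
apply: (@cont_comp R _ (@Num.sqrt R)); first exact: sqrt_continuous.
apply: (@continuous_dotv _ idfun idfun); exact: cont_id.
Qed.

Lemma continuous_enorm_powR p : 0 < p -> continuous (fun x => enorm x `^ p).
Proof.
move=> p0 x.
have -> : (fun x => enorm x `^ p) = (fun t : R => `|t| `^ p) \o (@enorm R N).
  by apply/funext => y /=; rewrite ger0_norm ?enorm_ge0.
apply: continuous_comp; first exact: continuous_enorm.
exact: continuous_normr_powR.
Qed.

Lemma continuous_subv a : continuous (fun x : V => x - a).
Proof.
apply: continuous_rV => j.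
rewrite (_ : (fun t : V => _) = (fun t : V => t ord0 j - a ord0 j)).
  by apply: cont_sub; [exact: coord_continuous|exact: cont_cst].
by apply/funext => t; rewrite !mxE.
Qed.

Lemma measurable_eball a r : measurable (eball a r).
Proof.
apply: measurable_open_rV.
rewrite (_ : eball a r = (fun x => enorm (x - a)) @^-1` `]-oo, r[%classic).
  apply: open_comp => [x _|]; last exact: interval_open.
  apply: (@continuous_comp _ _ _ (fun x => x - a) (@enorm R N)); last exact: continuous_enorm.
  exact: continuous_subv.
by apply/seteqP; split => x /=; rewrite in_itv.
Qed.

(* The case a = 0 relies on 0 `^ (p - 2) being multiplied by 0. *)
Lemma flux_le p a b : 1 < p ->
  `|enorm a `^ (p - 2) * dotv a b| <= enorm a `^ (p - 1) * enorm b.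
Proof.
move=> p1; have [a0|a0] := eqVneq (enorm a) 0.
  by rewrite (enorm_eq0 a0) dotv0l mulr0 normr0 mulr_ge0 ?powR_ge0 ?enorm_ge0.
have ap : 0 < enorm a by rewrite lt_neqAle eq_sym a0 enorm_ge0.
rewrite normrM ger0_norm ?powR_ge0//.
have -> : enorm a `^ (p - 1) = enorm a `^ (p - 2) * enorm a.
  rewrite -[X in _ * X](powRr1 (ltW ap)) -powRD ?(gt_eqF ap) ?implybT//.
  by congr (_ `^ _); ring.
rewrite -mulrA.
by rewrite ler_wpM2l ?powR_ge0// normr_dotv.
Qed.

Lemma flux_self p a : 1 < p -> enorm a `^ (p - 2) * dotv a a = enorm a `^ p.
Proof.
move=> p1; have [a0|a0] := eqVneq (enorm a) 0.
  by rewrite (enorm_eq0 a0) dotv0l mulr0 enorm0 powR0//; lra.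
have ap : 0 < enorm a by rewrite lt_neqAle eq_sym a0 enorm_ge0.
rewrite -enorm_sq -powR_mulrn ?enorm_ge0// -powRD ?(gt_eqF ap) ?implybT//.
by rewrite subrK.
Qed.

(** The tangent inequality for the convex function [|.|^p], obtained from the Cauchy-Schwarz and
    Young inequalities. The convexity facts and energy comparisons below rest on it. *)
Lemma gradient_inequality p a b : 1 < p ->
  enorm a `^ p + p * (enorm a `^ (p - 2) * dotv a (b - a)) <= enorm b `^ p.
Proof.
move=> p1; rewrite dotvDr dotvNr mulrBr flux_self//.
have H1 := le_trans (ler_norm _) (flux_le a b p1).
have H2 := young_powR p1 (enorm_ge0 a) (enorm_ge0 b).
apply: tangent_aux => //; exact: le_trans H1 H2.
Qed.

(** The tangent inequality is taken at the combination [m] towards both ends; weighted by [t] and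
    [1 - t], the linear terms cancel. *)
Lemma enorm_powR_convex p t a b : 1 < p -> 0 <= t <= 1 ->
  enorm (t *: a + (1 - t) *: b) `^ p <= t * enorm a `^ p + (1 - t) * enorm b `^ p.
Proof.
move=> p1 /andP[t0 t1]; set m := t *: a + _.
have Ha := gradient_inequality m a p1; have Hb := gradient_inequality m b p1.
have E : t * dotv m (a - m) + (1 - t) * dotv m (b - m) = 0.
  rewrite -!dotvZr -dotvDr (_ : _ + _ = 0) 1?dotvC ?dotv0l//.
  by rewrite !scalerBr addrACA -/m -opprD -scalerDl [t + _]addrC subrK scale1r subrr.
set M := enorm m `^ p in Ha Hb *; set F := enorm m `^ (p - 2) in Ha Hb.
have : t * (M + p * (F * dotv m (a - m))) + (1 - t) * (M + p * (F * dotv m (b - m))) <=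
    t * enorm a `^ p + (1 - t) * enorm b `^ p.
  by apply: lerD; apply: ler_wpM2l => //; rewrite subr_ge0.
have -> : t * (M + p * (F * dotv m (a - m))) + (1 - t) * (M + p * (F * dotv m (b - m))) =
  M + p * F * (t * dotv m (a - m) + (1 - t) * dotv m (b - m)) by ring.
by rewrite E mulr0 addr0.
Qed.

Lemma enorm_powR_midpoint p a b : 1 < p ->
  enorm (2^-1 *: (a + b)) `^ p <= (enorm a `^ p + enorm b `^ p) / 2.
Proof.
move=> p1; have h : 0 <= (2^-1 : R) <= 1 by lra.
have := enorm_powR_convex a b p1 h.
have -> : 1 - 2^-1 = (2^-1 : R) by field.
by rewrite scalerDr [X in _ -> _ <= X]mulrC mulrDr.
Qed.

(** Equality forces [|a| = |b|] by strict convexity of the power on the half line; then the midpoint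
    has the same length as well, and the parallelogram law gives [a - b = 0]. *)
Lemma enorm_powR_strict p a b : 1 < p ->
  enorm (2^-1 *: (a + b)) `^ p = (enorm a `^ p + enorm b `^ p) / 2 -> a = b.
Proof.
move=> p1 E.
have h2 : `|2^-1 : R| = 2^-1 by rewrite ger0_norm.
have le1 : enorm (2^-1 *: (a + b)) <= (enorm a + enorm b) / 2.
  by rewrite enormZ h2 mulrC ler_wpM2r// enormD.
have ab : enorm a = enorm b.
  apply/eqP/negPn/negP => /(strict_midpoint_powR p1 (enorm_ge0 a) (enorm_ge0 b)).
  rewrite -E ltNge => /negP; apply.
  by apply: ge0_ler_powR; rewrite ?nnegrE ?enorm_ge0 ?divr_ge0 ?addr_ge0 ?enorm_ge0//; lra.
have Em : enorm (2^-1 *: (a + b)) = enorm b.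
  have : enorm (2^-1 *: (a + b)) `^ p = enorm b `^ p by rewrite E ab mulrDl -splitr.
  by move/powR_injective; apply; rewrite ?nnegrE ?enorm_ge0//; lra.
have := parallelogram a b; rewrite Em ab => H.
have : enorm (a - b) ^+ 2 = 0 by move: H; rewrite expr_div_n; lra.
move/eqP; rewrite sqrf_eq0 => /eqP/enorm_eq0/eqP.
by rewrite subr_eq0 => /eqP.
Qed.

Lemma enorm_powRD p a b : 1 < p ->
  enorm (a + b) `^ p <= 2 `^ p * (enorm a `^ p + enorm b `^ p).
Proof.
move=> p1; have -> : a + b = 2 *: (2^-1 *: (a + b)).
  by rewrite scalerA divff// scale1r.
rewrite enormZ ger0_norm// powRM ?enorm_ge0// ler_wpM2l ?powR_ge0//.
apply: le_trans (enorm_powR_midpoint _ _ p1) _.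
by have := powR_ge0 (enorm a) p; have := powR_ge0 (enorm b) p; lra.
Qed.

(** A compactness argument on the set where [|a|^p + |b|^p = 1], extended by homogeneity; the
    constant [K] is the quotient of the maximum of [F] by the minimum of [H] over the part where
    [F >= e]. It gives one proof for all [p > 1] of inequalities whose explicit forms depend on
    whether [p] is below or above [2]. *)
Lemma homogeneous_bound p (F H : V * V -> R) (e : R) : 1 < p -> 0 < e ->
  continuous F -> continuous H ->
  (forall t a b, 0 <= t -> F (t *: a, t *: b) = t `^ p * F (a, b)) ->
  (forall t a b, 0 <= t -> H (t *: a, t *: b) = t `^ p * H (a, b)) ->
  (forall ab, 0 <= H ab) -> (forall ab, H ab = 0 -> F ab <= 0) ->
  exists2 K, 0 <= K & forall a b,
    F (a, b) <= e * (enorm a `^ p + enorm b `^ p) + K * H (a, b).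
Proof.
move=> p1 e0 cF cH hF hH H0 HF; have p0 : 0 < p by lra.
pose n (ab : V * V) := enorm ab.1 `^ p + enorm ab.2 `^ p.
have cn : continuous n.
  apply: cont_add => x.
    by apply: (@continuous_comp _ _ _ fst (fun a : V => enorm a `^ p));
      [exact: cvg_fst|exact: continuous_enorm_powR].
  by apply: (@continuous_comp _ _ _ snd (fun a : V => enorm a `^ p));
      [exact: cvg_snd|exact: continuous_enorm_powR].
(* On the compact set [S] the function [H] is positive, since [H = 0] would give [F <= 0 < e]. Where
   [n] is [1] but [F < e], the term [e] alone suffices. *)
pose S := [set ab | n ab = 1 /\ e <= F ab].
have cS : closed S.
  rewrite (_ : S = n @^-1` [set 1] `&` F @^-1` [set t | e <= t])//.
  by apply: closedI; apply: closed_comp.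
have cB : compact [set a : V | enorm a <= 1].
  apply: bounded_closed_compact.
    exists 1; split => // M M1 a /= a1.
    rewrite [leLHS]/Num.Def.normr/= mx_normrE; apply/bigmax_leP; split; first lra.
    move=> -[i j] _ /=; rewrite (ord1 i).
    by apply: le_trans (coord_le_enorm _ _) _; lra.
  apply: (closed_comp (f := @enorm R N) (D := [set t | t <= 1])).
    by move=> x _; exact: continuous_enorm.
  exact: closed_le.
have kS : compact S.
  apply: subclosed_compact cS (compact_setX cB cB) _ => -[a b] [/= nab _].
  have an (c : V) : enorm c `^ p <= 1 -> enorm c <= 1.
    move=> c1; rewrite leNgt; apply/negP => c2; move: c1; rewrite leNgt => /negP; apply.
    have : 1 `^ p < enorm c `^ p.
      by apply: gt0_ltr_powR; rewrite ?nnegrE ?enorm_ge0.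
    by rewrite powR1.
  have := powR_ge0 (enorm a) p; have := powR_ge0 (enorm b) p.
  by move: nab; rewrite /n/= => nab ? ?; split => /=; apply: an; rewrite -nab ?lerDl ?lerDr.
have [K K0 HK] : exists2 K, 0 <= K & forall ab, n ab = 1 -> F ab <= e + K * H ab.
  have [Sn0|/set0P S0] := eqVneq S set0.
    exists 0 => // ab nab; rewrite mul0r addr0 leNgt; apply/negP => eF.
    have : S ab by split => //; exact: ltW.
    by rewrite Sn0.
  have [c1 c1S Hc1] := compact_EVT_max S0 kS (continuous_subspaceT cF).
  have [c2 c2S Hc2] := compact_EVT_min S0 kS (continuous_subspaceT cH).
  have {}c2S := set_mem c2S; have {}c1S := set_mem c1S.
  have Hc2p : 0 < H c2.
    rewrite lt_neqAle H0 andbT eq_sym; apply/negP => /eqP /HF.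
    by have := c2S.2; lra.
  exists (F c1 / H c2).
    by rewrite divr_ge0// ?(ltW Hc2p)//; have := c1S.2; lra.
  move=> ab nab; have [eF|eF] := leP e (F ab); last first.
    have : 0 <= F c1 / H c2 * H ab.
      by rewrite mulr_ge0// divr_ge0// ?(ltW Hc2p)//; have := c1S.2; lra.
    lra.
  have abS : ab \in S by apply/mem_set.
  have := Hc1 _ abS; have := Hc2 _ abS => h2 h1.
  have : F c1 <= F c1 / H c2 * H ab.
    rewrite mulrAC ler_pdivlMr// ler_wpM2l//; have := c1S.2; lra.
  lra.
exists K => // a b.
have [nab|nab] := eqVneq (n (a, b)) 0.
  have ab0 : a = 0 /\ b = 0.
    have := powR_ge0 (enorm a) p; have := powR_ge0 (enorm b) p.
    rewrite /n/= in nab => ? ?.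
    split; apply: enorm_eq0; apply/eqP; move: nab.
      have : enorm a `^ p == 0 -> enorm a == 0 by rewrite powR_eq0 => /andP[].
      by move=> h ?; apply: h; apply/eqP; lra.
    have : enorm b `^ p == 0 -> enorm b == 0 by rewrite powR_eq0 => /andP[].
    by move=> h ?; apply: h; apply/eqP; lra.
  have E : (a, b) = (0 *: (0 : V), 0 *: (0 : V)) by rewrite !scale0r ab0.1 ab0.2.
  have := hF 0 (0 : V) (0 : V) (lexx 0); rewrite -E powR0 ?gt_eqF// mul0r => ->.
  by rewrite addr_ge0 ?mulr_ge0 ?addr_ge0 ?powR_ge0 ?(ltW e0)//.
have np : 0 < n (a, b) by rewrite lt_neqAle eq_sym nab/= addr_ge0 ?powR_ge0.
(* Dividing [(a, b)] by [s] brings it to the set where [n] is [1]. *)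
pose s := n (a, b) `^ p^-1.
have s0 : 0 < s by exact: powR_gt0.
have sp : s `^ p = n (a, b) by rewrite -powRrM mulVf ?gt_eqF// powRr1// ltW.
have Ea : a = s *: (s^-1 *: a) by rewrite scalerA divff ?gt_eqF// scale1r.
have Eb : b = s *: (s^-1 *: b) by rewrite scalerA divff ?gt_eqF// scale1r.
have n1 : n (s^-1 *: a, s^-1 *: b) = 1.
  rewrite /n/= !enormZ ger0_norm ?invr_ge0 ?(ltW s0)//.
  rewrite !powRM ?enorm_ge0 ?invr_ge0 ?(ltW s0)// -mulrDr -powR_inv1 ?(ltW s0)// -powRrM mulN1r powRN sp.
  by rewrite -/(n (a, b)) mulVf.
have EF : F (a, b) = s `^ p * F (s^-1 *: a, s^-1 *: b).
  by rewrite -hF ?(ltW s0)// -Ea -Eb.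
have EH : H (a, b) = s `^ p * H (s^-1 *: a, s^-1 *: b).
  by rewrite -hH ?(ltW s0)// -Ea -Eb.
rewrite EF EH sp -[enorm a `^ p + _]/(n (a, b)).
apply: le_trans (ler_wpM2l (ltW np) (HK _ n1)) _.
by rewrite mulrDr (mulrC e) mulrCA.
Qed.

(** Uniform convexity with a small error: [H] is the convexity defect at the midpoint, and it
    vanishes only for [a = b] by [enorm_powR_strict]. *)
Lemma powR_diff_bound p (e : R) : 1 < p -> 0 < e ->
  exists2 K, 0 <= K & forall a b, enorm (a - b) `^ p <=
    e * (enorm a `^ p + enorm b `^ p) +
    K * ((enorm a `^ p + enorm b `^ p) / 2 - enorm (2^-1 *: (a + b)) `^ p).
Proof.
move=> p1 e0; have p0 : 0 < p by lra.
have c1 : continuous (fun ab : V * V => ab.1) by move=> x; exact: cvg_fst.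
have c2 : continuous (fun ab : V * V => ab.2) by move=> x; exact: cvg_snd.
have cp (G : V * V -> V) : continuous G -> continuous (fun ab => enorm (G ab) `^ p).
  move=> cG x; apply: (@continuous_comp _ _ _ G (fun v => enorm v `^ p)); first exact: cG.
  exact: continuous_enorm_powR.
pose F (ab : V * V) := enorm (ab.1 - ab.2) `^ p.
pose H (ab : V * V) := (enorm ab.1 `^ p + enorm ab.2 `^ p) / 2 - enorm (2^-1 *: (ab.1 + ab.2)) `^ p.
have hZ t (v : V) : 0 <= t -> enorm (t *: v) `^ p = t `^ p * enorm v `^ p.
  by move=> t0; rewrite enormZ ger0_norm// powRM ?enorm_ge0.
apply: (@homogeneous_bound p F H e p1 e0).
- apply: cp => x; apply: cvgB; [exact: c1|exact: c2].
- apply: cont_sub.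
    apply: cont_mul; last exact: cont_cst.
    by apply: cont_add; [exact: (cp fst)|exact: (cp snd)].
  apply: cp => x; apply: cvgZr; apply: cvgD; [exact: c1|exact: c2].
- by move=> t a b t0; rewrite /F/= -scalerBr hZ.
- move=> t a b t0; rewrite /H/= -scalerDr scalerA mulrC -scalerA !hZ//.
  by set A := enorm a `^ p; set B := enorm b `^ p; set C := enorm _ `^ p; ring.
- by move=> [a b]; rewrite /H/= subr_ge0 enorm_powR_midpoint.
- move=> [a b]; rewrite /H/F/= => /eqP; rewrite subr_eq0 => /eqP/esym/(enorm_powR_strict p1) ->.
  by rewrite subrr enorm0 powR0// gt_eqF.
Qed.

(** Used to pass from convergence of gradients in [L^p] to convergence of their Dirichlet
    integrals. *)
Lemma powR_enorm_diff_bound p (e : R) : 1 < p -> 0 < e ->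
  exists2 K, 0 <= K & forall a b, `|enorm a `^ p - enorm b `^ p| <=
    e * (enorm a `^ p + enorm b `^ p) + K * enorm (a - b) `^ p.
Proof.
move=> p1 e0; have p0 : 0 < p by lra.
have c1 : continuous (fun ab : V * V => ab.1) by move=> x; exact: cvg_fst.
have c2 : continuous (fun ab : V * V => ab.2) by move=> x; exact: cvg_snd.
have cp (G : V * V -> V) : continuous G -> continuous (fun ab => enorm (G ab) `^ p).
  move=> cG x; apply: (@continuous_comp _ _ _ G (fun v => enorm v `^ p)); first exact: cG.
  exact: continuous_enorm_powR.
pose F (ab : V * V) := `|enorm ab.1 `^ p - enorm ab.2 `^ p|.
pose H (ab : V * V) := enorm (ab.1 - ab.2) `^ p.
have hZ t (v : V) : 0 <= t -> enorm (t *: v) `^ p = t `^ p * enorm v `^ p.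
  by move=> t0; rewrite enormZ ger0_norm// powRM ?enorm_ge0.
apply: (@homogeneous_bound p F H e p1 e0).
- apply: (@cont_comp R _ (@Num.norm R R)); first exact: norm_continuous.
  by apply: cont_sub; [exact: (cp fst)|exact: (cp snd)].
- apply: cp => x; apply: cvgB; [exact: c1|exact: c2].
- by move=> t a b t0; rewrite /F/= !hZ// -mulrBr normrM ger0_norm ?powR_ge0.
- by move=> t a b t0; rewrite /H/= -scalerBr hZ.
- by move=> ab; rewrite /H powR_ge0.
- move=> [a b]; rewrite /H/F/= => /eqP; rewrite powR_eq0 => /andP[/eqP/enorm_eq0/eqP + _].
  by rewrite subr_eq0 => /eqP ->; rewrite subrr normr0.
Qed.

(** At [a = 0] the flux is squeezed by [|a|^(p - 1) |b|], which covers [p < 2], where [|a|^(p - 2)]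
    blows up near [0]. *)
Lemma continuous_flux p b : 1 < p ->
  continuous (fun a : V => enorm a `^ (p - 2) * dotv a b).
Proof.
move=> p1 a; have [a0|a0] := eqVneq (enorm a) 0.
  have c : continuous (fun a : V => enorm a `^ (p - 1) * enorm b).
    by apply: cont_mul; [apply: continuous_enorm_powR; lra|exact: cont_cst].
  apply: (continuous_squeeze0 (c a)); last by move=> x; exact: flux_le.
  by rewrite a0 powR0 ?mul0r// gt_eqF//; lra.
apply: cont_at_mul.
  apply: (@continuous_comp _ _ _ (@enorm R N) (fun t => t `^ (p - 2))).
    exact: continuous_enorm.
  by apply: continuous_powR_pos; rewrite lt_neqAle eq_sym a0 enorm_ge0.
have c : continuous (fun a : V => dotv a b).
  by apply: continuous_dotv; [exact: cont_id|exact: cst_continuous].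
exact: c.
Qed.

End euclidean.

(** * Integrals of compactly supported functions *)

Section real_integrals.
Context d (T : measurableType d) (R : realType).
Variables (mu : {measure set T -> \bar R}) (D : set T) (mD : measurable D).
Implicit Types (f g : T -> R).
Notation intble f := (mu.-integrable D (EFin \o f)).

Lemma integrable_measurable f : intble f -> measurable_fun D f.
Proof. by move=> /measurable_int /measurable_EFinP. Qed.

Lemma integrable_add f g : intble f -> intble g -> intble (fun x => f x + g x).
Proof. by move=> Hf Hg; exact: (integrableD mD Hf Hg). Qed.

Lemma integrable_scale (c : R) f : intble f -> intble (fun x => c * f x).
Proof. by move=> Hf; exact: (integrableZl mD c Hf). Qed.

Lemma integrable_sub f g : intble f -> intble g -> intble (fun x => f x - g x).
Proof. by move=> Hf Hg; exact: (integrableB mD Hf Hg). Qed.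

Lemma integrable_norm f : intble f -> intble (fun x => `|f x|).
Proof. by move=> Hf; exact: (integrable_abse Hf). Qed.

Lemma integrable_le f g : measurable_fun D f -> (forall x, D x -> `|f x| <= g x) ->
  intble g -> intble f.
Proof.
move=> mf fg; apply: le_integrable => //; first exact/measurable_EFinP.
move=> x Dx /=; rewrite lee_fin; apply: le_trans (fg x Dx) _; exact: ler_norm.
Qed.

Lemma dominated_Rintegral (f_ : nat -> T -> R) f g :
  (forall n, measurable_fun D (f_ n)) ->
  (forall x, D x -> f_ n x @[n --> \oo] --> f x) ->
  intble g -> (forall n x, D x -> `|f_ n x| <= g x) ->
  intble f /\ (\int[mu]_(x in D) f_ n x)%R @[n --> \oo] --> (\int[mu]_(x in D) f x)%R.
Proof.
move=> mf fx ig fg.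
have mf' : measurable_fun D f by exact: (measurable_fun_cvg mf fx).
have fg' x : D x -> `|f x| <= g x.
  move=> Dx; have c : `|f_ n x| @[n --> \oo] --> `|f x|.
    exact: (continuous_cvg _ (@norm_continuous _ _ (f x)) (fx x Dx)).
  by apply: (cvgr_to_le c); apply: nearW => n; exact: fg.
have if' : intble f by exact: integrable_le fg' ig.
split => //.
have := @dominated_cvg _ _ _ mu D mD (fun n => EFin \o f_ n) (EFin \o f) (EFin \o g).
have -> : (fun n => \int[mu]_(x in D) (f_ n x))%R =
  fine \o (fun n => \int[mu]_(x in D) (EFin \o f_ n) x)%E by [].
move=> H; apply: fine_cvg.
rewrite fineK; last exact: integrable_fin_num.
apply: H => //.
- by move=> n; exact/measurable_EFinP.
- by move=> x Dx; apply: cvg_EFin; [exact: nearW|exact: fx].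
Qed.

End real_integrals.

(** * Compactly supported functions and invariance of their integrals *)

Section compactly_supported.
Context {R : realType} {N : nat}.
Notation V := 'rV[R]_N.
Notation mu := (@lebesgue_rV R N).
Notation e_ i := (delta_mx ord0 i : V).
Implicit Types (f g F : V -> R).

(** Boundedness in place of compactness of the closed support: for continuous functions it gives the
    same class, and it passes to sums, products and reflections without topology. *)
Definition bsupp f := exists M : R, forall x, f x != 0 -> forall i, `|x ord0 i| <= M.

Definition Cc f := continuous f /\ bsupp f.

Lemma bsupp_common f g : bsupp f -> (forall x, f x = 0 -> g x = 0) -> bsupp g.
Proof. by move=> [M HM] fg; exists M => x gx; apply: HM; apply: contra_neq gx; exact: fg. Qed.

Lemma bsuppD f g : bsupp f -> bsupp g -> bsupp (fun x => f x + g x).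
Proof.
move=> [M HM] [K HK]; exists (Num.max M K) => x fg i; rewrite le_max.
have [fx|fx] := eqVneq (f x) 0; last by rewrite HM.
by rewrite orbC HK//; apply: contra_neq fg => ->; rewrite fx addr0.
Qed.

Lemma Cc_add f g : Cc f -> Cc g -> Cc (fun x => f x + g x).
Proof. by move=> [? ?] [? ?]; split; [exact: cont_add|exact: bsuppD]. Qed.

Lemma Cc_mul f g : continuous f -> Cc g -> Cc (fun x => f x * g x).
Proof.
move=> cf [cg bg]; split; first exact: cont_mul.
by apply: bsupp_common bg _ => x ->; rewrite mulr0.
Qed.

Lemma Cc_scale c f : Cc f -> Cc (fun x => c * f x).
Proof. by apply: Cc_mul; exact: cont_cst. Qed.

Lemma Cc_sub f g : Cc f -> Cc g -> Cc (fun x => f x - g x).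
Proof.
move=> cf cg; rewrite (_ : (fun x => _) = (fun x => f x + (-1) * g x)); last first.
  by apply/funext => x; rewrite mulN1r.
by apply: Cc_add => //; exact: Cc_scale.
Qed.

Lemma Cc_comp (h : R -> R) f : continuous h -> h 0 = 0 -> Cc f -> Cc (h \o f).
Proof.
move=> ch h0 [cf bf]; split; first exact: cont_comp.
by apply: bsupp_common bf _ => x /= ->.
Qed.

Lemma bounded_closed_cube (M : R) : compact [set x : V | forall i, `|x ord0 i| <= M].
Proof.
apply: bounded_closed_compact.
  exists `|M|; split => // K MK x /= xM.
  rewrite [leLHS]/Num.Def.normr/= mx_normrE; apply/bigmax_leP; split.
    by rewrite (le_trans _ (ltW MK)).
  move=> -[i j] _ /=; rewrite (ord1 i).
  by apply: le_trans (xM j) _; rewrite (le_trans (ler_norm _))// ltW.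
rewrite (_ : [set _ | _] = \bigcap_i (fun x : V => `|x ord0 i|) @^-1` [set t | t <= M]).
  apply: closed_bigI => i _.
  apply: closed_comp; last exact: closed_le.
  move=> x _; apply: (@cont_comp R _ (@Num.norm R R)).
    exact: norm_continuous.
  exact: coord_continuous.
by apply/seteqP; split => [x H i _|x H i]; [exact: H|exact: H].
Qed.

Lemma Cc_bounded f : Cc f -> exists2 C, 0 <= C & forall x, `|f x| <= C.
Proof.
move=> [cf [M HM]].
have [S0|/set0P S0] := eqVneq [set x : V | forall i, `|x ord0 i| <= M] set0.
  exists 0 => // x; rewrite normr_le0; apply/negPn/negP => /HM H.
  by have : [set x : V | forall i, `|x ord0 i| <= M] x by []; rewrite S0.
have cf' : continuous (fun x => `|f x|).
  by apply: (@cont_comp R _ (@Num.norm R R)) => //; exact: norm_continuous.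
have [c _ Hc] := compact_EVT_max S0 (@bounded_closed_cube M) (continuous_subspaceT cf').
exists `|f c| => // x; have [->|fx] := eqVneq (f x) 0; first by rewrite normr0.
by apply: Hc; apply/mem_set => i; exact: HM.
Qed.

Lemma integrable_bounded_bsupp f C : measurable_fun setT f -> bsupp f ->
  (forall x, `|f x| <= C) -> mu.-integrable setT (EFin \o f).
Proof.
move=> mf [M HM] fC.
(* The box is open and [M] may be negative, hence the absolute value and the margin [1]. *)
set K := `|M| + 1.
have [mB vB] := @lebesgue_rV_box R N (- K) K ltac:(rewrite /K; have := normr_ge0 M; lra).
set B := [set x : V | _] in mB vB.
have -> : EFin \o f = (EFin \o f) \_ B.
  apply/funext => x; rewrite patchE; case: ifPn => // /negP xB /=.
  have [->//|fx] := eqVneq (f x) 0; exfalso; apply: xB; apply/mem_set => i.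
  have := HM x fx i; have := ler_norm M; rewrite /K ler_norml => ? /andP[? ?].
  by apply/andP; split; lra.
have vB' : (mu B < +oo)%E by rewrite (_ : mu B = ((K - - K) ^+ N)%:E)// ltry.
have H : mu.-integrable B (EFin \o f).
  apply: (measurable_bounded_integrable mB vB').
    exact: measurable_funS mf.
  exists C; split; first exact: num_real.
  by move=> c Cc x _ /=; rewrite (le_trans (fC x))// ltW.
exact: ((integrable_mkcond (EFin \o f) mB).1 H).
Qed.

Lemma Cc_integrable f : Cc f -> mu.-integrable setT (EFin \o f).
Proof.
move=> cf; have [C _ HC] := Cc_bounded cf.
apply: integrable_bounded_bsupp HC; last exact: cf.2.
by apply: continuous_measurable_rV; exact: cf.1.
Qed.

Lemma Cc_integrableS (D : set V) f : measurable D -> Cc f -> mu.-integrable D (EFin \o f).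
Proof. by move=> mD cf; apply: integrableS (Cc_integrable cf). Qed.

Lemma Rintegral_coordwise (g : 'I_N -> R -> R) f :
  (forall i, measurable_fun [set: measurableTypeR R] (g i : measurableTypeR R -> measurableTypeR R)) ->
  (forall i (A : set R), measurable A ->
    lebesgue_measure ((g i : measurableTypeR R -> measurableTypeR R) @^-1` A) = lebesgue_measure A) ->
  measurable_fun setT f ->
  mu.-integrable setT (EFin \o (f \o coordwise g)) ->
  \int[mu]_x f (coordwise g x) = \int[mu]_x f x.
Proof.
move=> mg lg mf intf; congr fine.
have mG := measurable_coordwise mg.
have mf' : measurable_fun setT (EFin \o f) by exact/measurable_EFinP.
have /= E := @integral_pushforward _ _ _ _ _ _ mG mu setT _ mf' intf measurableT.
rewrite preimage_setT in E; rewrite -E.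
apply: eq_measure_integral => A mA _.
exact: lebesgue_rV_coordwise.
Qed.

Lemma Rintegral_flip i h f : Cc f -> Cc (f \o flip i h) ->
  \int[mu]_x f (flip i h x) = \int[mu]_x f x.
Proof.
move=> cf cff; apply: Rintegral_coordwise.
- by move=> j; case: eqP => _; [exact: measurable_fun_reflection|exact: measurable_id].
- by move=> j A mA; case: eqP => _ //; exact: lebesgue_measure_reflection.
- by apply: continuous_measurable_rV; exact: cf.1.
- exact: Cc_integrable.
Qed.

Lemma Rintegral_shift i t f : Cc f -> Cc (fun x => f (t *: e_ i + x)) ->
  \int[mu]_x f (t *: e_ i + x) = \int[mu]_x f x.
Proof.
move=> cf cff.
have E x : t *: e_ i + x = coordwise (fun j u => if j == i then u + t else u) x.
  apply/rowP => j; rewrite !mxE eqxx/=; case: eqP => _; first by rewrite mulr1 addrC.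
  by rewrite mulr0 add0r.
under eq_Rintegral do rewrite E.
apply: Rintegral_coordwise.
- by move=> j; case: eqP => _; [exact: measurable_fun_translation|exact: measurable_id].
- by move=> j A mA; case: eqP => _ //; exact: lebesgue_measure_translation.
- by apply: continuous_measurable_rV; exact: cf.1.
- by have := Cc_integrable cff; rewrite (_ : (fun x => _) = f \o coordwise (fun j u => if j == i then u + t else u))//;
  apply/funext => x; rewrite E.
Qed.

Lemma is_derive_along i F (dF : V -> R) x (s : R) :
  (forall y, is_derive y (e_ i) F (dF y)) ->
  is_derive s 1 (fun u : R => F (u *: e_ i + x)) (dF (s *: e_ i + x)).
Proof.
move=> FdF; have /is_derive_lineP H := FdF (s *: e_ i + x).
have D : is_derive s 1 (fun u : R => u - s) 1.
  have := is_derive_add (is_derive_id s (1 : R)) (is_derive_const (- s) s (1 : R)).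
  by move/is_derive_eq; apply; rewrite addr0.
have := @is_derive1_comp R (fun h : R => F (h *: e_ i + (s *: e_ i + x))) (fun u => u - s) s _ 1.
rewrite subrr => /(_ _ H D); rewrite mulr1.
rewrite (_ : _ \o _ = (fun u : R => F (u *: e_ i + x)))//.
by apply/funext => u /=; rewrite addrA -scalerDl subrK.
Qed.

(** Constants are not integrable over the whole space; [b] replaces them in bounds for functions
    supported in a cube. *)
Lemma cube_majorant (M : R) : exists b : V -> R,
  [/\ mu.-integrable setT (EFin \o b), forall x, 0 <= b x &
      forall x : V, (forall i, `|x ord0 i| <= M) -> b x = 1].
Proof.
set B := [set x : V | forall i, `|x ord0 i| <= M].
have mB : measurable B.
  rewrite -[B]setCK; apply: measurableC; apply: measurable_open_rV.
  rewrite openC; apply: compact_closed; last exact: bounded_closed_cube.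
  exact: norm_hausdorff.
exists (\1_B); split => //.
- apply: (@integrable_bounded_bsupp _ 1).
  + exact: measurable_indic.
  + exists M => x; rewrite indicE; case: (boolP (x \in B)) => [/set_mem//|_].
    by rewrite eqxx.
  + by move=> x; rewrite indicE; case: (x \in B); rewrite ?normr1 ?normr0.
- by move=> x xM; rewrite indicE mem_set.
Qed.

(** The difference quotients have integral [0] by translation invariance. The mean value theorem
    bounds them by [C], and they live in a fixed cube, so dominated convergence carries this over to
    the derivative. *)
Lemma Rintegral_partial0 i F (dF : V -> R) : Cc F -> Cc dF ->
  (forall x, is_derive x (e_ i) F (dF x)) -> \int[mu]_x dF x = 0.
Proof.
move=> cF cdF FdF; have [C C0 HC] := Cc_bounded cdF.
pose t (n : nat) : R := n.+1%:R^-1.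
have t0 n : 0 < t n by rewrite invr_gt0 ltr0n.
have t1 n : t n <= 1 by rewrite invf_le1 ?ltr0n// ler1n.
pose q n x := (t n)^-1 * (F (t n *: e_ i + x) - F x).
have [M HM] := cF.2.
have sh n x : F (t n *: e_ i + x) != 0 -> forall j, `|x ord0 j| <= M + 1.
  move=> /HM H j; have := H j; rewrite !mxE eqxx/= => Hj.
  have -> : x ord0 j = (t n * (j == i)%:R + x ord0 j) - t n * (j == i)%:R by ring.
  rewrite (le_trans (ler_normB _ _))// lerD// normrM ger0_norm ?(ltW (t0 n))//.
  by case: (j == i); rewrite ?normr1 ?normr0 ?mulr1 ?mulr0.
have cs n : Cc (fun x => F (t n *: e_ i + x)).
  split; first by apply: (@cont_compose V V R (fun x : V => t n *: e_ i + x) F); [exact: continuous_addv|exact: cF.1].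
  by exists (M + 1) => x; exact: sh.
have cq n : Cc (q n) by apply: Cc_scale; exact: Cc_sub.
have q0 n : \int[mu]_x q n x = 0.
  rewrite RintegralZl//; last by apply: Cc_integrable; exact: Cc_sub.
  rewrite RintegralB//; try exact: Cc_integrable.
  by rewrite Rintegral_shift// subrr mulr0.
have qC n x : `|q n x| <= C.
  rewrite /q normrM ger0_norm ?invr_ge0 ?(ltW (t0 n))// ler_pdivrMl//.
  have D y : y \in `]0, t n[ -> is_derive y 1 (fun u : R => F (u *: e_ i + x)) (dF (y *: e_ i + x)).
    by move=> _; exact: is_derive_along.
  have [|y _] := MVT (t0 n) D.
    apply: continuous_subspaceT.
    apply: (continuous_is_derive (df := fun y => dF (y *: e_ i + x))) => y.
    exact: is_derive_along.
  rewrite scale0r add0r subr0 => ->.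
  by rewrite normrM mulrC [`|t n|]ger0_norm ?(ltW (t0 n))// ler_wpM2l// ltW.
(* The shifts [t n] are at most [1], so they move the support by at most [1]. *)
have [b [ib b0 b1]] := cube_majorant (M + 1).
have qd x : q n x @[n --> \oo] --> dF x.
  have [Dx Ex] := FdF x.
  have L : h^-1 *: ((F \o shift x) (h *: e_ i) - F x) @[h --> 0^'] --> dF x.
    by rewrite -Ex; exact: Dx.
  have /cvg_at_rightP H := cvg_dnbhs_at_right L.
  apply: (H t); split => //.
  exact: cvg_harmonic.
have qb n x : [set: V] x -> `|q n x| <= C * b x.
  move=> _; have [xM|] := pselect (forall j, `|x ord0 j| <= M + 1); first by rewrite b1// mulr1.
  move=> /existsNP[j Hj]; rewrite (_ : q n x = 0) ?normr0 ?mulr_ge0//.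
  rewrite /q; have [->|/sh/(_ j)//] := eqVneq (F (t n *: e_ i + x)) 0.
  have [->|/HM/(_ j) H2] := eqVneq (F x) 0; first by rewrite subrr mulr0.
  by exfalso; apply: Hj; lra.
have mq n : measurable_fun setT (q n) by apply: continuous_measurable_rV; exact: (cq n).1.
have [_ H] := dominated_Rintegral measurableT mq (fun x _ => qd x)
  (integrable_scale measurableT C ib) qb.
move: H; rewrite (_ : (fun n => _) = (fun=> 0)) => [H|]; last first.
  by apply/funext => n; rewrite q0.
by apply/esym/(cvg_unique _ (cvg_cst _) H).
Qed.

Lemma partial_near0 i f x : (\forall y \near x, f y = 0) -> partial i f x = 0.
Proof.
move=> fx; apply: (@is_derive_partial _ _ _ (fun=> 0)).
apply: near_eq_is_derive (is_derive_const 0 x (e_ i)).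
by apply: filterS fx => y ->.
Qed.

(** If some coordinate exceeds [M] at a point, it does so on a neighbourhood, where [f] is therefore
    [0]. *)
Lemma bsupp_partial i f : bsupp f -> bsupp (partial i f).
Proof.
move=> [M HM]; exists M => x; apply: contraPP => /existsNP[j /negP Mx].
apply/negP; rewrite negbK; apply/eqP/partial_near0.
have cj : continuous (fun y : V => `|y ord0 j|).
  apply: (@cont_comp R _ (@Num.norm R R)); first exact: norm_continuous.
  exact: coord_continuous.
rewrite -ltNge in Mx.
pose g (y : V) := `|y ord0 j|.
have H : \forall y \near x, M < g y by exact: (cvgr_gt _ (cj x)).
apply: filterS H => y /= My.
by apply/eqP/negPn/negP => /HM/(_ j); rewrite leNgt My.
Qed.

Lemma Cc_partial i f : Ck 1 f -> bsupp f -> Cc (partial i f).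
Proof. by move=> Hf bf; split; [exact: (Ck_partial i Hf)|exact: bsupp_partial]. Qed.

End compactly_supported.

(** * Signed powers, the derivatives of powers of the absolute value *)

Section signed_power.
Context {R : realType}.
Implicit Types (q t p : R).

Definition spow q t := if 0 <= t then t `^ q else - (- t) `^ q.

Lemma spow0 q : q != 0 -> spow q 0 = 0.
Proof. by move=> q0; rewrite /spow lexx powR0. Qed.

Lemma normr_spow q t : `|spow q t| = `|t| `^ q.
Proof.
rewrite /spow; case: leP => t0; first by rewrite !ger0_norm ?powR_ge0.
by rewrite normrN ger0_norm ?powR_ge0// ltr0_norm.
Qed.

Lemma mul_spow p t : 1 < p -> t * spow (p - 1) t = `|t| `^ p.
Proof.
move=> p1; rewrite /spow; case: leP => t0.
  by rewrite ger0_norm// mulrC powR_succ.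
by rewrite ltr0_norm// mulrN -mulNr mulrC powR_succ// oppr_ge0 ltW.
Qed.

Lemma continuous_spow q : 0 < q -> continuous (spow q).
Proof.
move=> q0.
have -> : spow q = (fun t => `|(`|t| + t) / 2| `^ q - `|(`|t| - t) / 2| `^ q).
  apply/funext => t; rewrite /spow; case: leP => t0.
    rewrite [`|t|]ger0_norm// subrr mul0r normr0 powR0 ?gt_eqF// subr0.
    by rewrite mulrDl -splitr ger0_norm.
  rewrite [`|t|]ltr0_norm// addNr mul0r normr0 powR0 ?gt_eqF// sub0r.
  by rewrite mulrDl -splitr ger0_norm// oppr_ge0 ltW.
have cn : continuous (fun t : R => `|t|) by exact: norm_continuous.
by apply: cont_sub; apply: (cont_comp (continuous_normr_powR q0));
  apply: cont_mul; try exact: cont_cst; [apply: cont_add|apply: cont_sub] => //; exact: cont_id.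
Qed.

(** The difference quotient at [0] is [w] itself. With [w = spow (p - 1)] this differentiates
    [|t|^p] at [0], where the rule for powers of positive numbers stops. *)
Lemma is_derive_factor0 (f w : R -> R) : (forall h, f h = h * w h) ->
  continuous_at 0 w -> is_derive (0 : R) 1 f (w 0).
Proof.
move=> fE cw.
have L : h^-1 *: ((f \o shift 0) (h *: 1) - f 0) @[h --> 0^'] --> w 0.
  have cw' : w h @[h --> 0^'] --> w 0 by apply: cvg_trans cw; apply: cvg_app; exact: cvg_within.
  apply: cvg_trans cw'; apply: near_eq_cvg; near=> h.
  have h0 : h != 0 by near: h; exact: nbhs_dnbhs_neq.
  by rewrite /= addr0 [h%:A]mulr1 (fE 0) mul0r subr0 fE [_ *: _]mulrA mulVf// mul1r.
have D : derivable f (0 : R) (1 : R) by apply/cvg_ex; exists (w 0).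
by apply: DeriveDef => //; exact/cvg_lim.
Unshelve. all: by end_near. Qed.

Lemma is_derive_normr_powR p t : 1 < p ->
  is_derive t 1 (fun u : R => `|u| `^ p) (p * spow (p - 1) t).
Proof.
move=> p1; have [t0|t0|->] := ltgtP t 0.
- have nt0 : 0 < - t by rewrite oppr_gt0.
  have D : is_derive t 1 (fun u : R => - u) (- 1 : R).
    by have := is_deriveN (is_derive_id t (1 : R)).
  have H := is_derive1_comp (is_derive1_powR p nt0) D.
  have E : p * (- t) `^ (p - 1) * -1 = p * spow (p - 1) t.
    by rewrite /spow leNgt t0/=; ring.
  apply: near_eq_is_derive (is_derive_eq H E).
  apply: (near_dist nt0) => u; rewrite ltr_norml => /andP[_ ut].
  by rewrite /= ltr0_norm//; lra.
- have E : p * t `^ (p - 1) = p * spow (p - 1) t by rewrite /spow (ltW t0).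
  apply: near_eq_is_derive (is_derive_eq (is_derive1_powR p t0) E).
  apply: (near_dist t0) => u; rewrite ltr_norml => /andP[ut _].
  by rewrite gtr0_norm//; lra.
- have q0 : 0 < p - 1 by lra.
  have cs : continuous_at (0 : R) (spow (p - 1)) by exact: (continuous_spow q0).
  have := @is_derive_factor0 _ (spow (p - 1)) (fun h => esym (mul_spow h p1)) cs.
  by rewrite spow0 ?gt_eqF// mulr0.
Qed.

End signed_power.

(** * Test functions, energy and the Poincaré inequality *)

Section test_functions.
Context {R : realType} {N : nat}.
Notation V := 'rV[R]_N.
Notation mu := (@lebesgue_rV R N).
Notation e_ i := (delta_mx ord0 i : V).
Implicit Types (phi psi : V -> R) (Om : set V) (p : R).

Lemma test_bsupp Om phi : test_function Om phi -> bsupp phi.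
Proof.
move=> [_ cphi _]; have [M [_ HM]] := compact_bounded cphi.
exists (M + 1) => x phix i.
have /= := HM (M + 1) ltac:(lra) x (@subset_closure _ [set x | phi x != 0] x phix).
apply: le_trans; rewrite [leRHS]/Num.Def.normr/= mx_normrE.
by apply/bigmax_geP; right => /=; exists (ord0, i).
Qed.

Lemma test_Cc Om phi : test_function Om phi -> Cc phi.
Proof.
move=> tphi; split; last exact: test_bsupp tphi.
by case: tphi => /(_ 0%N).
Qed.

Lemma test_partial_Cc Om phi i : test_function Om phi -> Cc (partial i phi).
Proof.
move=> tphi; apply: Cc_partial; last exact: test_bsupp tphi.
by case: tphi => /(_ 1%N).
Qed.

Lemma test_is_derive Om phi i x : test_function Om phi ->
  is_derive x (e_ i) phi (partial i phi x).
Proof. by move=> [/(_ 1%N) H _ _]; exact: Ck_is_derive H. Qed.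

Lemma test_out Om phi x : test_function Om phi -> ~ Om x -> phi x = 0.
Proof.
move=> [_ _ sub] Ox; apply/eqP/negPn/negP => phix; apply: Ox; apply: sub.
exact: (@subset_closure _ [set x | phi x != 0]).
Qed.

Lemma test_partial_out Om phi i x : test_function Om phi -> ~ Om x ->
  partial i phi x = 0.
Proof.
move=> [_ _ sub] Ox; apply: partial_near0.
have /= : nbhs x (~` closure [set x | phi x != 0]).
  apply: open_nbhs_nbhs; split; first by apply: closed_openC; exact: closed_closure.
  by move=> /sub.
apply: filterS => y /= Hy; apply/eqP/negPn/negP => phiy; apply: Hy.
exact: (@subset_closure _ [set x | phi x != 0]).
Qed.

Lemma grad0 phi x : (forall i, partial i phi x = 0) -> grad phi x = 0.
Proof. by move=> H; apply/rowP => i; rewrite !mxE. Qed.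

Lemma test_grad_continuous Om phi : test_function Om phi -> continuous (grad phi).
Proof.
move=> tphi; apply: continuous_rV => i.
rewrite (_ : (fun t : V => _) = partial i phi); last by apply/funext => t; rewrite mxE.
exact: (test_partial_Cc i tphi).1.
Qed.

Lemma bsupp_forall (I : finType) (F : I -> V -> R) (g : V -> R) :
  (forall i, bsupp (F i)) -> (forall x, (forall i, F i x = 0) -> g x = 0) -> bsupp g.
Proof.
move=> /choice[M HM] Fg; exists (\big[Num.max/0]_i M i) => x gx j.
have [i Fi] : exists i, F i x != 0.
  apply: contrapT => H; move/eqP: gx; apply; apply: Fg => i.
  by apply/eqP/negPn/negP => Fi; apply: H; exists i.
apply: le_trans (HM i x Fi j) _; exact: le_bigmax.
Qed.

Lemma test_grad_Cc p Om phi (G : V -> V -> R) : test_function Om phi ->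
  continuous (fun x => G x (grad phi x)) -> (forall x, G x 0 = 0) ->
  Cc (fun x => G x (grad phi x)).
Proof.
move=> tphi cG G0; split => //.
apply: (@bsupp_forall 'I_N (fun i => partial i phi)).
  by move=> i; exact: (test_partial_Cc i tphi).2.
by move=> x H; rewrite grad0.
Qed.

Lemma test_energy_Cc p Om phi : 1 < p -> test_function Om phi ->
  Cc (fun x => enorm (grad phi x) `^ p).
Proof.
move=> p1 tphi; have p0 : 0 < p by lra.
apply: (@test_grad_Cc p Om phi (fun _ v => enorm v `^ p)) => //.
  exact: cont_compose (test_grad_continuous tphi) (continuous_enorm_powR p0).
by move=> _; rewrite enorm0 powR0// gt_eqF.
Qed.

Lemma Rintegral_outside Om (f : V -> R) : (forall x, ~ Om x -> f x = 0) ->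
  \int[mu]_(x in Om) f x = \int[mu]_x f x.
Proof.
move=> f0; rewrite Rintegral_mkcond; congr (Rintegral _ _ _); apply/funext => x.
by rewrite patchE; case: ifPn => // /negP xO; rewrite f0// => Ox; apply: xO; exact/mem_set.
Qed.

(** The integrals run over the whole space, so that the energy does not mention an open set and can
    be compared across annuli. *)
Definition energy p phi : R :=
  p^-1 * \int[mu]_x (enorm (grad phi x) `^ p) - \int[mu]_x phi x.

(** The derivative of [x_i |phi|^p] in direction [i] has integral [0], which expresses the integral
    of [|phi|^p] through [phi] and one partial derivative. Young's inequality then produces half of
    that same integral, to be absorbed on the left. *)
Lemma poincare p (M : R) (i : 'I_N) : 1 < p -> exists2 K, 0 <= K &
  forall Om phi, (forall x, Om x -> forall j, `|x ord0 j| <= M) ->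
  test_function Om phi ->
  \int[mu]_x (`|phi x| `^ p) <= K * \int[mu]_x (enorm (grad phi x) `^ p).
Proof.
move=> p1; have p0 : 0 < p by lra.
(* Chosen so that [p (|M| + 1) = L / 2]: with [L |grad phi|] as second entry in Young's inequality,
   the coefficient of [|phi|^p] is at most [1 / 2]. *)
pose L := 2 * p * (`|M| + 1).
have L0 : 0 < L by rewrite /L !mulr_gt0//; have := normr_ge0 M; lra.
exists (L `^ p); first exact: powR_ge0.
move=> Om phi OmM tphi.
have cphi := test_Cc tphi; have cd := test_partial_Cc i tphi.
have q0 : 0 < p - 1 by lra.
have cpow : Cc (fun x => `|phi x| `^ p).
  apply: (@Cc_comp _ _ (fun t : R => `|t| `^ p)) => //; first exact: continuous_normr_powR.
  by rewrite normr0 powR0// gt_eqF.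
pose F (x : V) := x ord0 i * `|phi x| `^ p.
pose G (x : V) := x ord0 i * (p * (spow (p - 1) (phi x) * partial i phi x)).
pose dF (x : V) := `|phi x| `^ p + G x.
have cG : Cc G.
  apply: Cc_mul; first exact: coord_continuous.
  by apply: Cc_scale; apply: Cc_mul => //; apply: cont_comp; [exact: continuous_spow|exact: cphi.1].
have H : \int[mu]_x dF x = 0.
  apply: (@Rintegral_partial0 _ _ i F).
  - by apply: Cc_mul => //; exact: coord_continuous.
  - exact: Cc_add.
  - move=> x.
    have := is_derive_prod (is_derive_coord i i x)
      (is_derive_comp_line (is_derive_normr_powR (phi x) p1) (test_is_derive i x tphi)).
    move=> H0; apply: (is_derive_eq (H0 : is_derive x (e_ i) F _)).
    by rewrite /dF /G /= eqxx mulr1 addrC -mulrA.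
have E := test_energy_Cc p1 tphi.
rewrite RintegralD// in H; try exact: Cc_integrable.
have B x : - G x <= 2^-1 * `|phi x| `^ p + 2^-1 * (L `^ p * enorm (grad phi x) `^ p).
  have [Ox|Ox] := pselect (Om x); last first.
    by rewrite /G (test_partial_out _ tphi Ox) !mulr0 oppr0 addr_ge0// !mulr_ge0 ?powR_ge0.
  apply: le_trans (ler_norm _) _; rewrite normrN !normrM normr_spow (ger0_norm (ltW p0)).
  have Y := young_powR p1 (normr_ge0 (phi x)) (mulr_ge0 (ltW L0) (enorm_ge0 (grad phi x))).
  rewrite powRM ?enorm_ge0 ?(ltW L0)// in Y.
  have Hp : `|partial i phi x| <= enorm (grad phi x).
    by have := coord_le_enorm (grad phi x) i; rewrite mxE.
  have xM : `|x ord0 i| <= `|M| + 1.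
    by apply: le_trans (OmM x Ox i) _; rewrite (le_trans (ler_norm _))// lerDl.
  have a0 := powR_ge0 `|phi x| (p - 1).
  apply: (@le_trans _ _ (2^-1 * (`|phi x| `^ (p - 1) * (L * enorm (grad phi x))))).
    have -> : 2^-1 * (`|phi x| `^ (p - 1) * (L * enorm (grad phi x))) =
      (`|M| + 1) * (p * (`|phi x| `^ (p - 1) * enorm (grad phi x))).
      by rewrite /L; field.
    apply: ler_pM => //; first by rewrite !mulr_ge0// ltW.
    by rewrite ler_pM2l// ler_wpM2l.
  rewrite -mulrDr ler_wpM2l//; apply: le_trans Y _; apply: lerD.
    by rewrite ler_piMl ?powR_ge0// gerBl invr_ge0 ltW.
  by rewrite ler_piMl ?mulr_ge0 ?powR_ge0// invf_le1// ltW.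
have iE := Cc_integrable E; have iP := Cc_integrable cpow; have iG := Cc_integrable cG.
have i1 := integrable_scale measurableT (2^-1) iP.
have i2 := integrable_scale measurableT (L `^ p) iE.
have i3 := integrable_scale measurableT (2^-1) i2.
have := le_Rintegral measurableT (integrable_scale measurableT (-1) iG)
  (integrable_add measurableT i1 i3) (fun x _ => _).
rewrite RintegralD// !RintegralZl// => Hle.
have {}Hle := Hle ltac:(by move=> x; rewrite mulN1r).
move: H Hle; set P := \int[mu]_x (`|phi x| `^ p); set Q := \int[mu]_x G x.
by set S := \int[mu]_x _; move=> H Hle; lra.
Qed.

End test_functions.

(** * Completeness of Lp *)

(** Besides the limit, the explicit rate is needed: it becomes the rate of convergence in
    [Lp_complete]. *)
Lemma geometric_cauchy (R : realType) (a : nat -> R) (s : R) :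
  (forall n, `|a n.+1 - a n| <= s * 2^-1 ^+ n) ->
  exists2 l, a n @[n --> \oo] --> l & forall n, `|a n - l| <= 2 * s * 2^-1 ^+ n.
Proof.
move=> H.
have s0 : 0 <= s by have := H 0%N; rewrite expr0 mulr1; apply: le_trans.
have h0 : (fun n => 2^-1 ^+ n : R) @ \oo --> (0 : R).
  by apply: cvg_expr; rewrite ger0_norm// invf_lt1// ltr1n.
have hS n : (2^-1 : R) ^+ n = 2 * 2^-1 ^+ n.+1 by rewrite exprS mulrA divff// mul1r.
have hp n : 0 <= (2^-1 : R) ^+ n by rewrite exprn_ge0.
have B n k : `|a (n + k)%N - a n| <= 2 * s * 2^-1 ^+ n - 2 * s * 2^-1 ^+ (n + k).
  elim: k => [|k IH]; first by rewrite addn0 !subrr normr0.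
  rewrite addnS; have := H (n + k)%N; rewrite (hS (n + k)%N) in IH *.
  have := ler_normD (a (n + k).+1 - a (n + k)%N) (a (n + k)%N - a n).
  rewrite addrA subrK; set x := 2^-1 ^+ (n + k).+1 in IH *; lra.
have B' n k : `|a (n + k)%N - a n| <= 2 * s * 2^-1 ^+ n.
  by apply: le_trans (B n k) _; rewrite gerBl !mulr_ge0.
(* Adding the tail of the geometric series makes the sequence nonincreasing, so that monotone
   convergence supplies the limit. *)
pose b n := a n + 2 * s * 2^-1 ^+ n.
have cb : cvgn b.
  apply: nonincreasing_is_cvgn.
    apply/nonincreasing_seqP => n; rewrite /b (hS n).
    have := H n; rewrite (hS n) ler_norml => /andP[_].
    set x := 2^-1 ^+ n.+1; lra.
  exists (a 0%N - 2 * s) => _ [n _ <-]; rewrite /b.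
  have := B' 0%N n; rewrite add0n expr0 mulr1 ler_norml => /andP[? _].
  have : 0 <= 2 * s * 2^-1 ^+ n by rewrite !mulr_ge0.
  lra.
have ca : a n @[n --> \oo] --> limn b.
  have -> : a = (fun n => b n - 2 * s * 2^-1 ^+ n) by apply/funext => n; rewrite addrK.
  rewrite -[X in _ --> X]subr0; apply: cvgB => //.
  by rewrite -[X in _ --> X](mulr0 (2 * s)); apply: cvgMr.
exists (limn b) => // n.
have c1 : `|a m - a n| @[m --> \oo] --> `|limn b - a n|.
  by apply: cvg_norm; apply: cvgB => //; exact: cvg_cst.
rewrite distrC; apply: (cvgr_to_le c1); exists n => // m /= nm.
by rewrite -(subnKC nm).
Qed.

Section Lp_complete.
Context d (T : measurableType d) (R : realType).
Variables (mu : {measure set T -> \bar R}) (D : set T) (mD : measurable D) (p : R).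
Hypothesis p1 : 1 < p.

Lemma measurable_normr_powR (f : T -> R) : measurable_fun D f ->
  measurable_fun D (fun x => `|f x| `^ p).
Proof.
move=> mf; apply: (@measurableT_comp _ _ _ _ _ _ (fun t : R => t `^ p)).
  exact: measurable_powR.
exact: measurableT_comp.
Qed.

(** The extra factor [2^-n] in the hypothesis makes the sum [S] of [(2^n |f_(n+1) - f_n|)^p] have
    integral at most [2]. Where [S] is finite, hence almost everywhere, the increments are at most
    [S^(1/p) 2^-n], and integrating the resulting geometric rate gives the bound. *)
Lemma Lp_complete (f : nat -> T -> R) : (forall n, measurable_fun D (f n)) ->
  (forall n, (\int[mu]_(x in D) (`|f n.+1 x - f n x| `^ p)%:E <=
              (2^-1 ^+ n * (2^-1 ^+ n) `^ p)%:E)%E) ->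
  exists2 g : T -> R, measurable_fun D g & forall n,
    (\int[mu]_(x in D) (`|f n x - g x| `^ p)%:E <= ((2 * 2^-1 ^+ n) `^ p * 2)%:E)%E.
Proof.
move=> mf Hf; have p0 : 0 < p by exact: lt_trans ltr01 p1.
have hp n : 0 < (2^-1 : R) ^+ n by rewrite exprn_gt0.
pose a n x := (2 ^+ n * `|f n.+1 x - f n x|) `^ p.
have aE n x : a n x = (2 ^+ n) `^ p * `|f n.+1 x - f n x| `^ p.
  by rewrite /a powRM// exprn_ge0.
have md n : measurable_fun D (fun x => f n.+1 x - f n x) by exact: measurable_funB.
have ma n : measurable_fun D (EFin \o a n).
  apply/measurable_EFinP; rewrite (_ : a n = fun x => (2 ^+ n) `^ p * `|f n.+1 x - f n x| `^ p).
    by apply: measurable_funM => //; exact: measurable_normr_powR.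
  by apply/funext => x; exact: aE.
have a0 n x : (0 <= (EFin \o a n) x)%E by rewrite lee_fin powR_ge0.
pose S x : \bar R := (\sum_(0 <= n <oo) (EFin \o a n) x)%E.
have mS : measurable_fun D S by apply: ge0_emeasurable_sum.
have S0 x : (0 <= S x)%E by apply: nneseries_ge0.
have IS : (\int[mu]_(x in D) S x <= 2%:E)%E.
  rewrite /S integral_nneseries//.
  apply: lime_le; first by apply: is_cvg_nneseries => n _ _; exact: integral_ge0.
  apply: nearW => n.
  have Ia k : (\int[mu]_(x in D) (EFin \o a k) x <= (2^-1 ^+ k)%:E)%E.
    have -> : (\int[mu]_(x in D) (EFin \o a k) x =
        ((2 ^+ k) `^ p)%:E * \int[mu]_(x in D) (`|f k.+1 x - f k x| `^ p)%:E)%E.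
      rewrite -ge0_integralZl_EFin ?powR_ge0//; last first.
        by apply/measurable_EFinP; exact: measurable_normr_powR.
      by apply: eq_integral => x _ /=; rewrite aE EFinM.
    apply: le_trans (lee_wpmul2l _ (Hf k)) _; first by rewrite lee_fin powR_ge0.
    rewrite -EFinM lee_fin mulrCA -powRM ?exprn_ge0// -exprMn divff// expr1n powR1 mulr1.
    by [].
  have : (\sum_(0 <= k < n) \int[mu]_(x in D) (EFin \o a k) x <= \sum_(0 <= k < n) (2^-1 ^+ k)%:E)%E.
    by apply: lee_sum => k _; exact: Ia.
  move/le_trans; apply; rewrite sumEFin lee_fin.
  suff -> : \sum_(0 <= k < n) (2^-1 : R) ^+ k = 2 - 2 * 2^-1 ^+ n.
    by rewrite gerBl mulr_ge0// ltW.
  elim: n => [|n IH]; first by rewrite big_nil expr0 mulr1 subrr.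
  by rewrite big_nat_recr//= IH exprS mulrA divff// mul1r; set x := 2^-1 ^+ n; lra.
have iS : mu.-integrable D S.
  apply/integrableP; split => //.
  rewrite (eq_integral S); last by move=> x _; rewrite gee0_abs.
  by apply: le_lt_trans IS _; rewrite ltry.
(* The upper limit is measurable whether or not the sequence converges; almost everywhere it is the
   limit. *)
pose g x := fine (limn_esup (fun n => (f n x)%:E)).
have mg : measurable_fun D g.
  apply: (@measurableT_comp _ _ _ _ _ _ fine); first exact: fine_measurable.
  by apply: measurable_fun_limn_esup => n; exact/measurable_EFinP.
exists g => // n.
have K : {ae mu, forall x, D x -> ((`|f n x - g x| `^ p)%:E <= ((2 * 2^-1 ^+ n) `^ p)%:E * S x)%E}.
  have := integrable_ae mD iS; apply: filterS => x H Dx; have Sfin := H Dx.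
  pose s := (fine (S x)) `^ p^-1.
  have sp : s `^ p = fine (S x) by rewrite -powRrM mulVf ?gt_eqF// powRr1// fine_ge0.
  have ds k : `|f k.+1 x - f k x| <= s * 2^-1 ^+ k.
    have aS : a k x <= fine (S x).
      rewrite -lee_fin fineK//; apply: le_trans (nneseries_lim_ge k.+1 _) => //.
      rewrite big_nat_recr//=; apply: leeDr; apply: sume_ge0 => i _; exact: (a0 i x).
    have : (2 ^+ k * `|f k.+1 x - f k x|) <= s.
      rewrite leNgt; apply/negP => sa; move: aS; rewrite leNgt => /negP; apply.
      rewrite -sp; apply: gt0_ltr_powR => //; rewrite nnegrE ?powR_ge0//.
    by rewrite exprVn ler_pdivlMr ?exprn_gt0// mulrC.
  have [l cl Hl] := geometric_cauchy ds.
  have gl : g x = l.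
    rewrite /g; have -> : limn_esup (fun n0 : nat => (f n0 x)%:E) = l%:E.
      by apply: (cvg_limn_einf_sup _).2; apply: cvg_EFin; [exact: nearW|exact: cl].
    by [].
  rewrite -[S x]fineK// -EFinM lee_fin gl -sp -powRM ?powR_ge0 ?mulr_ge0 ?(ltW (hp n))//.
  apply: ge0_ler_powR; rewrite ?nnegrE ?(ltW p0) ?mulr_ge0 ?powR_ge0 ?(ltW (hp n))//.
  by apply: le_trans (Hl n) _; rewrite mulrAC.
apply: le_trans (ae_ge0_le_integral mD _ _ _ _ K) _ => //.
- by apply/measurable_EFinP; apply: measurable_normr_powR; exact: measurable_funB.
- by move=> x _; rewrite mule_ge0// lee_fin powR_ge0.
- by apply: emeasurable_funM.
by rewrite ge0_integralZl_EFin// ?powR_ge0// EFinM lee_wpmul2l// lee_fin powR_ge0.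
Qed.

Lemma integrable_normr_powR (f : T -> R) : measurable_fun D f ->
  (\int[mu]_(x in D) (`|f x| `^ p)%:E < +oo)%E ->
  mu.-integrable D (EFin \o (fun x => `|f x| `^ p)).
Proof.
move=> mf foo; apply/integrableP; split.
  by apply/measurable_EFinP; exact: measurable_normr_powR.
rewrite (eq_integral (fun x => (`|f x| `^ p)%:E))// => x _ /=.
by rewrite ger0_norm// powR_ge0.
Qed.

Lemma integrable_const (c : R) : (mu D < +oo)%E -> mu.-integrable D (EFin \o (fun=> c)).
Proof.
move=> muD; apply: (measurable_bounded_integrable mD muD); first exact: measurable_cst.
exists `|c|; split; first exact: num_real.
by move=> k ck x _ /=; exact: ltW.
Qed.

Lemma integrable_Lp (f : T -> R) : (mu D < +oo)%E -> measurable_fun D f ->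
  mu.-integrable D (EFin \o (fun x => `|f x| `^ p)) ->
  mu.-integrable D (EFin \o f).
Proof.
move=> muD mf fp.
apply: (@integrable_le _ _ _ _ _ mD _ (fun x => 1 + 1 * `|f x| `^ p)) => //.
  by move=> x _; have := @normr_le_powR _ p 1 (f x) p1 ltr01; rewrite powR1.
apply: integrable_add => //; last exact: integrable_scale.
exact: integrable_const.
Qed.

(** On a set of finite measure, [normr_le_powR] bounds [|f n - g|] by a small constant plus a
    multiple of its [p]th power. The bounded factor [h] stands for test functions and their
    derivatives. *)
Lemma cvg_L1 (f : nat -> T -> R) (g h : T -> R) (C : R) : (mu D < +oo)%E ->
  measurable_fun D h -> (forall x, D x -> `|h x| <= C) ->
  (forall n, measurable_fun D (f n)) -> measurable_fun D g ->
  (forall n, mu.-integrable D (EFin \o f n)) -> mu.-integrable D (EFin \o g) ->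
  (forall n, mu.-integrable D (EFin \o (fun x => `|f n x - g x| `^ p))) ->
  (\int[mu]_(x in D) (`|f n x - g x| `^ p))%R @[n --> \oo] --> (0 : R) ->
  (\int[mu]_(x in D) (f n x * h x))%R @[n --> \oo] --> (\int[mu]_(x in D) (g x * h x))%R.
Proof.
move=> muD mh hC mf mg fi gi fgi c0.
have C0 : 0 <= `|C| by [].
have hC' x : D x -> `|h x| <= `|C| by move=> Dx; exact: le_trans (hC x Dx) (ler_norm _).
have ih k : measurable_fun D k -> mu.-integrable D (EFin \o k) ->
    mu.-integrable D (EFin \o (fun x => k x * h x)).
  move=> mk ik; apply: (@integrable_le _ _ _ _ _ mD _ (fun x => `|C| * `|k x|)) => //.
  - exact: measurable_funM.
  - by move=> x Dx; rewrite normrM mulrC ler_wpM2r// hC'.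
  - by apply: integrable_scale => //; exact: integrable_norm.
apply/cvgrPdist_le => e e0.
pose m := fine (mu D); have m0 : 0 <= m by exact: fine_ge0.
pose e1 := e / (2 * (`|C| * m + 1)).
have e10 : 0 < e1 by rewrite divr_gt0// mulr_gt0// ltr_wpDl// mulr_ge0.
pose K := e1 `^ (1 - p).
have K0 : 0 <= K by exact: powR_ge0.
have e20 : 0 < e / (2 * (`|C| * K + 1)) by rewrite divr_gt0// mulr_gt0// ltr_wpDl// mulr_ge0.
have /cvgrPdist_le/(_ _ e20) := c0; apply: filterS => n.
rewrite sub0r normrN => Hn.
have {}Hn := le_trans (ler_norm _) Hn.
rewrite -RintegralB//; try exact: ih.
have i1 : mu.-integrable D (EFin \o (fun x => `|f n x - g x|)).
  by apply: integrable_norm => //; exact: integrable_sub.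
apply: le_trans (le_normr_Rintegral _ _) _ => //.
  by apply: integrable_sub => //; exact: ih.
have icst : mu.-integrable D (EFin \o (fun=> e1)) by exact: integrable_const.
have i2 : mu.-integrable D (EFin \o (fun x => `|C| * (e1 + K * `|f n x - g x| `^ p))).
  by apply: integrable_scale => //; apply: integrable_add => //; exact: integrable_scale.
apply: (@le_trans _ _ (\int[mu]_(x in D) (`|C| * (e1 + K * `|f n x - g x| `^ p))%R)).
  apply: le_Rintegral => //.
    by apply: integrable_norm => //; apply: integrable_sub => //; exact: ih.
  move=> x Dx; rewrite -mulrBl normrM mulrC distrC; apply: ler_pM => //; first exact: hC'.
  exact: normr_le_powR.
rewrite RintegralZl//; last first.
  by apply: integrable_add => //; exact: integrable_scale.
rewrite RintegralD//; last exact: integrable_scale.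
rewrite RintegralZl// Rintegral_cst// -/m.
set I := (\int[mu]_(x in D) _)%R in Hn *.
have A1 : `|C| * (e1 * m) <= e / 2.
  rewrite mulrCA /e1 mulrAC ler_pdivrMr; last by rewrite mulr_gt0// ltr_wpDl// mulr_ge0.
  have : 0 <= `|C| * m by rewrite mulr_ge0.
  by set z := `|C| * m => ?; nra.
have A2 : `|C| * (K * I) <= e / 2.
  have H2 : `|C| * K * I <= `|C| * K * (e / (2 * (`|C| * K + 1))).
    by rewrite ler_wpM2l// mulr_ge0.
  rewrite mulrA; apply: le_trans H2 _.
  rewrite mulrA ler_pdivrMr; last by rewrite mulr_gt0// ltr_wpDl// mulr_ge0.
  have : 0 <= `|C| * K by rewrite mulr_ge0.
  by set z := `|C| * K => ?; nra.
by rewrite mulrDr; lra.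
Qed.

End Lp_complete.

Lemma Rintegral_le_comb d (T : measurableType d) (R : realType)
    (mu : {measure set T -> \bar R}) (D : set T) (A B X Y : T -> R) (e K : R) :
  measurable D ->
  mu.-integrable D (EFin \o A) -> mu.-integrable D (EFin \o B) ->
  mu.-integrable D (EFin \o X) -> mu.-integrable D (EFin \o Y) ->
  (forall x, D x -> Y x <= e * (A x + B x) + K * (2^-1 * (A x + B x) - X x)) ->
  \int[mu]_(x in D) Y x <= e * (\int[mu]_(x in D) A x + \int[mu]_(x in D) B x) +
    K * (2^-1 * (\int[mu]_(x in D) A x + \int[mu]_(x in D) B x) - \int[mu]_(x in D) X x).
Proof.
move=> mD i1 i2 i3 iY H.
have i12 := integrable_add mD i1 i2.
have i4 := integrable_scale mD e i12.
have i5 := integrable_scale mD (2^-1) i12.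
have i6 := integrable_sub mD i5 i3.
have i7 := integrable_scale mD K i6.
apply: le_trans (le_Rintegral mD iY (integrable_add mD i4 i7) H) _.
by rewrite RintegralD// !RintegralZl// RintegralB// RintegralZl// RintegralD.
Qed.

(** * Minimizing sequences of the energy *)

Section test_algebra.
Context {R : realType} {N : nat}.
Notation V := 'rV[R]_N.
Notation mu := (@lebesgue_rV R N).
Notation e_ i := (delta_mx ord0 i : V).
Implicit Types (phi psi : V -> R) (Om : set V) (p a b : R).

Lemma test_intro Om phi (K : set V) : smooth phi -> compact K -> K `<=` Om ->
  (forall x, phi x != 0 -> K x) -> test_function Om phi.
Proof.
move=> sphi cK KO phiK.
have cl : closure [set x | phi x != 0] `<=` K.
  have /closure_id -> : closed K by apply: compact_closed => //; exact: norm_hausdorff.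
  by apply: closure_subset => x; exact: phiK.
split => //; last exact: subset_trans cl KO.
by apply: subclosed_compact cl => //; exact: closed_closure.
Qed.

Lemma test_lin Om a b phi psi : test_function Om phi -> test_function Om psi ->
  test_function Om (fun x => a * phi x + b * psi x).
Proof.
move=> [s1 c1 o1] [s2 c2 o2]; apply: (test_intro _ (compactU c1 c2)).
- by move=> k; apply: CkD; apply: CkZ; [exact: s1|exact: s2].
- by rewrite subUset.
- move=> x nz; have [H|H] := eqVneq (phi x) 0; last first.
    by left; exact: (@subset_closure _ [set x | phi x != 0]).
  right; apply: (@subset_closure _ [set x | psi x != 0]) => /=.
  by apply: contra_neq nz => ->; rewrite H !mulr0 addr0.
Qed.

Lemma test_zero Om : test_function Om (fun _ : V => 0).
Proof.
apply: (test_intro _ (@compact0 V)) => //.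
- by move=> k; exact: Ck_const.
- by move=> x; rewrite eqxx.
Qed.

Lemma grad_lin Om a b phi psi x : test_function Om phi -> test_function Om psi ->
  grad (fun x => a * phi x + b * psi x) x = a *: grad phi x + b *: grad psi x.
Proof.
move=> t1 t2; apply/rowP => i; rewrite !mxE.
have Z c f : is_derive x (e_ i) f (partial i f x) ->
    is_derive x (e_ i) (fun x => c * f x) (c * partial i f x).
  move=> H; have := is_derive_prod (is_derive_const c x (e_ i)) H.
  by move/is_derive_eq; apply; rewrite mulr0 addr0.
apply: (@is_derive_partial _ _ _ (fun x => a * partial i phi x + b * partial i psi x)).
by apply: is_derive_add; apply: Z; [exact: (test_is_derive i x t1)|exact: (test_is_derive i x t2)].
Qed.

Lemma Rintegral_test_by_parts Om phi (eta : V -> R) i :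
  test_function Om phi -> test_function Om eta ->
  \int[mu]_x (phi x * partial i eta x) = - \int[mu]_x (partial i phi x * eta x).
Proof.
move=> t1 t2.
have c1 : Cc (fun x => phi x * partial i eta x).
  by apply: Cc_mul; [exact: (test_Cc t1).1|exact: test_partial_Cc t2].
have c2 : Cc (fun x => eta x * partial i phi x).
  by apply: Cc_mul; [exact: (test_Cc t2).1|exact: test_partial_Cc t1].
have H : \int[mu]_x (phi x * partial i eta x + eta x * partial i phi x) = 0.
  apply: (@Rintegral_partial0 _ _ i (fun x => phi x * eta x)).
  - by apply: Cc_mul; [exact: (test_Cc t1).1|exact: test_Cc t2].
  - exact: Cc_add.
  - by move=> x; apply: is_derive_prod; [exact: (test_is_derive i x t1)|exact: (test_is_derive i x t2)].
move: H; rewrite RintegralD//; try exact: Cc_integrable.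
under [X in _ + X = _ -> _]eq_Rintegral do rewrite mulrC.
by move/eqP; rewrite addr_eq0 => /eqP.
Qed.

Definition dirichlet p phi : R := \int[mu]_x (enorm (grad phi x) `^ p).

Lemma energyE p phi : energy p phi = p^-1 * dirichlet p phi - \int[mu]_x phi x.
Proof. by []. Qed.

Lemma dirichlet_ge0 p phi : 0 <= dirichlet p phi.
Proof. by apply: Rintegral_ge0 => x _; exact: powR_ge0. Qed.

(** A real [inf] is meaningful only for a nonempty set that is bounded below; [energy_has_inf]
    provides this for bounded sets. *)
Definition torsion_energy p Om : R := inf [set energy p phi | phi in test_function Om].

End test_algebra.

Lemma cauchy_arith (R : realType) (p e K Q I d A B X F G : R) :
  0 < p -> 0 < e -> 0 <= K -> 0 <= Q -> d <= e / (2 * p * (K + 1)) ->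
  A <= Q -> B <= Q ->
  p^-1 * A - F <= I + d -> p^-1 * B - G <= I + d ->
  I <= p^-1 * X - 2^-1 * (F + G) ->
  e / (4 * (Q + 1)) * (A + B) + K * (2^-1 * (A + B) - X) <= e.
Proof.
move=> p0 e0 K0 Q0 dle D1 D2 J1 J2 J3.
have S1 : e / (4 * (Q + 1)) * (A + B) <= e / 2.
  have : e / (4 * (Q + 1)) * (A + B) <= e / (4 * (Q + 1)) * (2 * (Q + 1)).
    apply: ler_wpM2l; last by lra.
    by rewrite divr_ge0 ?(ltW e0)// mulr_ge0// addr_ge0.
  have -> : e / (4 * (Q + 1)) * (2 * (Q + 1)) = e / 2 by field; lra.
  by [].
have S2 : 2^-1 * (A + B) - X <= p * d.
  have : p^-1 * (2^-1 * (A + B) - X) <= d.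
    have -> : p^-1 * (2^-1 * (A + B) - X) = 2^-1 * (p^-1 * A + p^-1 * B) - p^-1 * X.
      by ring.
    lra.
  by rewrite ler_pdivrMl.
have S3 : K * (2^-1 * (A + B) - X) <= e / 2.
  apply: (@le_trans _ _ (K * (p * (e / (2 * p * (K + 1)))))).
    by rewrite ler_wpM2l//; apply: le_trans S2 _; rewrite ler_pM2l.
  apply: (@le_trans _ _ ((K + 1) * (p * (e / (2 * p * (K + 1)))))).
    apply: ler_wpM2r; last by rewrite lerDl.
    by rewrite mulr_ge0 ?(ltW p0)// divr_ge0 ?(ltW e0)// !mulr_ge0 ?(ltW p0)// addr_ge0.
  rewrite le_eqVlt; apply/orP; left; apply/eqP; field.
  by apply/andP; split; lra.
lra.
Qed.

Section minimizing.
Context {R : realType} {N : nat}.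
Notation V := 'rV[R]_N.
Notation mu := (@lebesgue_rV R N).
Implicit Types (phi psi : V -> R).
Variables (p : R) (Om : set V) (M : R) (i0 : 'I_N).
Hypotheses (p1 : 1 < p) (mOm : measurable Om).
Hypothesis OmM : forall x, Om x -> forall i, `|x ord0 i| <= M.

Let p0 : 0 < p. Proof. exact: lt_trans ltr01 p1. Qed.

(** Coercivity: a small part of the Dirichlet term absorbs the linear term, by [normr_le_powR] and
    the Poincaré inequality. *)
Lemma energy_lower : exists C, forall phi, test_function Om phi ->
  dirichlet p phi <= 2 * p * (energy p phi + C).
Proof.
have [K K0 HK] := poincare M i0 p1.
have [b [ib b0 b1]] := @cube_majorant R N M.
(* With this [e] the coefficient [e^(1 - p)] is [1 / (2 p (K + 1))], so that after the Poincaré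
   inequality the linear term costs a constant and at most half of [p^-1 * dirichlet p phi]. *)
pose e := (2 * p * (K + 1)) `^ (p - 1)^-1.
have L0 : 0 < 2 * p * (K + 1) by rewrite !mulr_gt0// ltr_wpDl.
have e0 : 0 < e by exact: powR_gt0.
have eK : e `^ (1 - p) = (2 * p * (K + 1))^-1.
  rewrite /e -powRrM.
  have -> : (p - 1)^-1 * (1 - p) = -1.
    by rewrite -[1 - p]opprB mulrN mulVf// gt_eqF// subr_gt0.
  by rewrite powR_inv1// ltW.
exists (e * \int[mu]_x b x) => phi tphi.
have cphi := test_Cc tphi.
have cpow : Cc (fun x => `|phi x| `^ p).
  apply: (@Cc_comp _ _ (fun t : R => `|t| `^ p)) => //; first exact: continuous_normr_powR.
  by rewrite normr0 powR0// gt_eqF.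
have i1 := integrable_scale measurableT e ib.
have i2 := integrable_scale measurableT (e `^ (1 - p)) (Cc_integrable cpow).
have H : \int[mu]_x phi x <= \int[mu]_x (e * b x + e `^ (1 - p) * `|phi x| `^ p).
  apply: le_Rintegral => //; [exact: Cc_integrable|exact: integrable_add|].
  move=> x _; have [Ox|Ox] := pselect (Om x).
    rewrite b1 ?mulr1; last exact: OmM.
    by apply: le_trans (ler_norm _) _; exact: normr_le_powR.
  by rewrite (test_out tphi Ox) addr_ge0// mulr_ge0// ?powR_ge0// ltW.
rewrite RintegralD// !RintegralZl// in H; last exact: Cc_integrable.
have HP := HK Om phi OmM tphi.
rewrite energyE; rewrite -/(dirichlet p phi) in HP; have D0 := dirichlet_ge0 p phi.
rewrite eK in H.
have H2 : (2 * p * (K + 1))^-1 * \int[mu]_x `|phi x| `^ p <= (2 * p)^-1 * dirichlet p phi.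
  rewrite invfM -mulrA ler_wpM2l ?invr_ge0 ?mulr_ge0 ?(ltW p0)//.
  rewrite ler_pdivrMl ?ltr_wpDl//; apply: le_trans HP _.
  by rewrite ler_wpM2r// lerDl.
move: H H2 D0; set D := dirichlet p phi; set P := \int[mu]_x `|phi x| `^ p.
set F := \int[mu]_x phi x; set B := \int[mu]_x b x => H H2 D0.
have : 2 * p * ((2 * p)^-1 * D) <= 2 * p * (p^-1 * D - F + e * B).
  rewrite ler_wpM2l ?mulr_ge0 ?(ltW p0)//.
  have E2 : p^-1 * D = 2 * ((2 * p)^-1 * D) by field; rewrite gt_eqF.
  by rewrite E2; lra.
by rewrite mulrA divff ?mul1r// mulf_neq0// gt_eqF.
Qed.

Lemma energy_has_inf : has_inf [set energy p phi | phi in test_function Om].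
Proof.
split; first by exists (energy p (fun _ : V => 0)); exists (fun=> 0) => //; exact: test_zero.
have [C HC] := energy_lower; exists (- C) => _ [phi tphi <-].
have := HC phi tphi; have := dirichlet_ge0 p phi => H1 /(le_trans H1).
by rewrite pmulr_rge0 ?mulr_gt0// -lerBlDr sub0r.
Qed.

Lemma torsion_energy_le phi : test_function Om phi -> torsion_energy p Om <= energy p phi.
Proof. by move=> tphi; apply: ge_inf; [exact: energy_has_inf.2|exists phi]. Qed.

Lemma torsion_energy_adherent e : 0 < e -> exists2 phi,
  test_function Om phi & energy p phi < torsion_energy p Om + e.
Proof. by move=> e0; have [_ [phi tphi <-] H] := inf_adherent e0 energy_has_inf; exists phi. Qed.

(** The midpoint of [phi] and [psi] is a test function, with energy at least the infimum, so its
    Dirichlet integral falls short of the average of the other two by at most [p * d].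
    [powR_diff_bound] converts this defect into a distance. *)
Lemma minimizing_cauchy e : 0 < e -> exists2 d, 0 < d & forall phi psi,
  test_function Om phi -> test_function Om psi ->
  energy p phi <= torsion_energy p Om + d -> energy p psi <= torsion_energy p Om + d ->
  \int[mu]_x (enorm (grad phi x - grad psi x) `^ p) <= e.
Proof.
move=> e0; have [C HC] := energy_lower.
set I := torsion_energy p Om.
have Q0 : 0 <= 2 * p * (I + 1 + C).
  have [phi tphi H] := torsion_energy_adherent ltr01.
  apply: le_trans (dirichlet_ge0 p phi) (le_trans (HC phi tphi) _).
  by rewrite ler_wpM2l ?mulr_ge0 ?(ltW p0)// lerD2r ltW.
set Q := 2 * p * (I + 1 + C) in Q0.
have e1 : 0 < e / (4 * (Q + 1)) by rewrite divr_gt0// mulr_gt0// ltr_wpDl.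
have [K K0 HK] := @powR_diff_bound R N _ _ p1 e1.
set e' := e / (4 * (Q + 1)) in e1 HK.
(* The bound [1] keeps both Dirichlet integrals below [Q]; the other bound makes [K] times the
   convexity defect at most [e / 2]. *)
have d0 : 0 < Num.min 1 (e / (2 * p * (K + 1))).
  by rewrite lt_min ltr01 divr_gt0// !mulr_gt0// ltr_wpDl.
exists (Num.min 1 (e / (2 * p * (K + 1)))) => // phi psi t1 t2.
set d := Num.min _ _ in d0 *.
have dl1 : d <= 1 by rewrite ge_min lexx.
have dl2 : d <= e / (2 * p * (K + 1)) by rewrite ge_min lexx orbT.
move=> J1 J2.
pose chi := fun x => 2^-1 * phi x + 2^-1 * psi x.
have t3 : test_function Om chi by exact: test_lin.
have J3 := torsion_energy_le t3.
have E1 := test_energy_Cc p1 t1; have E2 := test_energy_Cc p1 t2.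
have E3 := test_energy_Cc p1 t3.
have F1 := Cc_integrable (test_Cc t1); have F2 := Cc_integrable (test_Cc t2).
have Ichi : \int[mu]_x chi x = 2^-1 * (\int[mu]_x phi x + \int[mu]_x psi x).
  by rewrite RintegralD// ?RintegralZl// ?mulrDr//; exact: integrable_scale.
have D1 : dirichlet p phi <= Q.
  apply: le_trans (HC phi t1) _; rewrite ler_wpM2l ?mulr_ge0 ?(ltW p0)// lerD2r.
  by apply: le_trans J1 _; rewrite lerD2l.
have D2 : dirichlet p psi <= Q.
  apply: le_trans (HC psi t2) _; rewrite ler_wpM2l ?mulr_ge0 ?(ltW p0)// lerD2r.
  by apply: le_trans J2 _; rewrite lerD2l.
have i1 := Cc_integrable E1; have i2 := Cc_integrable E2; have i3 := Cc_integrable E3.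
have tB : test_function Om (fun x => 1 * phi x + (-1) * psi x) by exact: test_lin.
have iB : mu.-integrable setT (EFin \o (fun x => enorm (grad phi x - grad psi x) `^ p)).
  have := Cc_integrable (test_energy_Cc p1 tB).
  rewrite (_ : (fun x => enorm (grad _ x) `^ p) = (fun x => enorm (grad phi x - grad psi x) `^ p))//.
  by apply/funext => x; rewrite (grad_lin _ _ _ t1 t2) scale1r scaleN1r.
have HY x : enorm (grad phi x - grad psi x) `^ p <=
    e' * (enorm (grad phi x) `^ p + enorm (grad psi x) `^ p) +
    K * (2^-1 * (enorm (grad phi x) `^ p + enorm (grad psi x) `^ p) - enorm (grad chi x) `^ p).
  apply: le_trans (HK _ _) _.
  have -> : grad chi x = 2^-1 *: (grad phi x + grad psi x).
    by rewrite scalerDr; exact: (grad_lin _ _ _ t1 t2).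
  by rewrite [2^-1 * (_ + _)]mulrC.
have HM : \int[mu]_x (enorm (grad phi x - grad psi x) `^ p) <=
    e' * (dirichlet p phi + dirichlet p psi) +
    K * (2^-1 * (dirichlet p phi + dirichlet p psi) - dirichlet p chi).
  exact: (Rintegral_le_comb measurableT i1 i2 i3 iB (fun x _ => HY x)).
apply: le_trans HM _; move: J1 J2 J3; rewrite !energyE Ichi => J1 J2 J3.
exact: (cauchy_arith p0 e0 K0 Q0 dl2 D1 D2 J1 J2 J3).
Qed.

End minimizing.

(** * Limits of test functions *)

Section generic.
Context d (T : measurableType d) (R : realType).
Variables (mu : {measure set T -> \bar R}) (D : set T) (mD : measurable D).
Implicit Types (f g A B C : T -> R).

Lemma integral_EFin f : mu.-integrable D (EFin \o f) ->
  (\int[mu]_(x in D) (f x)%:E = (\int[mu]_(x in D) f x)%R%:E)%E.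
Proof. by move=> Hf; rewrite fineK//; exact: (integrable_fin_num mD Hf). Qed.

Lemma Rintegral_lin (a b : R) f g : mu.-integrable D (EFin \o f) ->
  mu.-integrable D (EFin \o g) ->
  \int[mu]_(x in D) (a * f x + b * g x) =
  a * \int[mu]_(x in D) f x + b * \int[mu]_(x in D) g x.
Proof. by move=> i1 i2; rewrite RintegralD ?RintegralZl//; exact: integrable_scale. Qed.

Lemma integrable_lin (a b : R) f g : mu.-integrable D (EFin \o f) ->
  mu.-integrable D (EFin \o g) ->
  mu.-integrable D (EFin \o (fun x => a * f x + b * g x)).
Proof. by move=> i1 i2; apply: integrable_add => //; exact: integrable_scale. Qed.

Lemma le_Rintegral_lin (a b : R) f g A : mu.-integrable D (EFin \o f) ->
  mu.-integrable D (EFin \o g) -> mu.-integrable D (EFin \o A) ->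
  (forall x, D x -> A x <= a * f x + b * g x) ->
  \int[mu]_(x in D) A x <= a * \int[mu]_(x in D) f x + b * \int[mu]_(x in D) g x.
Proof.
move=> i1 i2 iA H; rewrite -Rintegral_lin//.
by apply: le_Rintegral => //; exact: integrable_lin.
Qed.

Lemma normr_Rintegral_sub_le (b e : R) A B C :
  mu.-integrable D (EFin \o A) -> mu.-integrable D (EFin \o B) -> mu.-integrable D (EFin \o C) ->
  (forall x, D x -> `|A x - B x| <= e * (A x + B x) + b * C x) ->
  `|\int[mu]_(x in D) A x - \int[mu]_(x in D) B x| <=
  e * (\int[mu]_(x in D) A x + \int[mu]_(x in D) B x) + b * \int[mu]_(x in D) C x.
Proof.
move=> iA iB iC H; rewrite -RintegralB//.
apply: le_trans (le_normr_Rintegral mD (integrable_sub mD iA iB)) _.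
have iAB := integrable_add mD iA iB.
apply: le_trans (le_Rintegral_lin iAB iC _ H) _.
  exact: integrable_norm (integrable_sub mD iA iB).
by rewrite RintegralD.
Qed.

End generic.

Section scalar_sequences.
Context {R : realType}.

Lemma cvg_squeeze0 (a b : nat -> R) : (forall n, 0 <= a n <= b n) ->
  b n @[n --> \oo] --> 0 -> a n @[n --> \oo] --> 0.
Proof.
move=> ab b0; apply: (@squeeze_cvgr _ _ _ _ (fun=> 0) b) => //; last exact: cvg_cst.
exact: nearW.
Qed.

(** The factor [e] multiplies a bounded quantity, since [a n <= Q * (b + c n)], and the rest is
    controlled by [c n]. It turns [powR_enorm_diff_bound] into a limit. *)
Lemma cvg_scheme (a c : nat -> R) (b Q : R) :
  (forall e, 0 < e -> exists2 K, 0 <= K &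
    forall n, `|a n - b| <= e * (a n + b) + K * c n) ->
  (forall n, 0 <= c n) -> 0 <= b -> 0 <= Q ->
  (forall n, a n <= Q * (b + c n)) -> c n @[n --> \oo] --> 0 ->
  a n @[n --> \oo] --> b.
Proof.
move=> H c0 b0 Q0 aQ cc; apply/cvgrPdist_le => e e0.
have L0 : 0 < Q * (b + 1) + b + 1 by rewrite ltr_wpDl// addr_ge0// mulr_ge0// addr_ge0.
have e10 : 0 < e / 2 / (Q * (b + 1) + b + 1) by rewrite !divr_gt0.
have [K K0 HK] := H _ e10.
have d0 : 0 < Num.min 1 (e / 2 / (K + 1)).
  by rewrite lt_min ltr01 !divr_gt0// ltr_wpDl.
have /cvgrPdist_le/(_ _ d0) := cc; apply: filterS => n.
rewrite sub0r normrN ger0_norm// le_min => /andP[cn1 cn2].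
rewrite distrC; apply: le_trans (HK n) _.
have A1 : e / 2 / (Q * (b + 1) + b + 1) * (a n + b) <= e / 2.
  rewrite -[leRHS](divfK (lt0r_neq0 L0)) ler_wpM2l ?(ltW e10)//.
  have : Q * (b + c n) <= Q * (b + 1) by rewrite ler_wpM2l// lerD2l.
  by have := aQ n; lra.
have A2 : K * c n <= e / 2.
  apply: (@le_trans _ _ ((K + 1) * (e / 2 / (K + 1)))); last first.
    by rewrite mulrC divfK// gt_eqF// ltr_wpDl.
  by apply: ler_pM => //; rewrite lerDl.
lra.
Qed.

Lemma normr_powRD (p a b : R) : 0 <= p ->
  `|a + b| `^ p <= 2 `^ p * (`|a| `^ p + `|b| `^ p).
Proof.
move=> p0; pose m := Num.max `|a| `|b|.
have m0 : 0 <= m by rewrite le_max normr_ge0.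
have abm : `|a + b| <= 2 * m.
  apply: le_trans (ler_normD _ _) _; rewrite mulr2n mulrDl mul1r.
  by apply: lerD; rewrite le_max lexx ?orbT.
apply: (@le_trans _ _ ((2 * m) `^ p)).
  by apply: ge0_ler_powR; rewrite ?nnegrE ?mulr_ge0.
rewrite powRM// ler_wpM2l ?powR_ge0// /m maxEle; case: ifP => _.
  by rewrite lerDr powR_ge0.
by rewrite lerDl powR_ge0.
Qed.

End scalar_sequences.

Section vector_facts.
Context {R : realType} {N : nat}.
Notation V := 'rV[R]_N.

Lemma enorm_powR_le_sum (p : R) (i0 : 'I_N) (x : V) : 0 <= p ->
  enorm x `^ p <= N%:R `^ p * \sum_i `|x ord0 i| `^ p.
Proof.
move=> p0.
have [i Hi] : exists i, forall j, `|x ord0 j| <= `|x ord0 i|.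
  by case: (arg_maxP (fun i => `|x ord0 i|) (erefl true : xpredT i0)) => i _ H; exists i => j; exact: H.
apply: (@le_trans _ _ ((N%:R * `|x ord0 i|) `^ p)).
  apply: ge0_ler_powR; rewrite ?nnegrE ?enorm_ge0 ?mulr_ge0//.
  apply: le_trans (enorm_le_sum x) _.
  apply: le_trans (ler_sum _ (fun j _ => Hi j)) _.
  by rewrite sumr_const card_ord mulr_natl.
rewrite powRM// ler_wpM2l ?powR_ge0// (bigD1 i)//= lerDl.
by apply: sumr_ge0 => j _; exact: powR_ge0.
Qed.

Lemma coord_powR_le (p : R) (x : V) i : 0 <= p -> `|x ord0 i| `^ p <= enorm x `^ p.
Proof.
by move=> p0; apply: ge0_ler_powR; rewrite ?nnegrE ?enorm_ge0 ?coord_le_enorm.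
Qed.

Context d (T : measurableType d) (D : set T).
Implicit Types (g h : T -> V).

Definition mcoord g := forall i, measurable_fun D (fun x => g x ord0 i).

Lemma measurable_mcoord g : measurable_fun D g -> mcoord g.
Proof. by move=> mg i; exact: (measurableT_comp (measurable_coord i) mg). Qed.

Lemma mcoord_measurable g : measurable D -> mcoord g -> measurable_fun D g.
Proof.
move=> mD mg.
have : measurable_fun setT (g \_ D).
  apply: measurable_fun_coord => i.
  rewrite (_ : (fun t => _) = (fun x => g x ord0 i) \_ D).
    by apply/(measurable_restrictT _ mD).1.
  by apply/funext => x; rewrite !patchE; case: ifP => // _; rewrite mxE.
by move/(measurable_restrictT _ mD).2.
Qed.

Lemma measurable_dotv g h : mcoord g -> mcoord h ->
  measurable_fun D (fun x => dotv (g x) (h x)).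
Proof. by move=> mg mh; apply: measurable_sum => i; exact: measurable_funM. Qed.

Lemma measurable_enorm g : mcoord g -> measurable_fun D (fun x => enorm (g x)).
Proof.
move=> mg; apply: (@measurableT_comp _ _ _ _ _ _ (@Num.sqrt R)).
  by apply: continuous_measurable_fun; exact: sqrt_continuous.
exact: measurable_dotv.
Qed.

Lemma measurable_enorm_powR (p : R) g : mcoord g ->
  measurable_fun D (fun x => enorm (g x) `^ p).
Proof.
move=> mg; apply: (@measurableT_comp _ _ _ _ _ _ (fun t : R => t `^ p)).
  exact: measurable_powR.
exact: measurable_enorm.
Qed.

Lemma mcoord_lin (a b : R) g h : mcoord g -> mcoord h ->
  mcoord (fun x => a *: g x + b *: h x).
Proof.
move=> mg mh i.
rewrite (_ : (fun x => _) = (fun x => a * g x ord0 i + b * h x ord0 i)); last first.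
  by apply/funext => x; rewrite !mxE.
by apply: measurable_funD; exact: measurable_funM.
Qed.

End vector_facts.

Section sobolev_limits.
Context {R : realType} {N : nat}.
Notation V := 'rV[R]_N.
Notation mu := (@lebesgue_rV R N).
Implicit Types (phi psi u v : V -> R) (g h : V -> V).
Variables (p : R) (Om : set V) (M : R) (i0 : 'I_N).
Hypotheses (p1 : 1 < p) (mOm : measurable Om).
Hypothesis OmM : forall x, Om x -> forall i, `|x ord0 i| <= M.
Notation intble f := (mu.-integrable Om (EFin \o f)).

Let p0 : 0 < p. Proof. exact: lt_trans ltr01 p1. Qed.

Lemma bounded_measure_lty : (mu Om < +oo)%E.
Proof.
have K0 : - (`|M| + 1) <= `|M| + 1 by have := normr_ge0 M; lra.
have [mB vB] := @lebesgue_rV_box R N _ _ K0.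
set B := [set x : V | _] in mB vB.
have vB' : (mu B < +oo)%E.
  by rewrite (_ : mu B = ((`|M| + 1 - - (`|M| + 1)) ^+ N)%:E)// ltry.
apply: le_lt_trans vB'.
apply: le_measure; rewrite ?inE// => x Ox i.
have := OmM Ox i; have := ler_norm M; rewrite ler_norml => ? /andP[? ?].
by apply/andP; split; lra.
Qed.
Let muOm := bounded_measure_lty.

(** The sequential form of [sobolev0]; [approx_sobolev0] and [sobolev0_approx] are the two
    directions. Integrability is recorded separately because a real-valued integral is [0] when the
    extended one is infinite, so the convergence fields alone would not force the distances to be
    small. *)
Record test_approx u g (phi : nat -> V -> R) : Prop := TestApprox {
  approx_test : forall n, test_function Om (phi n);
  approx_mu : measurable_fun Om u;
  approx_mg : mcoord Om g;
  approx_iu : forall n, intble (fun x => `|phi n x - u x| `^ p);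
  approx_ig : forall n, intble (fun x => enorm (grad (phi n) x - g x) `^ p);
  approx_cu : (\int[mu]_(x in Om) (`|phi n x - u x| `^ p))%R @[n --> \oo] --> (0 : R);
  approx_cg : (\int[mu]_(x in Om) (enorm (grad (phi n) x - g x) `^ p))%R @[n --> \oo] --> (0 : R) }.

Lemma test_integrable phi : test_function Om phi -> intble phi.
Proof. by move=> t; apply: Cc_integrableS => //; exact: test_Cc t. Qed.

Lemma test_measurable phi : test_function Om phi -> measurable_fun Om phi.
Proof. by move=> /test_integrable; exact: integrable_measurable. Qed.

Lemma test_grad_mcoord phi : test_function Om phi -> mcoord Om (grad phi).
Proof.
move=> t i; rewrite (_ : (fun x => _) = partial i phi); last by apply/funext => x; rewrite mxE.
apply: (integrable_measurable (mu := mu)).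
by apply: Cc_integrableS => //; exact: test_partial_Cc t.
Qed.

Lemma test_powR_integrable phi : test_function Om phi -> intble (fun x => `|phi x| `^ p).
Proof.
move=> t; apply: Cc_integrableS => //.
apply: (@Cc_comp _ _ (fun t : R => `|t| `^ p)); last exact: test_Cc t.
  exact: continuous_normr_powR.
by rewrite normr0 powR0// gt_eqF.
Qed.

Lemma test_grad_integrable phi : test_function Om phi ->
  intble (fun x => enorm (grad phi x) `^ p).
Proof. by move=> t; apply: Cc_integrableS => //; exact: test_energy_Cc t. Qed.

Lemma integrable_powRD (a b : V -> R) : measurable_fun Om (fun x => a x + b x) ->
  intble (fun x => `|a x| `^ p) -> intble (fun x => `|b x| `^ p) ->
  intble (fun x => `|a x + b x| `^ p).
Proof.
move=> mab ia ib.
apply: (@integrable_le _ _ _ _ _ mOm _ (fun x => 2 `^ p * (`|a x| `^ p + `|b x| `^ p))).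
- exact: measurable_normr_powR.
- by move=> x _; rewrite ger0_norm ?powR_ge0//; apply: normr_powRD; exact: ltW.
- by apply: integrable_scale => //; exact: integrable_add.
Qed.

Lemma integrable_enorm_powRD (a b : V -> V) : mcoord Om (fun x => a x + b x) ->
  intble (fun x => enorm (a x) `^ p) -> intble (fun x => enorm (b x) `^ p) ->
  intble (fun x => enorm (a x + b x) `^ p).
Proof.
move=> mab ia ib.
apply: (@integrable_le _ _ _ _ _ mOm _ (fun x => 2 `^ p * (enorm (a x) `^ p + enorm (b x) `^ p))).
- exact: measurable_enorm_powR.
- by move=> x _; rewrite ger0_norm ?powR_ge0//; apply: enorm_powRD.
- by apply: integrable_scale => //; exact: integrable_add.
Qed.

Lemma integrable_enorm_powRZ (c : R) (a : V -> V) :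
  intble (fun x => enorm (a x) `^ p) -> intble (fun x => enorm (c *: a x) `^ p).
Proof.
move=> ia; rewrite (_ : (fun x => _) = (fun x => `|c| `^ p * enorm (a x) `^ p)).
  exact: integrable_scale.
by apply/funext => x; rewrite enormZ powRM// enorm_ge0.
Qed.

Lemma integrable_powRZ (c : R) (a : V -> R) :
  intble (fun x => `|a x| `^ p) -> intble (fun x => `|c * a x| `^ p).
Proof.
move=> ia; rewrite (_ : (fun x => _) = (fun x => `|c| `^ p * `|a x| `^ p)).
  exact: integrable_scale.
by apply/funext => x; rewrite normrM powRM.
Qed.

Section one_limit.
Variables (u : V -> R) (g : V -> V) (phi : nat -> V -> R).
Hypothesis A : test_approx u g phi.

Lemma approx_powR_integrable : intble (fun x => `|u x| `^ p).
Proof.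
have t := approx_test A 0%N.
rewrite (_ : (fun x => _) = (fun x => `|phi 0%N x + (- 1) * (phi 0%N x - u x)| `^ p)); last first.
  by apply/funext => x; congr (`|_| `^ _); ring.
apply: integrable_powRD; last by apply: integrable_powRZ; exact: (approx_iu A).
  apply: measurable_funD; first exact: test_measurable.
  apply: measurable_funM => //; apply: measurable_funB; [exact: test_measurable|exact: approx_mu A].
exact: test_powR_integrable.
Qed.

Lemma approx_integrable : intble u.
Proof. exact: (integrable_Lp mOm p1 muOm (approx_mu A) approx_powR_integrable). Qed.

Lemma approx_grad_integrable : intble (fun x => enorm (g x) `^ p).
Proof.
have t := approx_test A 0%N.
have E x : g x = grad (phi 0%N) x + (-1) *: (grad (phi 0%N) x - g x).
  by rewrite scaleN1r opprB addrC subrK.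
rewrite (_ : (fun x => _) = (fun x => enorm (grad (phi 0%N) x + (-1) *: (grad (phi 0%N) x - g x)) `^ p)); last first.
  by apply/funext => x; rewrite -E.
apply: integrable_enorm_powRD.
- rewrite (_ : (fun x => _) = g); first exact: approx_mg A.
  by apply/funext => x; rewrite -E.
- exact: test_grad_integrable.
- by apply: integrable_enorm_powRZ; exact: (approx_ig A).
Qed.

Lemma approx_cvg_mul (k : V -> R) (C : R) : measurable_fun Om k ->
  (forall x, Om x -> `|k x| <= C) ->
  (\int[mu]_(x in Om) (phi n x * k x))%R @[n --> \oo] --> (\int[mu]_(x in Om) (u x * k x))%R.
Proof.
move=> mk kC; apply: (cvg_L1 mOm p1 muOm mk kC).
- by move=> n; exact: test_measurable (approx_test A n).
- exact: approx_mu A.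
- by move=> n; exact: test_integrable (approx_test A n).
- exact: approx_integrable.
- exact: approx_iu A.
- exact: approx_cu A.
Qed.

Lemma approx_cvg_int :
  (\int[mu]_(x in Om) (phi n x))%R @[n --> \oo] --> (\int[mu]_(x in Om) (u x))%R.
Proof.
have := @approx_cvg_mul (fun=> 1) 1 (measurable_cst _) _.
under [X in _ --> X]eq_Rintegral do rewrite mulr1.
under eq_fun do under eq_Rintegral do rewrite mulr1.
by apply => x _; rewrite normr1.
Qed.

Lemma approx_coord_integrable i n :
  intble (fun x => `|partial i (phi n) x - g x ord0 i| `^ p).
Proof.
apply: (@integrable_le _ _ _ _ _ mOm _ _ _ _ (approx_ig A n)).
  apply: measurable_normr_powR => //; apply: measurable_funB; last exact: (approx_mg A).
  have := test_grad_mcoord (approx_test A n) i; under eq_fun do rewrite mxE.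
  by [].
move=> x _; rewrite ger0_norm ?powR_ge0//.
by have := coord_powR_le (grad (phi n) x - g x) i (ltW p0); rewrite !mxE.
Qed.

Lemma approx_coord_cvg i :
  (\int[mu]_(x in Om) (`|partial i (phi n) x - g x ord0 i| `^ p))%R @[n --> \oo] --> (0 : R).
Proof.
apply: cvg_squeeze0 (approx_cg A) => n; apply/andP; split.
  by apply: Rintegral_ge0 => x _; exact: powR_ge0.
apply: le_Rintegral => //; [exact: approx_coord_integrable|exact: (approx_ig A)|].
by move=> x _; have := coord_powR_le (grad (phi n) x - g x) i (ltW p0); rewrite !mxE.
Qed.

Lemma approx_coord_int i : intble (fun x => g x ord0 i).
Proof.
apply: (integrable_Lp mOm p1 muOm (approx_mg A i)).
apply: (@integrable_le _ _ _ _ _ mOm _ _ _ _ approx_grad_integrable).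
  by apply: measurable_normr_powR => //; exact: (approx_mg A).
by move=> x _; rewrite ger0_norm ?powR_ge0//; apply: coord_powR_le; exact: ltW.
Qed.

Lemma approx_cvg_coord_mul i (k : V -> R) (C : R) : measurable_fun Om k ->
  (forall x, Om x -> `|k x| <= C) ->
  (\int[mu]_(x in Om) (partial i (phi n) x * k x))%R @[n --> \oo] -->
  (\int[mu]_(x in Om) (g x ord0 i * k x))%R.
Proof.
move=> mk kC; apply: (cvg_L1 mOm p1 muOm mk kC).
- move=> n; have := test_grad_mcoord (approx_test A n) i; under eq_fun do rewrite mxE.
  by [].
- exact: (approx_mg A).
- by move=> n; apply: Cc_integrableS => //; exact: test_partial_Cc (approx_test A n).
- exact: approx_coord_int.
- exact: approx_coord_integrable.
- exact: approx_coord_cvg.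
Qed.

Lemma approx_cvg_dirichlet :
  dirichlet p (phi n) @[n --> \oo] --> (\int[mu]_(x in Om) (enorm (g x) `^ p))%R.
Proof.
have E n : dirichlet p (phi n) = \int[mu]_(x in Om) (enorm (grad (phi n) x) `^ p).
  apply/esym/Rintegral_outside => x Ox.
  rewrite (grad0 (phi := phi n)) ?enorm0 ?powR0 ?gt_eqF// => i.
  exact: test_partial_out (approx_test A n) Ox.
have iphi n := test_grad_integrable (approx_test A n).
have ig := approx_grad_integrable.
apply: (cvg_scheme _ _ _ (powR_ge0 2 p) _ (approx_cg A)).
- move=> e e0; have [K K0 HK] := @powR_enorm_diff_bound R N p e p1 e0.
  exists K => // n; rewrite E.
  exact: (normr_Rintegral_sub_le mOm (iphi n) ig (approx_ig A n) (fun x _ => HK _ _)).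
- by move=> n; apply: Rintegral_ge0 => x _; exact: powR_ge0.
- by apply: Rintegral_ge0 => x _; exact: powR_ge0.
- move=> n; rewrite E mulrDr.
  apply: le_Rintegral_lin => //; first exact: (approx_ig A).
  move=> x _; rewrite -mulrDr.
  have := enorm_powRD (g x) (grad (phi n) x - g x) p1.
  by rewrite addrCA subrr addr0.
Qed.

(** Integration by parts holds for each [phi n]; both sides pass to the limit because the test
    function and its derivative are bounded. *)
Lemma approx_weak_gradient : weak_gradient Om u g.
Proof.
move=> eta teta i.
have [C _ HC] := Cc_bounded (test_Cc teta).
have [C' _ HC'] := Cc_bounded (test_partial_Cc i teta).
have mp : measurable_fun Om (partial i eta).
  by have := test_grad_mcoord teta i; under eq_fun do rewrite mxE.
have c1 := approx_cvg_mul mp (fun x _ => HC' x).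
have c2 := @approx_cvg_coord_mul i _ _ (test_measurable teta) (fun x _ => HC x).
have E n : \int[mu]_(x in Om) (phi n x * partial i eta x) =
    - \int[mu]_(x in Om) (partial i (phi n) x * eta x).
  have E1 : \int[mu]_(x in Om) (phi n x * partial i eta x) = \int[mu]_x (phi n x * partial i eta x).
    by apply: Rintegral_outside => x Ox; rewrite (test_partial_out i teta Ox) mulr0.
  have E2 : \int[mu]_(x in Om) (partial i (phi n) x * eta x) = \int[mu]_x (partial i (phi n) x * eta x).
    by apply: Rintegral_outside => x Ox; rewrite (test_out teta Ox) mulr0.
  by rewrite E1 E2; exact: (Rintegral_test_by_parts i (approx_test A n) teta).
have EE : (fun n => \int[mu]_(x in Om) (phi n x * partial i eta x)) =
    (fun n => - \int[mu]_(x in Om) (partial i (phi n) x * eta x)) by apply/funext => n; exact: E.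
rewrite EE in c1.
exact: (cvg_unique (@Rhausdorff R) c1 (cvgN c2)).
Qed.

Lemma approx_sobolev0 : sobolev0 Om p u g.
Proof.
split.
  split; last exact: approx_weak_gradient.
    split; first exact: approx_mu A.
    by have := integral_EFin mOm approx_powR_integrable; rewrite /= => ->; rewrite ltry.
  split; first exact: (mcoord_measurable mOm (approx_mg A)).
  by have := integral_EFin mOm approx_grad_integrable; rewrite /= => ->; rewrite ltry.
move=> e e0; have e20 : 0 < e / 2 by rewrite divr_gt0.
have [n1 _ H1] : \forall n \near \oo, `|0 - \int[mu]_(x in Om) (`|phi n x - u x| `^ p)| < e / 2.
  by have /cvgrPdist_lt/(_ _ e20) := approx_cu A.
have [n2 _ H2] : \forall n \near \oo, `|0 - \int[mu]_(x in Om) (enorm (grad (phi n) x - g x) `^ p)| < e / 2.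
  by have /cvgrPdist_lt/(_ _ e20) := approx_cg A.
exists (phi (maxn n1 n2)); first exact: approx_test A _.
rewrite (integral_EFin mOm (approx_iu A _)) (integral_EFin mOm (approx_ig A _)).
rewrite -EFinD lte_fin.
have := H1 (maxn n1 n2) (leq_maxl _ _); have := H2 (maxn n1 n2) (leq_maxr _ _).
rewrite /= !sub0r !normrN => h2 h1.
by rewrite [ltRHS]splitr ltrD// (le_lt_trans (ler_norm _)).
Qed.

End one_limit.

Lemma sobolev0_approx u g : sobolev0 Om p u g -> exists phi : nat -> V -> R, test_approx u g phi.
Proof.
move=> [[[mu_ _] [mg_ _] _] H].
have n0 (n : nat) : 0 < (n.+1%:R^-1 : R) by rewrite invr_gt0 ltr0n.
have {}H (n : nat) : exists phi, test_function Om phi /\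
    (\int[mu]_(x in Om) (`|phi x - u x| `^ p)%:E +
     \int[mu]_(x in Om) (enorm (grad phi x - g x) `^ p)%:E < (n.+1%:R^-1)%:E)%E.
  by have [phi t Hphi] := H _ (n0 n); exists phi.
have [phi /all_and2[t Hphi]] := choice H.
have pos1 n : (0 <= \int[mu]_(x in Om) (`|phi n x - u x| `^ p)%:E)%E.
  by apply: integral_ge0 => x _; rewrite lee_fin powR_ge0.
have pos2 n : (0 <= \int[mu]_(x in Om) (enorm (grad (phi n) x - g x) `^ p)%:E)%E.
  by apply: integral_ge0 => x _; rewrite lee_fin powR_ge0.
have lt1 n : (\int[mu]_(x in Om) (`|phi n x - u x| `^ p)%:E < (n.+1%:R^-1)%:E)%E.
  by apply: le_lt_trans (Hphi n); rewrite leeDl.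
have lt2 n : (\int[mu]_(x in Om) (enorm (grad (phi n) x - g x) `^ p)%:E < (n.+1%:R^-1)%:E)%E.
  by apply: le_lt_trans (Hphi n); rewrite leeDr.
have mcg := measurable_mcoord mg_.
have i1 n : intble (fun x => `|phi n x - u x| `^ p).
  apply: integrable_normr_powR; last by apply: lt_trans (lt1 n) _; rewrite ltry.
  by apply: measurable_funB => //; exact: test_measurable (t n).
have mcd n : mcoord Om (fun x => grad (phi n) x - g x).
  rewrite (_ : (fun x => _) = (fun x => 1 *: grad (phi n) x + (-1) *: g x)).
    by apply: mcoord_lin => //; exact: test_grad_mcoord (t n).
  by apply/funext => x; rewrite scale1r scaleN1r.
have i2 n : intble (fun x => enorm (grad (phi n) x - g x) `^ p).
  apply/integrableP; split.
    by apply/measurable_EFinP; exact: measurable_enorm_powR.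
  rewrite (eq_integral (fun x => (enorm (grad (phi n) x - g x) `^ p)%:E)); last first.
    by move=> x _ /=; rewrite ger0_norm// powR_ge0.
  by apply: lt_trans (lt2 n) _; rewrite ltry.
exists phi; split => //.
- apply: (cvg_squeeze0 _ (@cvg_harmonic R)) => n; apply/andP; split.
    by apply: Rintegral_ge0 => x _; exact: powR_ge0.
  by rewrite -lee_fin -(integral_EFin mOm (i1 n)) ltW.
- apply: (cvg_squeeze0 _ (@cvg_harmonic R)) => n; apply/andP; split.
    by apply: Rintegral_ge0 => x _; exact: powR_ge0.
  by rewrite -lee_fin -(integral_EFin mOm (i2 n)) ltW.
Qed.

(** Makes the perturbations [u + t v] of the Euler-Lagrange argument admissible. *)
Lemma approx_lin (a b : R) u g (phi : nat -> V -> R) v h (psi : nat -> V -> R) : test_approx u g phi -> test_approx v h psi ->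
  test_approx (fun x => a * u x + b * v x) (fun x => a *: g x + b *: h x)
    (fun n x => a * phi n x + b * psi n x).
Proof.
move=> A B.
have t n : test_function Om (fun x => a * phi n x + b * psi n x).
  by apply: test_lin; [exact: approx_test A n|exact: approx_test B n].
have mu_ : measurable_fun Om (fun x => a * u x + b * v x).
  by apply: measurable_funD; apply: measurable_funM => //; [exact: approx_mu A|exact: approx_mu B].
have mg_ : mcoord Om (fun x => a *: g x + b *: h x).
  by apply: mcoord_lin; [exact: approx_mg A|exact: approx_mg B].
pose a' := 2 `^ p * `|a| `^ p; pose b' := 2 `^ p * `|b| `^ p.
have Bu n x : `|(a * phi n x + b * psi n x) - (a * u x + b * v x)| `^ p <=
    a' * `|phi n x - u x| `^ p + b' * `|psi n x - v x| `^ p.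
  have -> : (a * phi n x + b * psi n x) - (a * u x + b * v x) =
    a * (phi n x - u x) + b * (psi n x - v x) by ring.
  apply: le_trans (normr_powRD _ _ (ltW p0)) _.
  by rewrite !normrM !powRM// mulrDr !mulrA.
have Bg n x : enorm (grad (fun x => a * phi n x + b * psi n x) x - (a *: g x + b *: h x)) `^ p <=
    a' * enorm (grad (phi n) x - g x) `^ p + b' * enorm (grad (psi n) x - h x) `^ p.
  have -> : grad (fun x => a * phi n x + b * psi n x) x - (a *: g x + b *: h x) =
      a *: (grad (phi n) x - g x) + b *: (grad (psi n) x - h x).
    by rewrite (grad_lin _ _ _ (approx_test A n) (approx_test B n)) !scalerBr opprD addrACA.
  apply: le_trans (enorm_powRD _ _ p1) _.
  by rewrite !enormZ !powRM ?enorm_ge0// mulrDr !mulrA.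
have iu n : intble (fun x => `|(a * phi n x + b * psi n x) - (a * u x + b * v x)| `^ p).
  apply: (@integrable_le _ _ _ _ _ mOm _ _ _ _ (integrable_lin mOm a' b' (approx_iu A n) (approx_iu B n))).
    by apply: measurable_normr_powR => //; apply: measurable_funB => //; exact: test_measurable.
  by move=> x _; rewrite ger0_norm ?powR_ge0//; exact: Bu.
have mcd n : mcoord Om (fun x => grad (fun x => a * phi n x + b * psi n x) x - (a *: g x + b *: h x)).
  rewrite (_ : (fun x => _) = (fun x => 1 *: grad (fun x => a * phi n x + b * psi n x) x + (-1) *: (a *: g x + b *: h x))).
    by apply: mcoord_lin => //; exact: test_grad_mcoord.
  by apply/funext => x; rewrite scale1r scaleN1r.
have ig n : intble (fun x => enorm (grad (fun x => a * phi n x + b * psi n x) x - (a *: g x + b *: h x)) `^ p).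
  apply: (@integrable_le _ _ _ _ _ mOm _ _ _ _ (integrable_lin mOm a' b' (approx_ig A n) (approx_ig B n))).
    exact: measurable_enorm_powR.
  by move=> x _; rewrite ger0_norm ?powR_ge0//; exact: Bg.
have c0 (s r : nat -> R) : s n @[n --> \oo] --> (0 : R) -> r n @[n --> \oo] --> (0 : R) ->
    (a' * s n + b' * r n) @[n --> \oo] --> (0 : R).
  move=> s0 r0; rewrite -[X in _ --> X](addr0 0) -[X in _ --> X + _](mulr0 a') -[X in _ --> _ + X](mulr0 b').
  by apply: cvgD; apply: cvgMr.
split => //.
- apply: (cvg_squeeze0 _ (c0 _ _ (approx_cu A) (approx_cu B))) => n; apply/andP; split.
    by apply: Rintegral_ge0 => x _; exact: powR_ge0.
  by apply: (le_Rintegral_lin mOm (approx_iu A n) (approx_iu B n)) => // x _; exact: Bu.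
- apply: (cvg_squeeze0 _ (c0 _ _ (approx_cg A) (approx_cg B))) => n; apply/andP; split.
    by apply: Rintegral_ge0 => x _; exact: powR_ge0.
  by apply: (le_Rintegral_lin mOm (approx_ig A n) (approx_ig B n)) => // x _; exact: Bg.
Qed.

Lemma approx_const phi : test_function Om phi -> test_approx phi (grad phi) (fun=> phi).
Proof.
move=> t.
have E1 : (fun x => `|phi x - phi x| `^ p) = fun=> 0.
  by apply/funext => x; rewrite subrr normr0 powR0// gt_eqF.
have E2 : (fun x => enorm (grad phi x - grad phi x) `^ p) = fun=> 0.
  by apply/funext => x; rewrite subrr enorm0 powR0// gt_eqF.
have i0' : intble (fun _ : V => 0 : R) by exact: integrable_const.
have I0 : \int[mu]_(x in Om) (0 : R) = 0 by rewrite Rintegral_cst// mul0r.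
split => //.
- exact: test_measurable.
- exact: test_grad_mcoord.
- by rewrite E1.
- by rewrite E2.
- by rewrite E1 I0; exact: cvg_cst.
- by rewrite E2 I0; exact: cvg_cst.
Qed.

End sobolev_limits.

Lemma el_arith (R : realType) (p t A G F U W : R) : 0 < p ->
  A <= 1 * G + p * t * F -> p^-1 * G - U <= p^-1 * A - (1 * U + t * W) -> t * W <= t * F.
Proof.
move=> p0 H1 H2.
have H3 : p^-1 * A <= p^-1 * G + t * F.
  apply: le_trans (ler_wpM2l _ H1) _; first by rewrite invr_ge0 ltW.
  by rewrite mul1r mulrDr !mulrA mulVf ?mul1r// gt_eqF.
lra.
Qed.

Lemma solution_arith (R : realType) (p G D U F : R) : 0 < p ->
  G <= 1 * D + - p * (1 * F + -1 * U) -> p^-1 * G - U <= p^-1 * D - F.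
Proof.
move=> p0 H.
have : p^-1 * G <= p^-1 * D - (F - U).
  apply: le_trans (ler_wpM2l _ H) _; first by rewrite invr_ge0 ltW.
  by rewrite !mul1r mulN1r mulrDr mulNr mulrN mulrA mulVf ?mul1r// gt_eqF.
lra.
Qed.

(** * Existence of the torsion function *)

Section torsion_existence.
Context {R : realType} {N : nat}.
Notation V := 'rV[R]_N.
Notation mu := (@lebesgue_rV R N).
Implicit Types (phi psi u v : V -> R) (g h : V -> V).
Variables (p : R) (Om : set V) (M : R) (i0 : 'I_N).
Hypotheses (p1 : 1 < p) (mOm : measurable Om).
Hypothesis OmM : forall x, Om x -> forall i, `|x ord0 i| <= M.
Notation intble f := (mu.-integrable Om (EFin \o f)).

Let p0 : 0 < p. Proof. exact: lt_trans ltr01 p1. Qed.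
Let muOm := bounded_measure_lty mOm OmM.

Lemma test_sub Om' phi psi : test_function Om' phi -> test_function Om' psi ->
  test_function Om' (fun x => phi x - psi x).
Proof.
move=> t1 t2; rewrite (_ : (fun x => _) = (fun x => 1 * phi x + (-1) * psi x)); first exact: test_lin.
by apply/funext => x; rewrite mul1r mulN1r.
Qed.

Lemma grad_sub Om' phi psi x : test_function Om' phi -> test_function Om' psi ->
  grad (fun x => phi x - psi x) x = grad phi x - grad psi x.
Proof.
move=> t1 t2; rewrite (_ : (fun x => phi x - psi x) = (fun x => 1 * phi x + (-1) * psi x)).
  by rewrite (grad_lin 1 (-1) x t1 t2) scale1r scaleN1r.
by apply/funext => y; rewrite mul1r mulN1r.
Qed.

(** The Poincaré inequality, applied to [phi - psi], adds the functions themselves to the Cauchy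
    property of the gradients. *)
Lemma minimizing_dist e : 0 < e -> exists2 d, 0 < d & forall phi psi,
  test_function Om phi -> test_function Om psi ->
  energy p phi <= torsion_energy p Om + d -> energy p psi <= torsion_energy p Om + d ->
  \int[mu]_(x in Om) (`|phi x - psi x| `^ p) <= e /\
  \int[mu]_(x in Om) (enorm (grad phi x - grad psi x) `^ p) <= e.
Proof.
move=> e0; have [K K0 HK] := poincare M i0 p1.
have K1 : 0 < K + 1 by rewrite ltr_wpDl.
have e'0 : 0 < e / (K + 1) by rewrite divr_gt0.
have eKe : K * (e / (K + 1)) <= e.
  by rewrite mulrCA ger_pMr// ler_pdivrMr// mul1r lerDl.
have eKe' : e / (K + 1) <= e by rewrite ler_pdivrMr// ler_pMr// lerDr.
have [d d0 Hd] := minimizing_cauchy i0 p1 OmM e'0.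
exists d => // phi psi t1 t2 J1 J2.
have H := Hd _ _ t1 t2 J1 J2.
have t3 := test_sub t1 t2.
have E1 : \int[mu]_(x in Om) (`|phi x - psi x| `^ p) = \int[mu]_x (`|phi x - psi x| `^ p).
  apply: Rintegral_outside => x Ox; rewrite (test_out t1 Ox) (test_out t2 Ox) subrr normr0 powR0//.
  by rewrite gt_eqF.
have E2 : \int[mu]_(x in Om) (enorm (grad phi x - grad psi x) `^ p) =
   \int[mu]_x (enorm (grad phi x - grad psi x) `^ p).
  apply: Rintegral_outside => x Ox; rewrite -(grad_sub x t1 t2) grad0.
    by rewrite enorm0 powR0// gt_eqF.
  by move=> i; exact: test_partial_out t3 Ox.
have E3 : \int[mu]_x (enorm (grad (fun y => phi y - psi y) x) `^ p) =
   \int[mu]_x (enorm (grad phi x - grad psi x) `^ p).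
  by congr (Rintegral _ _ _); apply/funext => x; rewrite (grad_sub x t1 t2).
have P := HK _ _ OmM t3; rewrite E3 in P.
rewrite E1 E2; split.
  apply: le_trans P _; apply: (le_trans (ler_wpM2l K0 H)).
  exact: eKe.
exact: le_trans H eKe'.
Qed.

Lemma cvg_geometric_powR (c : R) : (c * (2 * 2^-1 ^+ n) `^ p) @[n --> \oo] --> (0 : R).
Proof.
rewrite -[X in _ --> X](mulr0 c); apply: cvgMr.
have E : (fun n => (2 * 2^-1 ^+ n) `^ p) = (fun t : R => `|t| `^ p) \o (fun n => 2 * 2^-1 ^+ n).
  by apply/funext => n /=; rewrite ger0_norm// mulr_ge0// exprn_ge0.
rewrite E.
have c0 : `|(0 : R)| `^ p = 0 by rewrite normr0 powR0// gt_eqF.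
have -> : (0 : R) = `|2 * (0 : R)| `^ p by rewrite mulr0 c0.
apply: continuous_cvg; first exact: (continuous_normr_powR p0).
by apply: cvgMr; apply: cvg_expr; rewrite ger0_norm// invf_lt1// ltr1n.
Qed.

Lemma integrable_sum_ord n (f : 'I_n -> V -> R) :
  (forall i, intble (f i)) -> intble (fun x => \sum_(i < n) f i x) /\
  \int[mu]_(x in Om) (\sum_(i < n) f i x) = \sum_(i < n) \int[mu]_(x in Om) f i x.
Proof.
elim: n f => [|n IH] f If.
  split.
    rewrite (_ : (fun x => _) = fun=> 0); first by apply: integrable_const.
    by apply/funext => x; rewrite big_ord0.
  rewrite big_ord0 (_ : (fun x => _) = fun=> 0); first by rewrite Rintegral_cst// mul0r.
  by apply/funext => x; rewrite big_ord0.
have [i1 i2] := IH (fun i => f (widen_ord (leqnSn n) i)) (fun i => If _).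
have E : (fun x => \sum_(i < n.+1) f i x) =
  (fun x => (\sum_(i < n) f (widen_ord (leqnSn n) i) x) + f ord_max x).
  by apply/funext => x; rewrite big_ord_recr.
rewrite E; split; first exact: integrable_add.
by rewrite big_ord_recr/= RintegralD// i2.
Qed.


Lemma approx_of_bounds (u : V -> R) (gi : 'I_N -> V -> R) (phi : nat -> V -> R) :
  (forall n, test_function Om (phi n)) -> measurable_fun Om u ->
  (forall i, measurable_fun Om (gi i)) ->
  (forall n, (\int[mu]_(x in Om) (`|phi n x - u x| `^ p)%:E <= ((2 * 2^-1 ^+ n) `^ p * 2)%:E)%E) ->
  (forall n i, (\int[mu]_(x in Om) (`|partial i (phi n) x - gi i x| `^ p)%:E <=
    ((2 * 2^-1 ^+ n) `^ p * 2)%:E)%E) ->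
  test_approx p Om u (fun x => \row_i gi i x) phi.
Proof.
move=> t mu_ mg Hu Hg.
have mc : mcoord Om (fun x => \row_i gi i x).
  by move=> i; under eq_fun do rewrite mxE; exact: mg.
have mci n : mcoord Om (fun x => grad (phi n) x - \row_i gi i x).
  rewrite (_ : (fun x => _) = (fun x => 1 *: grad (phi n) x + (-1) *: (\row_i gi i x))).
    by apply: mcoord_lin => //; exact: test_grad_mcoord (t n).
  by apply/funext => x; rewrite scale1r scaleN1r.
have iu n : intble (fun x => `|phi n x - u x| `^ p).
  apply: integrable_normr_powR => //.
    by apply: measurable_funB => //; exact: test_measurable.
  by apply: le_lt_trans (Hu n) _; rewrite ltry.
have ii n i : intble (fun x => `|partial i (phi n) x - gi i x| `^ p).
  apply: integrable_normr_powR => //.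
    apply: measurable_funB => //.
    by have := test_grad_mcoord mOm (t n) i; under eq_fun do rewrite mxE.
  by apply: le_lt_trans (Hg n i) _; rewrite ltry.
have [is_ Es] : (forall n, intble (fun x => \sum_i `|partial i (phi n) x - gi i x| `^ p)) /\
    (forall n, \int[mu]_(x in Om) (\sum_i `|partial i (phi n) x - gi i x| `^ p) =
    \sum_i \int[mu]_(x in Om) (`|partial i (phi n) x - gi i x| `^ p)).
  by split=> n; have [] := integrable_sum_ord (ii n).
have Bg n x : enorm (grad (phi n) x - \row_i gi i x) `^ p <=
    N%:R `^ p * \sum_i `|partial i (phi n) x - gi i x| `^ p.
  apply: le_trans (enorm_powR_le_sum i0 _ (ltW p0)) _.
  rewrite ler_wpM2l ?powR_ge0//; apply: ler_sum => i _.
  by rewrite !mxE.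
have ig n : intble (fun x => enorm (grad (phi n) x - \row_i gi i x) `^ p).
  apply: (@integrable_le _ _ _ _ _ mOm _ _ _ _ (integrable_scale mOm (N%:R `^ p) (is_ n))).
    exact: measurable_enorm_powR.
  by move=> x _; rewrite ger0_norm ?powR_ge0//; exact: Bg.
split => //.
- apply: (cvg_squeeze0 _ (cvg_geometric_powR 2)) => n; apply/andP; split.
    by apply: Rintegral_ge0 => x _; exact: powR_ge0.
  by rewrite -lee_fin -(integral_EFin mOm (iu n)) mulrC.
- apply: (cvg_squeeze0 _ (cvg_geometric_powR (N%:R `^ p * (2 *+ N)))) => n; apply/andP; split.
    by apply: Rintegral_ge0 => x _; exact: powR_ge0.
  apply: (@le_trans _ _ (N%:R `^ p * \int[mu]_(x in Om) (\sum_i `|partial i (phi n) x - gi i x| `^ p))).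
    by rewrite -RintegralZl//; apply: le_Rintegral => //; exact: integrable_scale.
  rewrite -mulrA ler_wpM2l ?powR_ge0// Es -[in leRHS](card_ord N) -sumr_const mulr_suml.
  apply: ler_sum => i _.
  by rewrite -lee_fin -(integral_EFin mOm (ii n i)) mulrC.
Qed.

Lemma minimizer_exists : exists u g (phi : nat -> V -> R), test_approx p Om u g phi /\
  energy p (phi n) @[n --> \oo] --> torsion_energy p Om.
Proof.
(* The tolerance is the one that [Lp_complete] requires of consecutive terms. *)
have e0 n : 0 < (2^-1 ^+ n * (2^-1 ^+ n) `^ p : R).
  by rewrite mulr_gt0 ?powR_gt0 ?exprn_gt0.
have H n : exists d, 0 < d /\ forall phi psi,
  test_function Om phi -> test_function Om psi ->
  energy p phi <= torsion_energy p Om + d -> energy p psi <= torsion_energy p Om + d ->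
  \int[mu]_(x in Om) (`|phi x - psi x| `^ p) <= 2^-1 ^+ n * (2^-1 ^+ n) `^ p /\
  \int[mu]_(x in Om) (enorm (grad phi x - grad psi x) `^ p) <= 2^-1 ^+ n * (2^-1 ^+ n) `^ p.
  by have [d d0 Hd] := minimizing_dist (e0 n); exists d.
have [d /all_and2[d0 Hd]] := choice H.
(* The tolerance [d n] has to hold for both [phi n.+1] and [phi n], so each function meets that of
   its own index and that of the preceding one. The bound [n.+1%:R^-1] makes the energies converge
   to the infimum. *)
have {}H n : exists phi, test_function Om phi /\ [/\ energy p phi <= torsion_energy p Om + d n,
    energy p phi <= torsion_energy p Om + d n.-1 & energy p phi <= torsion_energy p Om + n.+1%:R^-1].
  have m0 : 0 < Num.min (d n) (Num.min (d n.-1) n.+1%:R^-1).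
    by rewrite !lt_min !d0 invr_gt0 ltr0n.
  have [phi t /ltW Hphi] := torsion_energy_adherent i0 p1 OmM m0.
  exists phi; split=> //; split; apply: le_trans Hphi _; rewrite lerD2l !ge_min lexx ?orbT//.
have [phi /all_and2[t HH]] := choice H.
have {}Hd n : \int[mu]_(x in Om) (`|phi n.+1 x - phi n x| `^ p) <= 2^-1 ^+ n * (2^-1 ^+ n) `^ p /\
  \int[mu]_(x in Om) (enorm (grad (phi n.+1) x - grad (phi n) x) `^ p) <= 2^-1 ^+ n * (2^-1 ^+ n) `^ p.
  by apply: Hd => //; [have [_ /= ? _] := HH n.+1|have [? _ _] := HH n].
have tB n := test_sub (t n.+1) (t n).
have id1 n := test_powR_integrable p1 mOm (tB n).
have ig n : intble (fun x => enorm (grad (phi n.+1) x - grad (phi n) x) `^ p).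
  have := test_grad_integrable p1 mOm (tB n).
  rewrite (_ : (fun x => enorm _ `^ p) = (fun x => enorm (grad (phi n.+1) x - grad (phi n) x) `^ p))//.
  by apply/funext => x; rewrite (grad_sub x (t n.+1) (t n)).
have mpart i n : measurable_fun Om (partial i (phi n)).
  by have := test_grad_mcoord mOm (t n) i; under eq_fun do rewrite mxE.
have ii i n : intble (fun x => `|partial i (phi n.+1) x - partial i (phi n) x| `^ p).
  apply: (@integrable_le _ _ _ _ _ mOm _ _ _ _ (ig n)).
    by apply: measurable_normr_powR => //; exact: measurable_funB.
  move=> x _; rewrite ger0_norm ?powR_ge0//.
  by have := coord_powR_le (grad (phi n.+1) x - grad (phi n) x) i (ltW p0); rewrite !mxE.
have H0 n : (\int[mu]_(x in Om) (`|phi n.+1 x - phi n x| `^ p)%:E <=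
              (2^-1 ^+ n * (2^-1 ^+ n) `^ p)%:E)%E.
  by rewrite (integral_EFin mOm (id1 n)) lee_fin; exact: (Hd n).1.
have [u mu_ Hu] := Lp_complete mOm p1 (fun n => test_measurable mOm (t n)) H0.
have Hi i : exists g : V -> R, measurable_fun Om g /\ forall n,
    (\int[mu]_(x in Om) (`|partial i (phi n) x - g x| `^ p)%:E <= ((2 * 2^-1 ^+ n) `^ p * 2)%:E)%E.
  have HH' n : (\int[mu]_(x in Om) (`|partial i (phi n.+1) x - partial i (phi n) x| `^ p)%:E <=
              (2^-1 ^+ n * (2^-1 ^+ n) `^ p)%:E)%E.
    rewrite (integral_EFin mOm (ii i n)) lee_fin; apply: le_trans (Hd n).2.
    apply: le_Rintegral => // x _.
    by have := coord_powR_le (grad (phi n.+1) x - grad (phi n) x) i (ltW p0); rewrite !mxE.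
  by have [g mg Hg] := Lp_complete mOm p1 (mpart i) HH'; exists g.
have [gi /all_and2[mgi Hgi]] := choice Hi.
exists u, (fun x => \row_i gi i x), phi; split; first exact: approx_of_bounds.
apply/(@cvgrPdist_le R R) => e e1.
near=> n.
have [_ _ Hn] := HH n; have Hl := torsion_energy_le i0 p1 OmM (t n).
rewrite distrC ger0_norm ?subr_ge0// lerBlDl; apply: le_trans Hn _.
rewrite lerD2l.
near: n; have /cvgrPdist_le/(_ _ e1) := @cvg_harmonic R.
by apply: filterS => n; rewrite sub0r normrN ger0_norm// invr_ge0.
Unshelve. all: by end_near.
Qed.


Lemma cvg_ge_cst (a : nat -> R) (c l : R) : a n @[n --> \oo] --> l -> (forall n, c <= a n) -> c <= l.
Proof. by move=> al ca; apply: (ler_cvg_to (@cvg_cst _ c nat \oo _) al); exact: nearW. Qed.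

Definition sobolev_energy u g : R :=
  p^-1 * \int[mu]_(x in Om) (enorm (g x) `^ p) - \int[mu]_(x in Om) u x.

Lemma energy_cvg u g (phi : nat -> V -> R) : test_approx p Om u g phi ->
  energy p (phi n) @[n --> \oo] --> sobolev_energy u g.
Proof.
move=> A.
have c1 := approx_cvg_dirichlet p1 mOm A.
have c2 := approx_cvg_int p1 mOm OmM A.
have E n : energy p (phi n) = p^-1 * dirichlet p (phi n) - \int[mu]_(x in Om) phi n x.
  rewrite energyE; congr (_ - _); apply/esym/Rintegral_outside => x Ox.
  exact: (test_out (approx_test A n) Ox).
have -> : (fun n => energy p (phi n)) = (fun n => p^-1 * dirichlet p (phi n) - \int[mu]_(x in Om) phi n x).
  by apply/funext => n; exact: E.
by apply: cvgB c2; apply: cvgMr.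
Qed.

Lemma sobolev_energy_ge u g (phi : nat -> V -> R) : test_approx p Om u g phi ->
  torsion_energy p Om <= sobolev_energy u g.
Proof.
move=> A; apply: (cvg_ge_cst (energy_cvg A)) => n.
exact: (torsion_energy_le i0 p1 OmM (approx_test A n)).
Qed.

Lemma flux_integrable g h : mcoord Om g -> mcoord Om h ->
  intble (fun x => enorm (g x) `^ p) -> intble (fun x => enorm (h x) `^ p) ->
  intble (fun x => enorm (g x) `^ (p - 2) * dotv (g x) (h x)).
Proof.
move=> mg mh ig ih.
apply: (@integrable_le _ _ _ _ _ mOm _ _ _ _ (integrable_lin mOm (1 - p^-1) p^-1 ig ih)).
  by apply: measurable_funM; [exact: measurable_enorm_powR|exact: measurable_dotv].
move=> x _; apply: le_trans (flux_le _ _ p1) _.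
by apply: young_powR; rewrite ?enorm_ge0.
Qed.

(** The energy at [u + t v] is at least the infimum, and the gradient inequality taken at [g + t h]
    towards [g] bounds the growth of the Dirichlet term by [t] times the flux at that point paired
    with [h]. After division by [t], continuity of the flux and a dominating function allow [t] to
    tend to [0]. *)
Lemma euler_lagrange_le u g v h (phi psi : nat -> V -> R) :
  test_approx p Om u g phi -> test_approx p Om v h psi ->
  sobolev_energy u g <= torsion_energy p Om ->
  \int[mu]_(x in Om) v x <= \int[mu]_(x in Om) (enorm (g x) `^ (p - 2) * dotv (g x) (h x)).
Proof.
move=> A B J.
have mg := approx_mg A; have mh := approx_mg B.
have ig := approx_grad_integrable p1 mOm A; have ih := approx_grad_integrable p1 mOm B.
pose t (n : nat) : R := n.+1%:R^-1.
have t0 n : 0 < t n by rewrite invr_gt0 ltr0n.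
have t1 n : t n <= 1 by rewrite invf_le1 ?ltr0n// ler1n.
pose a n x := 1 *: g x + t n *: h x.
pose F n x := enorm (a n x) `^ (p - 2) * dotv (a n x) (h x).
pose D x := 2 `^ p * (enorm (g x) `^ p + enorm (h x) `^ p).
have iD : intble D by apply: integrable_scale => //; exact: integrable_add.
have ma n : mcoord Om (a n) by exact: mcoord_lin.
have mF n : measurable_fun Om (F n).
  by apply: measurable_funM; [exact: measurable_enorm_powR|exact: measurable_dotv].
have FD n x : `|F n x| <= D x.
  have s0 : 0 <= enorm (g x) + enorm (h x) by rewrite addr_ge0 ?enorm_ge0.
  have as_ : enorm (a n x) <= enorm (g x) + enorm (h x).
    apply: le_trans (enormD _ _) _; rewrite !enormZ normr1 mul1r (ger0_norm (ltW (t0 n))) lerD2l.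
    by rewrite ler_piMl ?enorm_ge0.
  apply: le_trans (flux_le _ _ p1) _.
  apply: (@le_trans _ _ ((enorm (g x) + enorm (h x)) `^ (p - 1) * (enorm (g x) + enorm (h x)))).
    apply: ler_pM; rewrite ?powR_ge0 ?enorm_ge0 ?lerDr ?enorm_ge0//.
    by apply: ge0_ler_powR; rewrite ?nnegrE ?enorm_ge0// subr_ge0 ltW.
  rewrite powR_succ//; have := normr_powRD (enorm (g x)) (enorm (h x)) (ltW p0).
  by rewrite !ger0_norm ?enorm_ge0.
have Fc x : Om x -> F n x @[n --> \oo] --> enorm (g x) `^ (p - 2) * dotv (g x) (h x).
  move=> _.
  have ca : a n x @[n --> \oo] --> g x.
    rewrite -[X in _ --> X]addr0 -(scale0r (h x)); apply: cvgD.
      by rewrite scale1r; exact: cvg_cst.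
    by apply: cvgZl; exact: cvg_harmonic.
  pose G (y : V) := enorm y `^ (p - 2) * dotv y (h x).
  have cG0 : continuous G by exact: (@continuous_flux R N p (h x) p1).
  have cG : G @ g x --> G (g x) by exact: cG0.
  exact: (@cvg_comp _ _ _ (fun n => a n x) G _ _ _ ca cG).
have [iF cF] := dominated_Rintegral mOm mF Fc iD (fun n x _ => FD n x).
apply: (cvg_ge_cst cF) => n.
have C := approx_lin p1 mOm 1 (t n) A B.
have iFn : intble (F n) by apply: integrable_le (mF n) _ iD.
have iu := approx_integrable p1 mOm OmM A; have iv := approx_integrable p1 mOm OmM B.
have P x : Om x -> enorm (a n x) `^ p <= 1 * enorm (g x) `^ p + p * t n * F n x.
  move=> _; have := gradient_inequality (a n x) (g x) p1.
  have -> : g x - a n x = (- t n) *: h x by rewrite /a scale1r opprD addrA subrr sub0r scaleNr.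
  rewrite dotvZr mulNr !mulrN lerBlDr mul1r => /le_trans; apply.
  by rewrite lerD2l /F -(mulrA p) ler_pM2l// mulrCA.
have H1 := le_Rintegral_lin mOm ig iFn (approx_grad_integrable p1 mOm C) P.
have J2 := le_trans J (sobolev_energy_ge C).
have I2 : \int[mu]_(x in Om) (1 * u x + t n * v x) =
   1 * \int[mu]_(x in Om) u x + t n * \int[mu]_(x in Om) v x by exact: Rintegral_lin.
rewrite /sobolev_energy I2 in J2.
rewrite -(ler_pM2l (t0 n)).
exact: (el_arith p0 H1 J2).
Qed.

Lemma torsion_solution_exists : exists ug : (V -> R) * (V -> V), torsion_solution Om p ug.1 ug.2.
Proof.
have [u [g [phi [A cJ]]]] := minimizer_exists.
have J : sobolev_energy u g <= torsion_energy p Om.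
  by rewrite (cvg_unique (@Rhausdorff R) (energy_cvg A) cJ).
exists (u, g); split; first exact: (approx_sobolev0 p1 mOm OmM A).
move=> v h /= /(sobolev0_approx mOm)[psi B].
have ig := approx_grad_integrable p1 mOm A; have ih := approx_grad_integrable p1 mOm B.
have iF := flux_integrable (approx_mg A) (approx_mg B) ig ih.
have iv := approx_integrable p1 mOm OmM B.
apply/eqP; rewrite eq_le (euler_lagrange_le A B J) andbT.
(* The reverse inequality is the same one for [- v], which [approx_lin] supplies as
   [-1 * v + 0 * v]. *)
have := euler_lagrange_le A (approx_lin p1 mOm (-1) 0 B B) J.
have -> : \int[mu]_(x in Om) (-1 * v x + 0 * v x) =
  -1 * \int[mu]_(x in Om) v x + 0 * \int[mu]_(x in Om) v x by exact: Rintegral_lin.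
have -> : \int[mu]_(x in Om) (enorm (g x) `^ (p - 2) * dotv (g x) (-1 *: h x + 0 *: h x)) =
   \int[mu]_(x in Om) (-1 * (enorm (g x) `^ (p - 2) * dotv (g x) (h x))).
  apply: eq_Rintegral => x _; rewrite dotvDr !dotvZr.
  by rewrite mul0r addr0 mulrCA.
by rewrite RintegralZl// mul0r addr0 !mulN1r lerN2.
Qed.

(** Testing the equation with [u] itself gives the identity of integrals. For the energy, the
    gradient inequality at [g] towards [grad phi], combined with the equation tested by [phi - u],
    shows that no test function does better. *)
Lemma solution_energy u g : torsion_solution Om p u g ->
  \int[mu]_(x in Om) (enorm (g x) `^ p) = \int[mu]_(x in Om) u x /\
  sobolev_energy u g = torsion_energy p Om.
Proof.
move=> [S EL]; have [psi B] := sobolev0_approx mOm S.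
have ig := approx_grad_integrable p1 mOm B.
have iu := approx_integrable p1 mOm OmM B.
split.
  rewrite -(EL _ _ S); apply: eq_Rintegral => x _; exact/esym/flux_self.
apply/eqP; rewrite eq_le (sobolev_energy_ge B) andbT.
apply: lb_le_inf; first exact: (energy_has_inf i0 p1 OmM).1.
move=> _ [phi t <-].
have A := approx_const p1 mOm OmM t.
have C := approx_lin p1 mOm 1 (-1) A B.
have E := EL _ _ (approx_sobolev0 p1 mOm OmM C).
have iphi := test_integrable mOm t.
have iF := flux_integrable (approx_mg B) (approx_mg C) ig (approx_grad_integrable p1 mOm C).
have I2 : \int[mu]_(x in Om) (1 * phi x + -1 * u x) =
   1 * \int[mu]_(x in Om) phi x + -1 * \int[mu]_(x in Om) u x by exact: Rintegral_lin.
rewrite I2 in E.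
have P x : Om x -> enorm (g x) `^ p <= 1 * enorm (grad phi x) `^ p +
    - p * (enorm (g x) `^ (p - 2) * dotv (g x) (1 *: grad phi x + -1 *: g x)).
  move=> _; have := gradient_inequality (g x) (grad phi x) p1.
  by rewrite scale1r scaleN1r mulNr lerBrDr mul1r.
have H := le_Rintegral_lin mOm (test_grad_integrable p1 mOm t) iF ig P.
rewrite E in H.
have E1 : dirichlet p phi = \int[mu]_(x in Om) (enorm (grad phi x) `^ p).
  apply/esym/Rintegral_outside => x Ox.
  rewrite (grad0 (phi := phi)) ?enorm0 ?powR0 ?gt_eqF// => i.
  exact: test_partial_out t Ox.
have E2 : \int[mu]_(x in Om) phi x = \int[mu]_x phi x.
  by apply: Rintegral_outside => x Ox; exact: (test_out t Ox).
rewrite -E1 E2 in H; rewrite energyE /sobolev_energy.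
exact: (solution_arith p0 H).
Qed.

(** Existence makes [get] return a solution, and [solution_energy] applies to whichever it returns:
    with [E] the rigidity, [E / p - E] is the infimum. *)
Lemma torsional_rigidityE : torsional_rigidity p Om = - (p / (p - 1)) * torsion_energy p Om.
Proof.
have [ug Hug] := torsion_solution_exists.
have /solution_energy[H1 H2] : torsion_solution Om p (torsion_function p Om).1 (torsion_function p Om).2.
  by rewrite /torsion_function; case: xgetP => [y _ /= //|/(_ ug)]; case.
rewrite -H2 /torsional_rigidity /sobolev_energy -H1.
by field; rewrite !gt_eqF// subr_gt0.
Qed.

End torsion_existence.

(** * Polarization *)

Section softabs.
Context {R : realType}.
Implicit Types e t : R.

(** Shifting each cut by [e] creates the interval [[-e, e]] of zeros and raises the distance to
    [|t|] from [e] to [2 * e]. *)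
Definition softabs e t := softcut e (t - e) + softcut e (- t - e).

Lemma softabsN e t : softabs e (- t) = softabs e t.
Proof. by rewrite /softabs opprK addrC. Qed.

Lemma softabs_small e t : `|t| <= e -> softabs e t = 0.
Proof.
by rewrite ler_norml => /andP[h1 h2]; rewrite /softabs !softcut_le0 ?addr0//; lra.
Qed.

Lemma softabs_near e t : 0 < e -> `|t| - 2 * e <= softabs e t <= `|t|.
Proof.
move=> e0; wlog t0 : t / 0 <= t.
  move=> H; have [/H//|/ltW t0] := leP 0 t.
  by rewrite -softabsN -normrN; apply: H; rewrite oppr_ge0.
rewrite (ger0_norm t0) /softabs (@softcut_le0 _ _ (- t - e)); last by lra.
have [te|te] := leP t e.
  by rewrite softcut_le0; [apply/andP; split; lra|lra].
have := @softcut_near _ e (t - e) e0; rewrite subr_ge0 => /(_ (ltW te))/andP[h1 h2].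
by apply/andP; split; lra.
Qed.

Definition dsoftabs e t := dsoftcut e (t - e) - dsoftcut e (- t - e).

Lemma dsoftabsN e t : dsoftabs e (- t) = - dsoftabs e t.
Proof. by rewrite /dsoftabs opprK opprB. Qed.

Lemma dsoftabs_le1 e t : 0 < e -> `|dsoftabs e t| <= 1.
Proof.
move=> e0; rewrite /dsoftabs ler_norml.
have /andP[a b] := dsoftcut_itv (t - e) e0; have /andP[c d] := dsoftcut_itv (- t - e) e0.
by apply/andP; split; lra.
Qed.

Lemma is_derive_softabs e t : 0 < e -> is_derive t 1 (softabs e) (dsoftabs e t).
Proof.
move=> e0.
have D1 : is_derive t (1 : R) (fun t => t - e) (1 - 0).
  exact: is_deriveB (is_derive_id t (1 : R)) (is_derive_const e t (1 : R)).
have D2 : is_derive t (1 : R) (fun t => - t - e) (- 1 - 0).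
  exact: is_deriveB (is_deriveN (is_derive_id t (1 : R))) (is_derive_const e t (1 : R)).
have H1 := @is_derive1_comp R (softcut e) (fun t : R => t - e) t _ _ (is_derive_softcut (t - e) e0) D1.
have H2 := @is_derive1_comp R (softcut e) (fun t : R => - t - e) t _ _ (is_derive_softcut (- t - e) e0) D2.
have := is_derive_add H1 H2.
by move/is_derive_eq; apply; rewrite /dsoftabs; ring.
Qed.

End softabs.

Lemma convex_swap (R : realType) (l A B X Y : R) : Y <= l * B + (1 - l) * A ->
  X <= l * A + (1 - l) * B -> X + Y <= A + B.
Proof. by move=> h1 h2; nra. Qed.

Lemma polar_arith (R : realType) (e a b G : R) : 0 < e -> `|a - b| - 2 * e <= G <= `|a - b| ->
  (Num.max a b - e <= 2^-1 * (a + b) + 1 * (2^-1 * G) <= Num.max a b) /\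
  (Num.min a b <= 2^-1 * (a + b) + - 1 * (2^-1 * G) <= Num.min a b + e).
Proof.
move=> e0; have [ab|ba] := leP a b => /andP[].
  rewrite ler0_norm ?subr_le0// => h1 h2; split; apply/andP; split; lra.
rewrite ger0_norm ?subr_ge0 ?(ltW ba)// => h1 h2.
by split; apply/andP; split; lra.
Qed.

Lemma eps_choice (R : realType) (eta I : R) : 0 < eta -> 0 <= I ->
  exists e, [/\ 0 < e, 3 * e <= eta & 2 * e * I <= eta].
Proof.
move=> eta0 I0; have I1 : 0 < I + 1 by lra.
pose e := eta / (3 * (I + 1)).
have e0 : 0 < e by rewrite divr_gt0// mulr_gt0.
have eE : 3 * e * I + 3 * e = eta by rewrite /e; field; rewrite gt_eqF.
have eI : 0 <= e * I by rewrite mulr_ge0// ltW.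
have eI2 : 2 * e * I = 2 * (e * I) by ring.
have eI3 : 3 * e * I = 3 * (e * I) by ring.
by rewrite eI3 in eE; exists e; split => //; rewrite ?eI2; lra.
Qed.

Lemma closed_fun_ge (R : realType) (T : topologicalType) (f : T -> R) (c : R) :
  continuous f -> closed [set x | c <= f x].
Proof.
by move=> cf; apply: (@closed_comp _ _ f [set t | c <= t]) => [x _|]; [exact: cf|exact: closed_ge].
Qed.

Lemma closed_fun_le (R : realType) (T : topologicalType) (f : T -> R) (c : R) :
  continuous f -> closed [set x | f x <= c].
Proof.
by move=> cf; apply: (@closed_comp _ _ f [set t | t <= c]) => [x _|]; [exact: cf|exact: closed_le].
Qed.

Lemma dist_chain_max (R : realType) (e eta a w m : R) : `|a - w| <= 2 * e ->
  m - e <= w <= m -> 3 * e <= eta -> `|a - m| <= eta.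
Proof.
by rewrite !ler_norml => /andP[? ?] /andP[? ?] ?; apply/andP; split; lra.
Qed.

Lemma dist_chain_min (R : realType) (e eta a w m : R) : `|a - w| <= 2 * e ->
  m <= w <= m + e -> 3 * e <= eta -> `|a - m| <= eta.
Proof.
by rewrite !ler_norml => /andP[? ?] /andP[? ?] ?; apply/andP; split; lra.
Qed.

Section polarization.
Context {R : realType} {N : nat}.
Notation V := 'rV[R]_N.
Notation mu := (@lebesgue_rV R N).
Notation e_ i := (delta_mx ord0 i : V).
Implicit Types (phi psi u v : V -> R).

Lemma Ck_softabs k e (f : V -> R) : 0 < e -> Ck k f -> Ck k (fun x => softabs e (f x)).
Proof.
move=> e0 Hf; apply: CkD; apply: Ck_softcut => //.
  by apply: CkD => //; exact: Ck_const.
apply: CkD; last exact: Ck_const.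
rewrite (_ : (fun x => - f x) = (fun x => -1 * f x)); first exact: CkZ.
by apply/funext => x; rewrite mulN1r.
Qed.

Lemma test_sub_set Om Om' phi : Om `<=` Om' -> test_function Om phi -> test_function Om' phi.
Proof. by move=> sub [s c o]; split=> // x /o/sub. Qed.

Lemma test_flip i h phi : test_function setT phi -> test_function setT (phi \o flip i h).
Proof.
move=> [s c _]; set S := closure _ in c.
apply: (@test_intro R N setT _ (flip i h @` S)) => //.
- by move=> k; apply: Ck_flip; exact: s.
- apply: continuous_compact => //; apply: continuous_subspaceT; exact: continuous_flip.
- move=> x px; exists (flip i h x); last exact: flipK.
  exact: (@subset_closure _ [set x | phi x != 0]).
Qed.

Lemma test_setT phi : smooth phi -> bsupp phi -> test_function setT phi.
Proof.
move=> s [M HM]; apply: (@test_intro R N setT _ [set x : V | forall j, `|x ord0 j| <= M]) => //.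
exact: bounded_closed_cube.
Qed.

Lemma Cc_flip i h (f : V -> R) : Cc f -> Cc (f \o flip i h).
Proof.
move=> [cf [M HM]]; split.
  by move=> x; apply: continuous_comp; [exact: continuous_flip|exact: cf].
exists (`|h| + M) => x fx j; have := HM _ fx j; rewrite flipE; case: eqP => _ H.
  have -> : x ord0 j = h - (h - x ord0 j) by ring.
  by apply: le_trans (ler_normB _ _) _; rewrite lerD2l.
by apply: le_trans H _; rewrite lerDr.
Qed.

(** Reflection preserves the measure, so it suffices to compare the sums over each pair of mirror
    points. *)
Lemma le_Rintegral_flip i h (f g : V -> R) : Cc f -> Cc g ->
  (forall x, f x + f (flip i h x) <= g x + g (flip i h x)) ->
  \int[mu]_x f x <= \int[mu]_x g x.
Proof.
move=> cf cg H.
have cF := @Cc_flip i h _ cf; have cG := @Cc_flip i h _ cg.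
have := le_Rintegral measurableT (Cc_integrable (Cc_add cf cF)) (Cc_integrable (Cc_add cg cG)) (fun x _ => H x).
have E f' : Cc f' -> \int[mu]_x (f' x + (f' \o flip i h) x) = 2 * \int[mu]_x f' x.
  move=> c; have c' := @Cc_flip i h _ c.
  have -> : \int[mu]_x (f' x + (f' \o flip i h) x) = \int[mu]_x f' x + \int[mu]_x f' (flip i h x).
    by apply: RintegralD => //; exact: Cc_integrable.
  by rewrite Rintegral_flip// -mulr2n mulr_natl.
have E1 := E f cf; have E2 := E g cg.
by move=> Hle; rewrite -(ler_pM2l (ltr0n R 2)) -E1 -E2.
Qed.

Section soft_polarization.
Variables (i : 'I_N) (h e : R) (phi : V -> R).
Hypotheses (e0 : 0 < e) (h0 : h != 0) (tphi : test_function setT phi).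
(** [h * (h - 2 * x ord0 i)] equals [|flip x|^2 - |x|^2] (see [enorm_sq_flip]), so [sg] is [1] on
    the open side of the mirror that contains the origin. *)
Let sg (x : V) : R := Num.sg (h * (h - 2 * x ord0 i)).
Let D x := phi x - phi (flip i h x).

(* With [|D x|] in place of [softabs e (D x)] this is the maximum of the two values of [phi]
   where [sg x = 1], and their minimum where [sg x = -1]. [softabs e] vanishes near [0], which
   compensates for the jump of [sg] on the mirror, where [D] vanishes. *)
Definition soft_polar x := 2^-1 * (phi x + phi (flip i h x)) + sg x * (2^-1 * softabs e (D x)).

Let sg_flip x : sg (flip i h x) = - sg x.
Proof.
rewrite /sg flipE eqxx -sgrN; congr Num.sg.
ring.
Qed.

Let D_flip x : D (flip i h x) = - D x.
Proof. by rewrite /D flipK opprB. Qed.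

Let tphiF := test_flip i h tphi.

Let tD : test_function setT D.
Proof. exact: test_sub tphi tphiF. Qed.

Let sphi k : Ck k phi. Proof. by have [/(_ k)] := tphi. Qed.

Let flip_fix (x : V) : h * (h - 2 * x ord0 i) = 0 -> flip i h x = x.
Proof.
move=> s0; have xi : h - 2 * x ord0 i = 0.
  by move/eqP: s0; rewrite mulf_eq0 (negbTE h0) => /eqP.
by apply/rowP => j; rewrite flipE; have [->|//] := eqVneq j i; lra.
Qed.

Let glue x : (\forall y \near x, 2^-1 * softabs e (D y) = 0) \/ (\forall y \near x, sg y = sg x).
Proof.
have cs : continuous (fun y : V => h * (h - 2 * y ord0 i)).
  apply: cont_mul; first exact: cont_cst.
  apply: cont_sub; first exact: cont_cst.
  by apply: cont_mul; [exact: cont_cst|exact: coord_continuous].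
have [s0|s0|s0] := ltgtP (h * (h - 2 * x ord0 i)) 0.
- right; have : \forall y \near x, h * (h - 2 * (y : V) ord0 i) < 0.
    by have /cvgr_lt/(_ _ s0) := cs x.
  by apply: filterS => y y0; rewrite /sg !ltr0_sg.
- right; have : \forall y \near x, 0 < h * (h - 2 * (y : V) ord0 i).
    by have /cvgr_gt/(_ _ s0) := cs x.
  by apply: filterS => y y0; rewrite /sg !gtr0_sg.
- left; have Fx := flip_fix s0.
  have cD : continuous D := (test_Cc tD).1.
  have : \forall y \near x, `|D x - D y| < e.
    by have /cvgrPdist_lt/(_ _ e0) := cD x.
  have -> : D x = 0 by rewrite /D Fx subrr.
  by apply: filterS => y; rewrite sub0r normrN => /ltW/softabs_small ->; rewrite mulr0.
Qed.

Lemma soft_polar_smooth : smooth soft_polar.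
Proof.
move=> k; apply: CkD.
  by apply: CkZ; apply: CkD => //; exact: (@Ck_flip R N k i h phi).
apply: Ck_glue; last exact: glue.
by apply: CkZ; apply: Ck_softabs => //; have [/(_ k)] := tD.
Qed.

Let half_double (t : R) : 2^-1 * (t + t) = t. Proof. by field. Qed.

Lemma soft_polar_max (x : V) : 0 <= h * (h - 2 * x ord0 i) ->
  Num.max (phi x) (phi (flip i h x)) - e <= soft_polar x <= Num.max (phi x) (phi (flip i h x)).
Proof.
rewrite le_eqVlt => /orP[/eqP/esym s0|s0]; rewrite /soft_polar /sg.
  by rewrite s0 sgr0 mul0r addr0 (flip_fix s0) maxxx half_double lexx gerBl ltW.
by rewrite gtr0_sg//; exact: (polar_arith e0 (softabs_near _ e0)).1.
Qed.

Lemma soft_polar_min (x : V) : h * (h - 2 * x ord0 i) <= 0 ->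
  Num.min (phi x) (phi (flip i h x)) <= soft_polar x <= Num.min (phi x) (phi (flip i h x)) + e.
Proof.
rewrite le_eqVlt => /orP[/eqP s0|s0]; rewrite /soft_polar /sg.
  by rewrite s0 sgr0 mul0r addr0 (flip_fix s0) minxx half_double lexx lerDl ltW.
by rewrite ltr0_sg//; exact: (polar_arith e0 (softabs_near _ e0)).2.
Qed.

Lemma soft_polar_ge0 x : (forall y, 0 <= phi y) -> 0 <= soft_polar x.
Proof.
move=> phi0; have [px|mx] := leP 0 (h * (h - 2 * x ord0 i)).
  rewrite /soft_polar addr_ge0 ?mulr_ge0 ?addr_ge0 ?softcut_ge0//.
  by rewrite /sg sgr_ge0.
by have /andP[Hx _] := soft_polar_min (ltW mx); apply: le_trans Hx; rewrite le_min !phi0.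
Qed.

Lemma soft_polar_eq0 x : phi x = 0 -> phi (flip i h x) = 0 -> soft_polar x = 0.
Proof.
move=> Hx HF.
by rewrite /soft_polar /D Hx HF subrr softabs_small ?normr0 ?ltW// !(mulr0, addr0).
Qed.

(** The weight of [grad phi x] in the gradient of [soft_polar], the remainder going to the reflected
    gradient. Mirror points share it, because [sg] and [D] both change sign. *)
Let lam x := 2^-1 * (1 + sg x * dsoftabs e (D x)).

Let lam01 x : 0 <= lam x <= 1.
Proof.
have : `|sg x * dsoftabs e (D x)| <= 1.
  rewrite normrM -[leRHS]mulr1; apply: ler_pM => //; last exact: dsoftabs_le1.
  by rewrite normr_sg; case: (_ != 0).
by rewrite ler_norml => /andP[a b]; rewrite /lam; apply/andP; split; lra.
Qed.

Let lam_flip x : lam (flip i h x) = lam x.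
Proof. by rewrite /lam sg_flip D_flip dsoftabsN mulrNN. Qed.

Let gradF x : V := \row_j ((-1) ^+ (j == i) * partial j phi (flip i h x)).

Let enorm_gradF x : enorm (gradF x) = enorm (grad phi (flip i h x)).
Proof.
rewrite /enorm /dotv; congr Num.sqrt; apply: eq_bigr => j _; rewrite !mxE.
by rewrite mulrACA -expr2 sqrr_sign mul1r.
Qed.

Let soft_polar_grad x : grad soft_polar x = lam x *: grad phi x + (1 - lam x) *: gradF x.
Proof.
apply/rowP => j; rewrite !mxE.
have d1 := test_is_derive j x tphi.
have d2 : is_derive x (e_ j) (phi \o flip i h) ((-1) ^+ (j == i) * partial j phi (flip i h x)).
  by apply: is_derive_flip; exact: test_is_derive tphi.
set a := partial j phi x in d1 *; set b := _ * partial j phi _ in d2 *.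
have c (k : R) := is_derive_const k x (e_ j).
have d3 : is_derive x (e_ j) D (a - b) by exact: is_deriveB d1 d2.
have d4 := is_derive_prod (c 2^-1) (is_derive_comp_line (is_derive_softabs (D x) e0) d3).
have d5 := is_derive_glue d4 (glue x).
have d6 := is_derive_add (is_derive_prod (c 2^-1) (is_derive_add d1 d2)) d5.
have E : 2^-1 * (a + b) + (phi x + (phi \o flip i h) x) * 0 +
       sg x * (2^-1 * (dsoftabs e (D x) * (a - b)) + (softabs e \o D) x * 0) =
   lam x * a + (1 - lam x) * b.
  by rewrite /lam !mulr0 !addr0; move: (sg x) (dsoftabs e (D x)) => s d; field.
have d7 : is_derive x (e_ j) soft_polar (lam x * a + (1 - lam x) * b) := is_derive_eq d6 E.
exact: (is_derive_partial (g := fun=> lam x * a + (1 - lam x) * b) d7).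
Qed.

(** Convexity bounds the two terms on the left with weights [lam], [1 - lam] at [x] and with the
    roles of the two gradients exchanged at the mirror point; the weights add up to [1] for each
    gradient. *)
Lemma soft_polar_grad_le p x : 1 < p ->
  enorm (grad soft_polar x) `^ p + enorm (grad soft_polar (flip i h x)) `^ p <=
  enorm (grad phi x) `^ p + enorm (grad phi (flip i h x)) `^ p.
Proof.
move=> p1; rewrite !soft_polar_grad lam_flip.
have := enorm_powR_convex (grad phi x) (gradF x) p1 (lam01 x).
have := enorm_powR_convex (grad phi (flip i h x)) (gradF (flip i h x)) p1 (lam01 x).
rewrite !enorm_gradF flipK.
exact: convex_swap.
Qed.

Lemma soft_polar_test : test_function setT soft_polar.
Proof.
apply: test_setT; first exact: soft_polar_smooth.
apply: (@bsupp_forall R N bool (fun b => if b then phi else phi \o flip i h)).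
  by case; [exact: test_bsupp tphi|exact: test_bsupp tphiF].
by move=> x H; apply: soft_polar_eq0; [exact: (H true)|exact: (H false)].
Qed.

Lemma soft_polar_dirichlet p : 1 < p -> dirichlet p soft_polar <= dirichlet p phi.
Proof.
move=> p1; apply: (@le_Rintegral_flip i h).
- exact: test_energy_Cc p1 soft_polar_test.
- exact: test_energy_Cc p1 tphi.
- by move=> x; exact: soft_polar_grad_le.
Qed.

(** The terms carrying [softabs] are opposite at mirror points. *)
Lemma soft_polar_int : \int[mu]_x soft_polar x = \int[mu]_x phi x.
Proof.
have E x : soft_polar x + soft_polar (flip i h x) = phi x + phi (flip i h x).
  rewrite /soft_polar sg_flip D_flip softabsN flipK mulNr.
  by move: (sg x * _) => z; field.
have c1 := test_Cc soft_polar_test; have c2 := test_Cc tphi.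
by apply/eqP; rewrite eq_le; apply/andP; split; apply: (@le_Rintegral_flip i h) => // x; rewrite E.
Qed.

Lemma soft_polar_energy p : 1 < p -> energy p soft_polar <= energy p phi.
Proof.
move=> p1; have H := soft_polar_dirichlet p1; rewrite !energyE soft_polar_int lerD2r.
by apply: ler_wpM2l H; rewrite invr_ge0 ltW// (lt_trans ltr01 p1).
Qed.

End soft_polarization.

(** Outside [K] the function [v] is only known to be at most [e]; cutting at that level brings the
    support into [K]. The gradient does not grow, since the derivative of [softcut] lies in
    [[0, 1]], and the integral falls by at most [2 * e] times that of [b], which is [1] wherever
    [v > 0]. *)
Lemma soft_truncation p Om v e M (b : V -> R) (K : set V) :
  1 < p -> 0 < e -> test_function setT v -> compact K -> K `<=` Om ->
  (forall x, e < v x -> K x) -> (forall x, 0 < v x -> forall j, `|x ord0 j| <= M) ->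
  mu.-integrable setT (EFin \o b) -> (forall x, 0 <= b x) ->
  (forall x : V, (forall j, `|x ord0 j| <= M) -> b x = 1) ->
  let psi x := softcut e (v x - e) in
  [/\ test_function Om psi, forall x, 0 <= psi x,
      forall x, 0 <= v x -> `|psi x - v x| <= 2 * e &
      energy p psi <= energy p v + 2 * e * \int[mu]_x b x].
Proof.
move=> p1 e0 tv cK KO vK vM ib b0 b1 psi.
have sv k : Ck k v by have [/(_ k)] := tv.
have near_ x : v x - 2 * e <= psi x.
  have [ev|ve] := leP e (v x); last by apply: le_trans (softcut_ge0 _ _); lra.
  have /andP[+ _] := @softcut_near _ e (v x - e) e0 ltac:(by rewrite subr_ge0).
  by rewrite /psi; lra.
have tpsi : test_function Om psi.
  apply: (test_intro _ cK KO) => [k|x px].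
    by apply: Ck_softcut => //; apply: CkD => //; exact: Ck_const.
  apply: vK; rewrite ltNge; apply/negP => ve; move/eqP: px; apply.
  by rewrite /psi softcut_le0// subr_le0.
split => //.
- by move=> x; exact: softcut_ge0.
- move=> x v0; have n := near_ x; rewrite ler_norml; apply/andP; split; first by lra.
  have [ev|ve] := leP e (v x); last by rewrite /psi softcut_le0; lra.
  have /andP[_ +] := @softcut_near _ e (v x - e) e0 ltac:(by rewrite subr_ge0).
  by rewrite /psi; lra.
have tpsiT : test_function setT psi by exact: test_sub_set tpsi.
have G x : enorm (grad psi x) `^ p <= enorm (grad v x) `^ p.
  have -> : grad psi x = dsoftcut e (v x - e) *: grad v x.
    apply/rowP => j; rewrite !mxE.
    have d1 : is_derive x (e_ j) (fun x => v x - e) (partial j v x - 0).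
      exact: is_deriveB (test_is_derive j x tv) (is_derive_const e x (e_ j)).
    have := @is_derive_comp_line R _ (softcut e) (fun x : V => v x - e) _ _ _ _ (is_derive_softcut (v x - e) e0) d1.
    rewrite subr0 => d2; exact: (is_derive_partial (g := fun=> dsoftcut e (v x - e) * partial j v x) d2).
  have /andP[d0 d1] := dsoftcut_itv (v x - e) e0.
  rewrite enormZ ger0_norm//; apply: ge0_ler_powR; rewrite ?nnegrE ?mulr_ge0 ?enorm_ge0//.
    by apply: ltW; apply: lt_trans p1.
  by rewrite ler_piMl ?enorm_ge0.
have Dle : dirichlet p psi <= dirichlet p v.
  apply: le_Rintegral => //; first exact: Cc_integrable (test_energy_Cc p1 tpsiT).
  exact: Cc_integrable (test_energy_Cc p1 tv).
have Ile : \int[mu]_x v x <= 1 * \int[mu]_x psi x + 2 * e * \int[mu]_x b x.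
  apply: (le_Rintegral_lin measurableT (Cc_integrable (test_Cc tpsiT)) ib (Cc_integrable (test_Cc tv))).
  move=> x _; rewrite mul1r; have [v0|v0] := ltP 0 (v x).
    by rewrite b1 ?mulr1; [rewrite -lerBlDr|exact: vM].
  apply: le_trans v0 _; rewrite addr_ge0 ?softcut_ge0// mulr_ge0//.
  by rewrite mulr_ge0// ltW.
rewrite !energyE; move: Dle Ile; rewrite -(@ler_pM2l _ p^-1) ?invr_gt0 ?(lt_trans ltr01 p1)//.
rewrite mul1r => Dle Ile.
rewrite -addrA; apply: lerD => //.
by rewrite lerNl opprD opprK lerBlDr.
Qed.

(** The last two hypotheses are the support conditions: on the side of the maximum, one of two
    mirror points in [Om'] has to put [x] in [Om]; on the side of the minimum, both are in [Om'].
    The error [eta] pays for smoothing and truncation together. *)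
Lemma polarization_test p Om Om' M i h phi eta : 1 < p -> 0 < eta -> h != 0 ->
  test_function Om' phi -> (forall x, 0 <= phi x) ->
  (forall x, Om' x -> forall j, `|x ord0 j| <= M) ->
  (forall x : V, 0 <= h * (h - 2 * x ord0 i) -> Om' x \/ Om' (flip i h x) -> Om x) ->
  (forall x : V, h * (h - 2 * x ord0 i) <= 0 -> Om' x -> Om' (flip i h x) -> Om x) ->
  exists psi, [/\ test_function Om psi, forall x, 0 <= psi x, energy p psi <= energy p phi + eta,
    (forall x : V, 0 <= h * (h - 2 * x ord0 i) ->
       `|psi x - Num.max (phi x) (phi (flip i h x))| <= eta) &
    (forall x : V, h * (h - 2 * x ord0 i) <= 0 ->
       `|psi x - Num.min (phi x) (phi (flip i h x))| <= eta)].
Proof.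
move=> p1 eta0 h0 tphi phi0 OmM Hmax Hmin.
(* Reflecting a point with coordinates bounded by [M] gives coordinates bounded by [|h| + M]. *)
have [b [ib b0 b1]] := @cube_majorant R N (`|h| + M).
have Ib : 0 <= \int[mu]_x b x by apply: Rintegral_ge0.
have [e [e0 e3 eb]] := eps_choice eta0 Ib.
have tphiT : test_function setT phi by exact: test_sub_set tphi.
have tv := soft_polar_test i e0 h0 tphiT.
set v := soft_polar i h e phi in tv.
have [_ cS SO] := tphi; set S := closure _ in cS SO.
have phiS x : phi x != 0 -> S x by exact: (@subset_closure _ [set x | phi x != 0]).
have posS x : 0 < phi x -> S x by move=> px; apply: phiS; rewrite gt_eqF.
pose FS := flip i h @` S.
have posF x : 0 < phi (flip i h x) -> FS x by move=> /posS Sx; exists (flip i h x) => //; exact: flipK.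
have cF : compact FS.
  by apply: continuous_compact => //; apply: continuous_subspaceT; exact: continuous_flip.
have cs : continuous (fun y : V => h * (h - 2 * y ord0 i)).
  apply: cont_mul; first exact: cont_cst.
  apply: cont_sub; first exact: cont_cst.
  by apply: cont_mul; [exact: cont_cst|exact: coord_continuous].
pose Hp := [set x : V | 0 <= h * (h - 2 * x ord0 i)].
pose Hm := [set x : V | h * (h - 2 * x ord0 i) <= 0].
have clp : closed Hp by exact: closed_fun_ge.
have clm : closed Hm by exact: closed_fun_le.
(* When [v > e], at least one of [phi] and its reflection is positive on the side of the maximum,
   and both are on the side of the minimum, where [v] exceeds the minimum by at most [e]. *)
pose K := ((S `|` FS) `&` Hp) `|` ((S `&` FS) `&` Hm).
have cK : compact K.
  apply: compactU; first by apply: compact_closedI => //; exact: compactU.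
  apply: compact_closedI => //; apply: compact_closedI => //.
  by apply: compact_closed => //; exact: norm_hausdorff.
have KO : K `<=` Om.
  move=> x [[SF px]|[[Sx [y Sy yx]] mx]].
    apply: Hmax => //; case: SF => [/SO|[y /SO Oy <-]]; first by left.
    by right; rewrite flipK.
  apply: Hmin => //; first exact: SO.
  by rewrite -yx flipK; exact: SO.
have vp x : Hp x -> _ := fun H => soft_polar_max phi e0 h0 H.
have vm x : Hm x -> _ := fun H => soft_polar_min phi e0 h0 H.
have vK x : e < v x -> K x.
  move=> evx; have [px|mx] := leP 0 (h * (h - 2 * x ord0 i)).
    left; split => //; have /andP[_ Hx] := vp x px.
    have : 0 < Num.max (phi x) (phi (flip i h x)) by apply: lt_le_trans Hx; apply: lt_trans evx.
    by rewrite lt_max => /orP[/posS|/posF]; [left|right].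
  right; have mx' : Hm x by exact: ltW.
  split => //; have /andP[_ Hx] := vm x mx'.
  have : 0 < Num.min (phi x) (phi (flip i h x)).
    by rewrite -(ltrD2r e) add0r; apply: lt_le_trans Hx.
  by rewrite lt_min => /andP[/posS ? /posF].
have v0 x : 0 <= v x by exact: soft_polar_ge0.
have vM x : 0 < v x -> forall j, `|x ord0 j| <= `|h| + M.
  move=> vx j; have [Ox|Ox] := pselect (Om' x).
    by apply: le_trans (OmM x Ox j) _; rewrite lerDr.
  have [OFx|OFx] := pselect (Om' (flip i h x)); last first.
    by move: vx; rewrite /v soft_polar_eq0 ?ltxx//; exact: (test_out tphi).
  have := OmM _ OFx j; rewrite flipE; case: eqP => _ H.
    have -> : x ord0 j = h - (h - x ord0 j) by ring.
    by apply: le_trans (ler_normB _ _) _; rewrite lerD2l.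
  by apply: le_trans H _; rewrite lerDr.
have [t1 t2 t3 t4] := soft_truncation p1 e0 tv cK KO vK vM ib b0 b1.
exists (fun x => softcut e (v x - e)); split => //.
- apply: le_trans t4 _; apply: lerD => //.
  exact: soft_polar_energy.
- by move=> x px; exact: (dist_chain_max (t3 x (v0 x)) (vp x px) e3).
- by move=> x mx; exact: (dist_chain_min (t3 x (v0 x)) (vm x mx) e3).
Qed.

(** Truncating a nearly minimal function by [soft_truncation] removes its negative values at a cost
    of at most [eta / 2]. *)
Lemma nonneg_minimizing p (Om : set V) M (i0 : 'I_N) eta : 1 < p -> 0 < eta ->
  (forall x, Om x -> forall j : 'I_N, `|x ord0 j| <= M) ->
  exists phi, [/\ test_function Om phi, forall x, 0 <= phi x &
    energy p phi <= torsion_energy p Om + eta].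
Proof.
move=> p1 eta0 OmM.
have [b [ib b0 b1]] := @cube_majorant R N M.
have Ib : 0 <= \int[mu]_x b x by apply: Rintegral_ge0.
have eta2 : 0 < eta / 2 by rewrite divr_gt0.
have [e [e0 e3 eb]] := eps_choice eta2 Ib.
have [phi tphi Hphi] := torsion_energy_adherent i0 p1 OmM eta2.
have tphiT : test_function setT phi by exact: test_sub_set tphi.
have [_ cS SO] := tphi; set S := closure _ in cS SO.
have phiS x : phi x != 0 -> S x by exact: (@subset_closure _ [set x | phi x != 0]).
have posS x : 0 < phi x -> S x by move=> px; apply: phiS; rewrite gt_eqF.
have [t1 t2 _ t4] := @soft_truncation p Om phi e M b S p1 e0 tphiT cS SO
  (fun x ex => posS x (lt_trans e0 ex)) (fun x px => OmM x (SO x (posS x px))) ib b0 b1.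
exists (fun x => softcut e (phi x - e)); split => //.
apply: le_trans t4 _; rewrite [X in _ <= _ + X]splitr addrA.
by apply: lerD => //; exact: ltW.
Qed.

End polarization.

(** * The one-dimensional profile of the radial torsion function *)

Section signed_power_regularization.
Context {R : realType}.
Variable be : R.
Hypothesis be0 : 0 < be.

(* At [d = 0] this is [sgn k * |k| `^ be]; it is smooth in [k] for [d > 0]. *)
Definition rpow (d k : R) : R := k * (k ^+ 2 + d) `^ ((be - 1) / 2).

Lemma rpow_bound d k : 0 <= d -> `|rpow d k| <= (k ^+ 2 + d) `^ (be / 2).
Proof.
move=> d0; have kd0 : 0 <= k ^+ 2 + d by rewrite addr_ge0 ?sqr_ge0.
rewrite /rpow normrM (ger0_norm (powR_ge0 _ _)).
move: kd0; rewrite le_eqVlt => /orP[/eqP/esym kd|kd].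
  have k0 : k = 0.
    by move/eqP: kd; rewrite paddr_eq0 ?sqr_ge0// sqrf_eq0 => /andP[/eqP].
  by rewrite k0 normr0 mul0r powR_ge0.
have -> : (k ^+ 2 + d) `^ (be / 2) = (k ^+ 2 + d) `^ (1 / 2) * (k ^+ 2 + d) `^ ((be - 1) / 2).
  rewrite -powRD; last by rewrite (gt_eqF kd) implybT.
  by congr (_ `^ _); field.
apply: ler_wpM2r; first exact: powR_ge0.
have -> : `|k| = (k ^+ 2) `^ (1 / 2).
  rewrite -[k ^+ 2](real_normK (num_real _)) -powR_mulrn// -powRrM.
  by have -> : 2%:R * (1 / 2) = 1 :> R by [field]; rewrite powRr1.
by apply: ge0_ler_powR; rewrite ?nnegrE ?sqr_ge0 ?lerDl// ltW.
Qed.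

Lemma rpow_gt0 d k : 0 <= d -> 0 < k -> 0 < rpow d k.
Proof.
move=> d0 k0; rewrite /rpow mulr_gt0// powR_gt0// ltr_pwDl// exprn_gt0//.
Qed.

Lemma rpowN d k : rpow d (- k) = - rpow d k.
Proof. by rewrite /rpow sqrrN mulNr. Qed.

Lemma rpow_lt0 d k : 0 <= d -> k < 0 -> rpow d k < 0.
Proof. by move=> d0 k0; rewrite -oppr_gt0 -rpowN rpow_gt0// oppr_gt0. Qed.

(** The exponent [(be - 1) / 2] may be negative, so a limit with [k ^+ 2 + d = 0] is out of reach of
    continuity of the power; there [rpow_bound] dominates by the positive power [be / 2]. *)
Lemma rpow_cvg (T : Type) (F : set_system T) {FF : Filter F} (d_ k_ : T -> R) (d k : R) :
  (forall x, 0 <= d_ x) -> 0 <= d -> d_ @ F --> d -> k_ @ F --> k ->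
  (fun x => rpow (d_ x) (k_ x)) @ F --> rpow d k.
Proof.
move=> d_0 d0 cd ck.
have ckd : (fun x => k_ x ^+ 2 + d_ x) @ F --> k ^+ 2 + d.
  by apply: cvgD => //; rewrite expr2; apply: cvgM.
have : 0 <= k ^+ 2 + d by rewrite addr_ge0 ?sqr_ge0.
rewrite le_eqVlt => /orP[/eqP/esym kd|kd]; last first.
  have cp : {for k ^+ 2 + d, continuous (fun u : R => u `^ ((be - 1) / 2))} by exact: continuous_powR_pos.
  by apply: cvgM => //; exact: (@cvg_comp _ _ _ (fun x => k_ x ^+ 2 + d_ x) (fun u : R => u `^ ((be - 1) / 2)) _ _ _ ckd cp).
have k0 : k = 0.
  by move/eqP: kd; rewrite paddr_eq0 ?sqr_ge0// sqrf_eq0 => /andP[/eqP].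
have -> : rpow d k = 0 by rewrite /rpow k0 mul0r.
have b0 : 0 < be / 2 by rewrite divr_gt0.
have c0 : (fun x => `|k_ x ^+ 2 + d_ x| `^ (be / 2)) @ F --> (0 : R).
  rewrite kd in ckd.
  have -> : (0 : R) = `|(0 : R)| `^ (be / 2) by rewrite normr0 powR0// gt_eqF.
  exact: (@cvg_comp _ _ _ (fun x => k_ x ^+ 2 + d_ x) (fun u : R => `|u| `^ (be / 2)) _ _ _ ckd (@continuous_normr_powR R _ b0 0)).
apply/cvgr0Pnorm_lt => e e0.
have /cvgr0Pnorm_lt/(_ _ e0) := c0; apply: filterS => x; apply: le_lt_trans.
rewrite [leRHS]ger0_norm ?powR_ge0//.
by rewrite (ger0_norm (addr_ge0 (sqr_ge0 _) (d_0 x))); exact: rpow_bound.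
Qed.

End signed_power_regularization.

Section softmax.
Context {R : realType}.

Lemma softcut0E (u : R) : softcut 0 u = Num.max 0 u.
Proof.
have [u0|u0] := leP u 0; first by rewrite softcut_le0.
by rewrite /softcut /flat u0 expr0 invr1 mul1r mul0r oppr0 expR0 mulr1.
Qed.

Lemma softcut_itv (k u : R) : 0 <= k -> Num.max 0 u - k <= softcut k u <= Num.max 0 u.
Proof.
rewrite le_eqVlt => /predU1P[<-|k0]; first by rewrite softcut0E subr0 lexx.
have [u0|/ltW u0] := leP u 0; last exact: softcut_near.
by rewrite softcut_le0// lexx andbT subr_le0 ltW.
Qed.

Lemma continuous_softcut (k : R) : 0 <= k -> continuous (softcut k).
Proof.
rewrite le_eqVlt => /predU1P[<-|k0].
  rewrite (_ : softcut 0 = (fun u => Num.max 0 u)); last by apply/funext => u; rewrite softcut0E.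
  by move=> x; apply: continuous_max; [exact: cst_continuous|exact: cvg_id].
exact: continuous_is_derive (fun u => is_derive_softcut u k0).
Qed.

End softmax.

Lemma Rintegral_dist_cvg0 d (T : measurableType d) (R : realType)
    (mu : {measure set T -> \bar R}) (D : set T) (f_ : nat -> T -> R) (f : T -> R) (C : R) :
  measurable D -> (forall n, mu.-integrable D (EFin \o f_ n)) -> mu.-integrable D (EFin \o f) ->
  mu.-integrable D (EFin \o (fun=> C + C)) ->
  (forall n x, D x -> `|f_ n x| <= C) -> (forall x, D x -> `|f x| <= C) ->
  (forall x, D x -> f_ n x @[n --> \oo] --> f x) ->
  (\int[mu]_(x in D) `|f_ n x - f x|)%R @[n --> \oo] --> (0 : R).
Proof.
move=> mD ir i0 iC Hn HB Cc.
have [] := @dominated_Rintegral _ _ _ mu _ mD (fun n x => `|f_ n x - f x|) (fun=> 0) _ _ _ iC.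
- move=> n; apply: (integrable_measurable (mu := mu)).
  by apply: integrable_norm => //; exact: integrable_sub.
- move=> x Dx; have -> : (0 : R) = `|f x - f x| by rewrite subrr normr0.
  have cc : (f_ n x - f x) @[n --> \oo] --> f x - f x by apply: cvgB (Cc x Dx) (cvg_cst _).
  exact: (cvg_norm cc).
- by move=> n x Dx; rewrite normr_id; apply: le_trans (ler_normB _ _) _; apply: lerD; auto.
by move=> _; rewrite Rintegral_cst// mul0r.
Qed.

Lemma le_Rintegral_dist d (T : measurableType d) (R : realType)
    (mu : {measure set T -> \bar R}) (D : set T) (f g : T -> R) : measurable D ->
  mu.-integrable D (EFin \o f) -> mu.-integrable D (EFin \o g) ->
  `|\int[mu]_(x in D) f x - \int[mu]_(x in D) g x| <= \int[mu]_(x in D) `|f x - g x|.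
Proof.
move=> mD fi gi; rewrite -RintegralB//.
exact: (le_normr_Rintegral mD (integrable_sub mD fi gi)).
Qed.

Lemma ge0_Rintegral_subset d (T : measurableType d) (R : realType)
    (mu : {measure set T -> \bar R}) (D E : set T) (f : T -> R) : measurable D -> measurable E ->
  mu.-integrable E (EFin \o f) -> D `<=` E -> (forall x, E x -> 0 <= f x) ->
  \int[mu]_(x in D) f x <= \int[mu]_(x in E) f x.
Proof.
move=> mD mE fi DE f0.
have fD : mu.-integrable D (EFin \o f) by exact: integrableS fi.
rewrite -lee_fin -(integral_EFin mD fD) -(integral_EFin mE fi).
by apply: ge0_subset_integral => //; case/integrableP: fi.
Qed.

Lemma le_Rintegral_dist_subset d (T : measurableType d) (R : realType)
    (mu : {measure set T -> \bar R}) (D E : set T) (f g : T -> R) : measurable D -> measurable E ->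
  mu.-integrable E (EFin \o f) -> mu.-integrable E (EFin \o g) -> D `<=` E ->
  `|\int[mu]_(x in D) f x - \int[mu]_(x in D) g x| <= \int[mu]_(x in E) `|f x - g x|.
Proof.
move=> mD mE fi gi DE.
have fD : mu.-integrable D (EFin \o f) by exact: integrableS fi.
have gD : mu.-integrable D (EFin \o g) by exact: integrableS gi.
apply: le_trans (le_Rintegral_dist mD fD gD) _.
by apply: ge0_Rintegral_subset => //; exact: integrable_norm (integrable_sub mE fi gi).
Qed.

Lemma dist_sub_le (R : realType) (a b a' b' e : R) : `|a - b| <= e -> `|a' - b'| <= e ->
  `|(a - a') - (b - b')| <= 2 * e.
Proof. by rewrite !ler_norml => /andP[? ?] /andP[? ?]; apply/andP; split; lra. Qed.

Lemma min_max0 (R : realType) (a b : R) : a < 0 -> 0 < b -> Num.min a b <= 0 <= Num.max a b.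
Proof. by move=> a0 b0; rewrite ge_min le_max (ltW a0) (ltW b0) orbT. Qed.

Lemma derive_pos_lt (R : realType) (f df : R -> R) (m x y : R) :
  (forall t, m < t -> is_derive t 1 f (df t)) -> m < x -> x < y ->
  (forall t, x < t < y -> 0 < df t) -> f x < f y.
Proof.
move=> fd mx xy H.
have [||c cxy E] := @MVT R f df x y xy.
- by move=> t; rewrite in_itv/= => /andP[xt _]; apply: fd; exact: lt_trans xt.
- apply: derivable_within_continuous => t; rewrite in_itv/= => /andP[xt _].
  by have [] := fd t (lt_le_trans mx xt).
by rewrite -subr_gt0 E mulr_gt0 ?subr_gt0// H.
Qed.

Lemma derive_neg_lt (R : realType) (f df : R -> R) (m x y : R) :
  (forall t, m < t -> is_derive t 1 f (df t)) -> m < x -> x < y ->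
  (forall t, x < t < y -> df t < 0) -> f y < f x.
Proof.
move=> fd mx xy H.
rewrite -ltrN2; apply: (@derive_pos_lt R (fun x => - f x) (fun x => - df x) m) => //.
- by move=> t mt; exact: is_deriveN (fd t mt).
- by move=> t xty; rewrite oppr_gt0 H.
Qed.

Lemma is_derive_integral (R : realType) (f : R -> R) (a K t : R) : continuous f -> a < t ->
  is_derive t 1 (fun t => \int[lebesgue_measure]_(x in `[a, t]) f x - K) (f t).
Proof.
move=> cf at_.
have fi : lebesgue_measure.-integrable `[a, t + 1] (EFin \o f).
  apply: continuous_compact_integrable; first exact: segment_compact.
  exact: continuous_subspaceT.
have [||D E] := @continuous_FTC1_closed R f a t (t + 1) _ fi at_; [by rewrite ltrDl|exact: cf|].
have D1 : is_derive t 1 (fun t => \int[lebesgue_measure]_(x in `[a, t]) f x) (f t).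
  by apply: (DeriveDef D); rewrite -derive1E.
exact: (is_derive_eq (is_deriveB D1 (is_derive_const K t (1 : R))) (subr0 _)).
Qed.

Section radial_profile.
Context {R : realType}.
Variables (lo hi nu be c : R).
Hypotheses (lo0 : 0 < lo) (lohi : lo < hi) (nu0 : 0 < nu) (be0 : 0 < be) (c0 : 0 < c).
Let hi0 : 0 < hi. Proof. exact: lt_trans lohi. Qed.

(* With [c = N] and [nu = N / 2], the field [kap s (|x|^2) x] has divergence [-1], and it
   vanishes on the sphere [|x|^2 = s]. *)
Definition kap (s t : R) : R := c^-1 * (s `^ nu * t `^ (- nu) - 1).

Lemma kap_sign s t : 0 < s -> 0 < t -> [/\ t < s -> 0 < kap s t, s < t -> kap s t < 0 & kap s s = 0].
Proof.
move=> s0 t0.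
have E : s `^ nu * t `^ (- nu) = (s / t) `^ nu.
  by rewrite powRM ?invr_ge0 ?ltW// -powR_inv1 ?ltW// -powRrM mulN1r.
have P1 : 1 `^ nu = 1 by rewrite powR1.
split.
- move=> ts; rewrite /kap mulr_gt0 ?invr_gt0// subr_gt0 E -[ltLHS]P1.
  by rewrite gt0_ltr_powR// ?nnegrE ?divr_ge0 ?ltW// ltr_pdivlMr// mul1r.
- move=> st; rewrite /kap pmulr_rlt0 ?invr_gt0// subr_lt0 E -[ltRHS]P1.
  by rewrite gt0_ltr_powR// ?nnegrE ?divr_ge0 ?ltW// ltr_pdivrMr// mul1r.
- rewrite /kap -powRD ?addrN ?powRr0 ?subrr ?mulr0//.
  by rewrite (gt_eqF s0) implybT.
Qed.

(* Keeps the argument of the singular powers below away from [0]; it is [t] for [d = 0] and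
   [lo / 2 <= t]. *)
Definition clampr (d t : R) : R := lo / 2 + softcut d (t - lo / 2).

Lemma clampr_ge d t : lo / 2 <= clampr d t.
Proof. by rewrite lerDl softcut_ge0. Qed.

Lemma clampr_gt0 d t : 0 < clampr d t.
Proof. by apply: lt_le_trans (clampr_ge d t); rewrite divr_gt0. Qed.

Lemma clampr_itv d t : 0 <= d -> Num.max (lo / 2) t - d <= clampr d t <= Num.max (lo / 2) t.
Proof.
move=> d0; have := softcut_itv (t - lo / 2) d0.
have -> : Num.max 0 (t - lo / 2) = Num.max (lo / 2) t - lo / 2.
  by have [?|?] := leP (lo / 2) t; have [?|?] := leP 0 (t - lo / 2); lra.
by rewrite /clampr; set m := Num.max _ _ => /andP[h1 h2]; apply/andP; split; lra.
Qed.

(* For [d = 0] and [be = 1 / (p - 1)] this is [W'] for the torsion function [W (|x|^2)]: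
   its gradient [g] satisfies [|g|^(p-2) g = kap s (|x|^2) x]. Positive [d] regularizes. *)
Definition rslope (s d t : R) : R :=
  2^-1 * (clampr d t `^ ((be - 1) / 2) * rpow be d (kap s (clampr d t))).

Lemma rslope_gt0 s d t : 0 <= d -> 0 < s -> Num.max (lo / 2) t < s -> 0 < rslope s d t.
Proof.
move=> d0 s0 ts; rewrite /rslope pmulr_rgt0// pmulr_rgt0 ?powR_gt0 ?clampr_gt0//.
apply: rpow_gt0 => //; have [H _ _] := kap_sign s0 (clampr_gt0 d t); apply: H.
by have /andP[_ h] := clampr_itv t d0; exact: le_lt_trans ts.
Qed.

(** The margin [d] is there because [clampr d t] may lie below [Num.max (lo / 2) t] by as much as
    [d]; it never lies above, so [rslope_gt0] has no margin. *)
Lemma rslope_lt0 s d t : 0 <= d -> 0 < s -> s + d < Num.max (lo / 2) t -> rslope s d t < 0.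
Proof.
move=> d0 s0 ts; rewrite /rslope pmulr_rlt0// pmulr_rlt0 ?powR_gt0 ?clampr_gt0//.
apply: rpow_lt0 => //; have [_ H _] := kap_sign s0 (clampr_gt0 d t); apply: H.
by have /andP[h _] := clampr_itv t d0; apply: lt_le_trans h; rewrite ltrBrDr.
Qed.

Lemma rslope_cvg (T : Type) (F : set_system T) {FF : Filter F} (s_ d_ t_ : T -> R) (s d t : R) :
  (forall x, 0 <= d_ x) -> 0 <= d -> 0 < s -> s_ @ F --> s -> d_ @ F --> d ->
  (fun x => clampr (d_ x) (t_ x)) @ F --> clampr d t ->
  (fun x => rslope (s_ x) (d_ x) (t_ x)) @ F --> rslope s d t.
Proof.
move=> d_0 d0 s0 cs cd ct.
have cpow (a : R) (f : T -> R) (l : R) : 0 < l -> f @ F --> l -> (fun x => f x `^ a) @ F --> l `^ a.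
  move=> l0 fl; have cp : {for l, continuous (fun u : R => u `^ a)} by exact: continuous_powR_pos.
  exact: (@cvg_comp _ _ _ f (fun u : R => u `^ a) _ _ _ fl cp).
have tau0 := clampr_gt0 d t.
apply: cvgMr; apply: cvgM; first exact: cpow.
apply: rpow_cvg => //.
apply: cvgMr; apply: cvgB; last exact: cvg_cst.
by apply: cvgM; exact: cpow.
Qed.

Lemma rslope_bounded : exists C : R, forall s d t, lo <= s <= hi -> 0 <= d <= 1 -> t <= hi ->
  `|rslope s d t| <= C.
Proof.
pose K := c^-1 * (hi `^ nu * (lo / 2) `^ (- nu) + 1).
exists (2^-1 * (((lo / 2) `^ ((be - 1) / 2) + hi `^ ((be - 1) / 2)) * (K ^+ 2 + 1) `^ (be / 2))).
move=> s d t /andP[ls sh] /andP[d0 d1] th.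
have s0 : 0 < s by exact: lt_le_trans ls.
have l2 : 0 < lo / 2 by rewrite divr_gt0.
have T0 := clampr_gt0 d t; have T1 := clampr_ge d t.
have T2 : clampr d t <= hi.
  have /andP[_ h] := clampr_itv t d0; apply: le_trans h _; rewrite ge_max th andbT; lra.
rewrite /rslope normrM ger0_norm// normrM (ger0_norm (powR_ge0 _ _)) ler_pM2l//.
(* The sign of the exponent depends on [be]; the sum of the values at both ends bounds the power in
   either case. *)
have pow_le (a : R) : clampr d t `^ a <= (lo / 2) `^ a + hi `^ a.
  have [a0|a0] := leP 0 a.
    by rewrite (le_trans (_ : _ <= hi `^ a)) ?lerDr ?powR_ge0// ge0_ler_powR// nnegrE ltW.
  rewrite (le_trans (_ : _ <= (lo / 2) `^ a)) ?lerDl ?powR_ge0//.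
  rewrite -[a]opprK !(powRN _ (- a)) lef_pV2 ?posrE ?powR_gt0//.
  by rewrite ge0_ler_powR ?nnegrE ?oppr_ge0 ?(ltW a0) ?(ltW l2) ?(ltW T0).
apply: ler_pM; rewrite ?powR_ge0//.
apply: le_trans (rpow_bound _ _ d0) _.
apply: ge0_ler_powR; rewrite ?nnegrE ?addr_ge0 ?sqr_ge0 ?divr_ge0 ?(ltW be0)//.
apply: lerD => //; rewrite -(real_normK (num_real (kap s _))).
have K0 : 0 <= K by rewrite mulr_ge0 ?invr_ge0 ?addr_ge0 ?mulr_ge0 ?powR_ge0// ltW.
rewrite ler_pXn2r ?nnegrE//.
rewrite /kap /K normrM ger0_norm ?invr_ge0 ?(ltW c0)// ler_pM2l ?invr_gt0//.
apply: le_trans (ler_normB _ _) _; rewrite normr1 lerD2r normrM !ger0_norm ?powR_ge0//.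
apply: ler_pM; rewrite ?powR_ge0//; first by rewrite ge0_ler_powR// ?nnegrE ltW.
rewrite !powRN lef_pV2 ?posrE ?powR_gt0//.
by rewrite ge0_ler_powR ?nnegrE ?(ltW nu0) ?(ltW l2) ?(ltW T0).
Qed.

Notation mu := (@lebesgue_measure R).

Lemma continuous_rslope s d : 0 < s -> 0 <= d -> continuous (rslope s d).
Proof.
move=> s0 d0 t; apply: rslope_cvg => //; [exact: cvg_cst|exact: cvg_cst|].
apply: cvgD; first exact: cvg_cst.
have cs : {for t - lo / 2, continuous (softcut d)} by exact: continuous_softcut.
apply: (@cvg_comp _ _ _ (fun t : R => t - lo / 2) (softcut d) _ _ _ _ cs).
by apply: cvgB; [exact: cvg_id|exact: cvg_cst].
Qed.

Lemma rslope_integrable s d (y : R) : 0 < s -> 0 <= d ->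
  mu.-integrable `[-1, y] (EFin \o rslope s d).
Proof.
move=> s0 d0; apply: continuous_compact_integrable; first exact: segment_compact.
by apply: continuous_subspaceT; exact: continuous_rslope.
Qed.

(** The lower limit [-1] leaves room below [0], so that the profile is differentiable at every value
    of [|x|^2]. The subtracted constant enforces the boundary condition on the inner sphere; the one
    on the outer sphere determines [s]. *)
Definition prof (s d t : R) : R :=
  \int[mu]_(x in `[-1, t]) rslope s d x - \int[mu]_(x in `[-1, lo]) rslope s d x.

Lemma prof_lo s d : prof s d lo = 0. Proof. exact: subrr. Qed.

Lemma is_derive_prof (s d t : R) : 0 < s -> 0 <= d -> -1 < t -> is_derive t 1 (prof s d) (rslope s d t).
Proof.
move=> s0 d0 t1.
exact: is_derive_integral (continuous_rslope s0 d0) t1.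
Qed.

Lemma prof_incr (s d x y : R) : 0 < s -> 0 <= d -> -1 < x -> x < y -> lo / 2 < s -> y <= s ->
  prof s d x < prof s d y.
Proof.
move=> s0 d0 x1 xy ls ys.
apply: (derive_pos_lt (fun t => @is_derive_prof s d t s0 d0) x1 xy) => t /andP[xt ty].
by apply: rslope_gt0 => //; rewrite gt_max ls (lt_le_trans ty ys).
Qed.

Lemma prof_decr (s d x y : R) : 0 < s -> 0 <= d -> -1 < x -> x < y -> s + d <= x ->
  prof s d y < prof s d x.
Proof.
move=> s0 d0 x1 xy sx.
apply: (derive_neg_lt (fun t => @is_derive_prof s d t s0 d0) x1 xy) => t /andP[xt ty].
by apply: rslope_lt0 => //; rewrite lt_max (le_lt_trans sx xt) orbT.
Qed.

Lemma rslope_int_cvg (s_ d_ : nat -> R) (s d y : R) : y <= hi ->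
  (forall n, lo <= s_ n <= hi) -> (forall n, 0 <= d_ n <= 1) -> lo <= s <= hi -> 0 <= d <= 1 ->
  s_ n @[n --> \oo] --> s -> d_ n @[n --> \oo] --> d ->
  (forall t, clampr (d_ n) t @[n --> \oo] --> clampr d t) ->
  (\int[mu]_(x in `[-1, y]) `|rslope (s_ n) (d_ n) x - rslope s d x|)%R @[n --> \oo] --> (0 : R).
Proof.
move=> yhi sn dn sI dI cs cd cT; have d0 : 0 <= d by case/andP: dI.
have [C HC] := rslope_bounded.
have s0 : 0 < s by apply: lt_le_trans lo0 _; case/andP: sI.
have sn0 n : 0 < s_ n by apply: lt_le_trans lo0 _; case/andP: (sn n).
have dn0 n : 0 <= d_ n by case/andP: (dn n).
have mD : measurable (`[-1, y] : set R) by exact: measurable_itv.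
have ir n := rslope_integrable y (sn0 n) (dn0 n); have i0 := rslope_integrable y s0 d0.
have Cc x : rslope (s_ n) (d_ n) x @[n --> \oo] --> rslope s d x by exact: rslope_cvg.
have iC : mu.-integrable `[-1, y] (EFin \o (fun=> C + C)).
  apply: continuous_compact_integrable; first exact: segment_compact.
  by apply: continuous_subspaceT => x; exact: cst_continuous.
have HB x : `[-1, y]%classic x -> `|rslope s d x| <= C.
  by move=> /=; rewrite in_itv/= => /andP[_ xy]; apply: HC => //; exact: le_trans yhi.
have Hn n x : `[-1, y]%classic x -> `|rslope (s_ n) (d_ n) x| <= C.
  by move=> /=; rewrite in_itv/= => /andP[_ xy]; apply: HC => //; exact: le_trans yhi.
exact: (@Rintegral_dist_cvg0 _ _ R mu _ (fun n => rslope (s_ n) (d_ n)) (rslope s d) C mD ir i0 iC Hn HB (fun x _ => Cc x)).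
Qed.

Lemma clampr_cvg0 (d_ : nat -> R) (t : R) : (forall n, 0 <= d_ n) ->
  d_ n @[n --> \oo] --> (0 : R) -> clampr (d_ n) t @[n --> \oo] --> clampr 0 t.
Proof.
move=> d0 cd; apply/cvgrPdist_le => e e0.
have /cvgr0Pnorm_le/(_ _ e0) := cd; apply: filterS => n.
rewrite ger0_norm// => dn.
have /andP[h1 h2] := clampr_itv t (d0 n); have /andP[h3 h4] := clampr_itv t (lexx 0).
move: h1 h2 h3 h4; set m := Num.max _ _; set a := clampr _ _; set b := clampr _ _ => *.
by rewrite ler_norml; apply/andP; split; lra.
Qed.

(** Shooting in [s]: on [[lo, hi]] the profile decreases for [s = lo] and increases for [s = hi], so
    some value in between makes it vanish at both ends. *)
Lemma prof_root : exists2 s, lo < s < hi & prof s 0 hi = 0.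
Proof.
(* Clamping [s] to [[lo, hi]] keeps the integrand within [rslope_bounded] and gives a function
   continuous on the whole line. *)
pose cl (s : R) := Num.min hi (Num.max lo s).
have clI s : lo <= cl s <= hi by rewrite /cl le_min ge_min le_max !lexx (ltW lohi).
have cl0 s : 0 < cl s by apply: lt_le_trans lo0 _; case/andP: (clI s).
have ccl : continuous cl.
  move=> s; apply: continuous_min; first exact: cst_continuous.
  by apply: continuous_max; [exact: cst_continuous|exact: cvg_id].
pose H y s := \int[mu]_(x in `[-1, y]) rslope (cl s) 0 x.
have cH (y : R) : y <= hi -> continuous (H y).
  move=> yhi s; apply/(@cvg_nbhsP _ R^o) => u us.
  have cs : cl (u n) @[n --> \oo] --> cl s.
    exact: (@cvg_comp _ _ _ u cl _ _ _ us (ccl s)).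
  have I01 : 0 <= (0 : R) <= 1 by rewrite lexx ler01.
  have D : (\int[mu]_(x in `[-1, y]) `|rslope (cl (u n)) 0 x - rslope (cl s) 0 x|)%R @[n --> \oo] --> (0 : R).
    exact: (rslope_int_cvg yhi (fun n => clI (u n)) (fun _ => I01) (clI s) I01 cs (cvg_cst _) (fun t => cvg_cst _)).
  apply/cvgrPdist_le => e e0; have /cvgr0Pnorm_le/(_ _ e0) := D; apply: filterS => n.
  apply: le_trans; rewrite distrC [leRHS]ger0_norm; last exact: Rintegral_ge0.
  have mD : measurable (`[-1, y] : set R) by exact: measurable_itv.
  exact: (@le_Rintegral_dist _ _ R mu _ (rslope (cl (u n)) 0) (rslope (cl s) 0) mD
    (rslope_integrable y (cl0 _) (lexx 0)) (rslope_integrable y (cl0 _) (lexx 0))).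
have m1lo : -1 < lo by rewrite (lt_trans _ lo0)// ltrN10.
have P1 : prof lo 0 hi < 0.
  have := @prof_decr lo 0 lo hi lo0 (lexx 0) m1lo lohi; rewrite prof_lo; apply.
  by rewrite addr0.
have P2 : 0 < prof hi 0 hi.
  have := @prof_incr hi 0 lo hi hi0 (lexx 0) m1lo lohi; rewrite prof_lo; apply => //.
  by have := lo0; have := lohi; lra.
have E1 : cl lo = lo by rewrite /cl maxxx min_r// ltW.
have E2 : cl hi = hi by rewrite /cl max_r ?minxx// ltW.
have [||s sI Es] := @IVT R (fun s => H hi s - H lo s) lo hi 0 (ltW lohi).
- apply: continuous_subspaceT => s; apply: cvgB; [exact: cH|exact: cH (ltW lohi) _].
- by apply: min_max0; rewrite /H ?E1 ?E2; [exact: P1|exact: P2].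
move: sI; rewrite in_itv/= => sI.
have Ecl : cl s = s by case/andP: sI => s1 s2; rewrite /cl (max_r s1) min_r.
rewrite /H Ecl in Es; have {}Es : prof s 0 hi = 0 := Es; exists s => //.
have ns1 : lo != s by apply/eqP => sl; move: Es P1; rewrite -sl => ->; rewrite ltxx.
have ns2 : s != hi by apply/eqP => sl; move: Es P2; rewrite sl => ->; rewrite ltxx.
by case/andP: sI => s1 s2; rewrite !lt_neqAle ns1 s1 ns2 s2.
Qed.

(** The profile increases up to [s], decreases after it, and vanishes at [lo] and [hi]. *)
Lemma prof_bounds s : lo < s < hi -> prof s 0 hi = 0 ->
  [/\ forall t, -1 < t <= lo -> prof s 0 t <= 0, forall t, hi <= t -> prof s 0 t <= 0,
      forall t, lo < t < hi -> 0 < prof s 0 t &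
      forall t, -1 < t -> t != s -> prof s 0 t < prof s 0 s].
Proof.
move=> /andP[ls sh] Ph; have s0 : 0 < s by exact: lt_trans ls.
have m1lo : -1 < lo by rewrite (lt_trans _ lo0)// ltrN10.
have m1s : -1 < s by exact: lt_trans ls.
have l2s : lo / 2 < s by have := lo0; lra.
have incr x y : -1 < x -> x < y -> y <= s -> prof s 0 x < prof s 0 y.
  by move=> x1 xy ys; exact: prof_incr.
have decr x y : s <= x -> x < y -> prof s 0 y < prof s 0 x.
  by move=> sx xy; apply: prof_decr; rewrite ?addr0// (lt_le_trans m1s).
split.
- move=> t /andP[t1]; rewrite le_eqVlt => /predU1P[->|tl]; first by rewrite prof_lo.
  by have := incr _ _ t1 tl (ltW ls); rewrite prof_lo => /ltW.
- move=> t; rewrite le_eqVlt => /predU1P[<-|tl]; first by rewrite Ph.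
  by have := decr _ _ (ltW sh) tl; rewrite Ph => /ltW.
- move=> t /andP[lt th]; have [ts|st] := leP t s.
    by have := incr _ _ m1lo lt ts; rewrite prof_lo.
  by have := decr _ _ (ltW st) th; rewrite Ph.
- by move=> t t1; rewrite neq_lt => /orP[ts|st]; [exact: incr|exact: decr].
Qed.

Lemma prof_approx_lo s d t : lo < s -> 0 <= d -> -1 < t <= lo -> prof s d t <= 0.
Proof.
move=> ls d0 /andP[t1]; rewrite le_eqVlt => /predU1P[->|tl]; first by rewrite prof_lo.
have s0 : 0 < s by exact: lt_trans ls.
have l2s : lo / 2 < s by have := lo0; lra.
have := prof_incr s0 d0 t1 tl l2s (ltW ls).
by rewrite prof_lo => /ltW.
Qed.

Lemma prof_approx_hi s d t : lo < s -> 0 <= d -> s + d <= hi -> hi <= t -> prof s d t <= prof s d hi.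
Proof.
move=> ls d0 sd; rewrite le_eqVlt => /predU1P[->//|ht].
have s0 : 0 < s by exact: lt_trans ls.
by apply: ltW; apply: prof_decr => //; rewrite (lt_trans _ hi0)// ltrN10.
Qed.

(** One error comes from the integral up to [t] and one from the normalization at [lo]; the integral
    up to [hi] bounds each. *)
Lemma prof_dist s d t : lo < s < hi -> 0 <= d <= 1 -> lo <= t <= hi ->
  `|prof s d t - prof s 0 t| <= 2 * \int[mu]_(x in `[-1, hi]) `|rslope s d x - rslope s 0 x|.
Proof.
move=> /andP[ls sh] /andP[d0 d1] /andP[lt th].
have s0 : 0 < s by exact: lt_trans ls.
have i1 y := rslope_integrable y s0 d0; have i2 y := rslope_integrable y s0 (lexx 0).
have H y : y <= hi -> `|\int[mu]_(x in `[-1, y]) rslope s d x - \int[mu]_(x in `[-1, y]) rslope s 0 x| <=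
    \int[mu]_(x in `[-1, hi]) `|rslope s d x - rslope s 0 x|.
  move=> yh; have mD : measurable (`[-1, y] : set R) by exact: measurable_itv.
  have mD' : measurable (`[-1, hi] : set R) by exact: measurable_itv.
  apply: (@le_Rintegral_dist_subset _ _ R mu _ _ (rslope s d) (rslope s 0) mD mD' (i1 hi) (i2 hi)).
  by move=> x /=; rewrite !in_itv/= => /andP[-> /le_trans]; apply.
exact: (dist_sub_le (H t th) (H lo (ltW lohi))).
Qed.

Lemma prof_dist_cvg0 s (d_ : nat -> R) : lo < s < hi -> (forall n, 0 <= d_ n <= 1) ->
  d_ n @[n --> \oo] --> (0 : R) ->
  (2 * \int[mu]_(x in `[-1, hi]) `|rslope s (d_ n) x - rslope s 0 x|)%R @[n --> \oo] --> (0 : R).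
Proof.
move=> /andP[ls sh] dI cd.
have sI : lo <= s <= hi by rewrite !ltW.
have I01 : 0 <= (0 : R) <= 1 by rewrite lexx ler01.
rewrite -[X in _ --> X](mulr0 2); apply: cvgMr.
apply: (rslope_int_cvg (lexx hi) (fun=> sI) dI sI I01 (cvg_cst _) cd) => t.
by apply: clampr_cvg0 => // n; case/andP: (dI n).
Qed.

End radial_profile.

(** * Moving the hole *)

Section annuli_geometry.
Context {R : realType} {N : nat}.
Notation V := 'rV[R]_N.
Notation mu := (@lebesgue_rV R N).
Implicit Types (x c : V) (r : R).

Lemma continuous_enorm_sub c : continuous (fun x : V => enorm (x - c)).
Proof. exact: cont_compose (@continuous_subv R N c) (@continuous_enorm R N). Qed.

(** The points [c + t (x - c)] with [0 < t < 1] stay in the open ball, since [t * r < r], and tend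
    to [x]. *)
Lemma closure_eball c r : 0 < r -> closure (eball c r) = [set x | enorm (x - c) <= r].
Proof.
move=> r0; apply/seteqP; split.
  have clB : closed [set x : V | enorm (x - c) <= r].
    apply: (@closed_fun_le R V (fun x : V => enorm (x - c))); exact: continuous_enorm_sub.
  rewrite [X in _ `<=` X](closure_id _).1//; apply: closure_subset => x.
  by rewrite /eball/= => /ltW.
move=> x /= xr B Bx.
pose f (t : R) : V := c + t *: (x - c).
have cf : f t @[t --> 1^'-] --> x.
  apply: cvg_within_filter.
  have -> : x = f 1 by rewrite /f scale1r addrC subrK.
  by apply: cvgD; [exact: cvg_cst|apply: cvgZl; exact: cvg_id].
near (1 : R)^'- => t.
exists (f t); split; last by near: t; exact: cf.
rewrite /eball /f /= [c + _]addrC addrK enormZ.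
have t1 : t < 1 by near: t; exact: nbhs_left_lt.
have t0 : 0 < t by near: t; apply: nbhs_left_gt.
rewrite gtr0_norm//; apply: le_lt_trans (ler_wpM2l (ltW t0) xr) _.
by rewrite gtr_pMl.
Unshelve. all: by end_near.
Qed.

Lemma annulusP r0 r1 c x : 0 < r0 -> annulus r0 r1 c x <-> enorm x < r1 /\ r0 < enorm (x - c).
Proof.
move=> r00; rewrite /annulus closure_eball//; split.
  by move=> [xr /negP]; rewrite /eball/= subr0 -ltNge in xr *.
by move=> [xr xc]; split; [rewrite /eball/= subr0|apply/negP; rewrite -ltNge].
Qed.

Lemma measurable_annulus r0 r1 c : 0 < r0 -> measurable (annulus r0 r1 c).
Proof.
move=> r00; apply: measurableD; first exact: measurable_eball.
rewrite closure_eball// -[X in measurable X]setCK; apply: measurableC; apply: measurable_open_rV.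
by apply: closed_openC; apply: (@closed_fun_le R V (fun x : V => enorm (x - c))); exact: continuous_enorm_sub.
Qed.

Lemma annulus_bounded r0 r1 c x (j : 'I_N) : 0 < r0 -> annulus r0 r1 c x -> `|x ord0 j| <= r1.
Proof.
move=> r00 /annulusP-/(_ r00)[xr _]; apply: le_trans (coord_le_enorm x j) _; exact: ltW.
Qed.

Lemma annuli_centered r0 r1 : 0 < r0 -> r0 < r1 -> annuli r0 r1 (annulus r0 r1 (0 : V)).
Proof.
move=> r00 rr; exists 0 => //; rewrite closure_eball// => x /=.
by rewrite /eball/= => /le_lt_trans; apply.
Qed.

Lemma enorm_sub_sq_flip (i : 'I_N) (c c' x : V) : (forall j, j != i -> c ord0 j = c' ord0 j) ->
  enorm (x - c) ^+ 2 - enorm (x - c') ^+ 2 =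
  (c ord0 i - c' ord0 i) * (c ord0 i + c' ord0 i - 2 * x ord0 i).
Proof.
move=> H; rewrite !enorm_sq /dotv (bigD1 i)//= [X in _ - X](bigD1 i)//=.
have -> : \sum_(j | j != i) (x - c) ord0 j * (x - c) ord0 j =
          \sum_(j | j != i) (x - c') ord0 j * (x - c') ord0 j.
  by apply: eq_bigr => j ji; rewrite !mxE H.
rewrite !mxE; ring.
Qed.

Lemma enorm_sub_flip (i : 'I_N) (c c' x : V) : (forall j, j != i -> c ord0 j = c' ord0 j) ->
  enorm (flip i (c ord0 i + c' ord0 i) x - c) = enorm (x - c').
Proof.
move=> H; rewrite /enorm /dotv; congr Num.sqrt; apply: eq_bigr => j _; rewrite mxE flipE !mxE.
by have [->|ji] := eqVneq j i; [ring|rewrite H].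
Qed.

Lemma enorm_sq_flip (i : 'I_N) h x : enorm (flip i h x) ^+ 2 - enorm x ^+ 2 = h * (h - 2 * x ord0 i).
Proof.
rewrite !enorm_sq /dotv (bigD1 i)//= [X in _ - X](bigD1 i)//=.
have -> : \sum_(j | j != i) flip i h x ord0 j * flip i h x ord0 j =
          \sum_(j | j != i) x ord0 j * x ord0 j.
  by apply: eq_bigr => j ji; rewrite !flipE (negbTE ji).
rewrite flipE eqxx; ring.
Qed.

Lemma enorm_le_sq (x y : V) : 0 <= enorm y ^+ 2 - enorm x ^+ 2 -> enorm x <= enorm y.
Proof. by rewrite subr_ge0 ler_pXn2r// nnegrE enorm_ge0. Qed.

Section one_step.
Variables (r0 r1 : R) (i : 'I_N) (c c' : V).
Hypotheses (r00 : 0 < r0) (cc' : `|c' ord0 i| < `|c ord0 i|).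
Hypothesis ceq : forall j, j != i -> c ord0 j = c' ord0 j.
(** Twice the midpoint of the two values of coordinate [i], so that [flip i h] exchanges [c] and
    [c']. *)
Let h := c ord0 i + c' ord0 i.

Lemma shift_neq0 : h != 0.
Proof.
apply/eqP => h0; move: cc'.
have -> : c' ord0 i = - c ord0 i by apply/eqP; rewrite -addr_eq0 addrC; apply/eqP.
by rewrite normrN ltxx.
Qed.

(** The product is [c_i^2 - c'_i^2]. Its sign says that [c'], with the smaller coordinate in
    absolute value, lies on the same side of the mirror as the origin. *)
Let hc : 0 < h * (c ord0 i - c' ord0 i).
Proof.
rewrite mulrC -subr_sqr subr_gt0 -(real_normK (num_real (c ord0 i))) -(real_normK (num_real (c' ord0 i))).
by rewrite ltr_pXn2r// nnegrE.
Qed.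

Let hk (y : R) : 0 <= h * y -> 0 <= (c ord0 i - c' ord0 i) * y.
Proof.
move=> hy; have hh : 0 < h * h by rewrite -expr2 exprn_even_gt0//= shift_neq0.
by rewrite -(pmulr_rge0 _ hh) mulrACA mulr_ge0// ltW.
Qed.

Let flip_c' (x : V) : enorm (flip i h x - c') = enorm (x - c).
Proof.
have -> : h = c' ord0 i + c ord0 i by rewrite /h addrC.
by apply: enorm_sub_flip => j ji; rewrite ceq.
Qed.

(** On the origin's side, [x] is no farther from the origin than its image, and no closer to [c]
    than to [c']. If [x] is in the old annulus, the second fact clears the new hole. If its image
    is, the first one keeps [x] in the outer ball, and the distance of the image to [c'] is that of
    [x] to [c]. *)
Lemma annulus_polar_max (x : V) : 0 <= h * (h - 2 * x ord0 i) ->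
  annulus r0 r1 c' x \/ annulus r0 r1 c' (flip i h x) -> annulus r0 r1 c x.
Proof.
move=> side; have H1 := enorm_sub_sq_flip x ceq; have H3 := enorm_sq_flip i h x.
move=> [/(annulusP _ _ _ r00)[xr xc]|/(annulusP _ _ _ r00)[xr xc]]; apply/annulusP => //.
  split=> //; apply: lt_le_trans xc _; apply: enorm_le_sq; rewrite H1.
  exact: hk.
rewrite -flip_c'; split => //.
by apply: le_lt_trans xr; apply: enorm_le_sq; rewrite H3.
Qed.

(** [x] itself supplies the outer bound and its image the inner one, since the image is as far from
    [c'] as [x] is from [c]. *)
Lemma annulus_polar_min (x : V) : h * (h - 2 * x ord0 i) <= 0 ->
  annulus r0 r1 c' x -> annulus r0 r1 c' (flip i h x) -> annulus r0 r1 c x.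
Proof.
move=> _ /(annulusP _ _ _ r00)[xr _] /(annulusP _ _ _ r00)[_ xc].
by apply/annulusP => //; rewrite -flip_c'.
Qed.

Lemma annulus_polarization p phi eta : 1 < p -> 0 < eta ->
  test_function (annulus r0 r1 c') phi -> (forall x, 0 <= phi x) ->
  exists psi, [/\ test_function (annulus r0 r1 c) psi, forall x, 0 <= psi x,
    energy p psi <= energy p phi + eta,
    (forall x : V, 0 <= h * (h - 2 * x ord0 i) ->
       `|psi x - Num.max (phi x) (phi (flip i h x))| <= eta) &
    (forall x : V, h * (h - 2 * x ord0 i) <= 0 ->
       `|psi x - Num.min (phi x) (phi (flip i h x))| <= eta)].
Proof.
move=> p1 eta0 tphi phi0.
apply: (@polarization_test R N p _ (annulus r0 r1 c') r1) => //.
- exact: shift_neq0.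
- by move=> x Ox j; exact: annulus_bounded Ox.
- exact: annulus_polar_max.
- exact: annulus_polar_min.
Qed.

Lemma torsion_energy_shift p : 1 < p ->
  torsion_energy p (annulus r0 r1 c) <= torsion_energy p (annulus r0 r1 c').
Proof.
move=> p1; apply/ler_addgt0Pr => e e0.
have B c0 x : annulus r0 r1 c0 x -> forall j : 'I_N, `|x ord0 j| <= r1.
  by move=> Ox j; exact: annulus_bounded Ox.
have e20 : 0 < e / 2 by rewrite divr_gt0.
have [phi [t1 phi0 J1]] := nonneg_minimizing i p1 e20 (B c').
have [psi [t2 _ J2 _ _]] := annulus_polarization p1 e20 t1 phi0.
apply: le_trans (torsion_energy_le i p1 (B c) t2) _.
apply: le_trans J2 _; rewrite [X in _ <= _ + X]splitr addrA.
by rewrite lerD2r.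
Qed.

End one_step.

(** By induction on the number of coordinates in which the centres differ: each of these is [0] for
    [c'], and one reflection moves it to its value in [c] while the others stay fixed. *)
Lemma torsion_energy_chain p r0 r1 (c c' : V) : 1 < p -> 0 < r0 ->
  (forall j, c' ord0 j = c ord0 j \/ c' ord0 j = 0) ->
  torsion_energy p (annulus r0 r1 c) <= torsion_energy p (annulus r0 r1 c').
Proof.
move=> p1 r00; have [n] := ubnP #|[set j : 'I_N | c' ord0 j != c ord0 j]%SET|.
elim: n c' => // n IH c' nc H.
have [->|] := eqVneq c' c; first exact: lexx.
rewrite -subr_eq0 => /rV0Pn[j]; rewrite !mxE subr_eq0 => cj.
have c'j : c' ord0 j = 0 by case: (H j) => // E; rewrite E eqxx in cj.
pose c'' : V := \row_k if k == j then c ord0 k else c' ord0 k.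
have c''E k : c'' ord0 k = if k == j then c ord0 k else c' ord0 k by rewrite mxE.
apply: (@le_trans _ _ (torsion_energy p (annulus r0 r1 c''))).
  apply: IH => [|k]; last by rewrite c''E; case: eqP => _; [left|exact: H].
  rewrite ltnS in nc; apply: leq_trans nc; apply: proper_card; apply/properP; split.
    by apply/fintype.subsetP => k; rewrite !inE c''E; case: (k == j); rewrite ?eqxx.
  by exists j; rewrite !inE// c''E !eqxx.
apply: (@torsion_energy_shift r0 r1 j c'' c') => //.
  by rewrite c'j normr0 c''E eqxx normr_gt0 -c'j eq_sym.
by move=> k kj; rewrite c''E (negbTE kj).
Qed.

End annuli_geometry.

(** * The torsion function of the concentric annulus *)

Lemma softcut_dist (R : realType) (e v w : R) : 0 < e -> `|v - w| <= e ->
  `|softcut e (v - e) - Num.max w 0| <= 3 * e.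
Proof.
move=> e0; have := softcut_itv (v - e) (ltW e0).
move: (softcut e (v - e)) => a.
have [ve|ve] := leP (v - e) 0; have [w0|w0] := leP w 0;
  rewrite !ler_norml => /andP[? ?] /andP[? ?]; apply/andP; split; lra.
Qed.

(** The ratio of [e_ n] to [u_ n] tends to [0]: truncation disappears from the gradient in the limit
    wherever the function is positive. *)
Lemma dsoftcut_cvg1 (R : realType) (e_ u_ : nat -> R) (u : R) : 0 < u -> (forall n, 0 < e_ n) ->
  e_ n @[n --> \oo] --> (0 : R) -> u_ n @[n --> \oo] --> u ->
  dsoftcut (e_ n) (u_ n) @[n --> \oo] --> (1 : R).
Proof.
move=> u0 e0 ce cu.
have civ : (u_ n)^-1 @[n --> \oo] --> u^-1 by apply: cvgV => //; rewrite gt_eqF.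
have cq : e_ n * (u_ n)^-1 @[n --> \oo] --> (0 : R) by rewrite -(mul0r u^-1); exact: cvgM.
have cx : expR (- (e_ n * (u_ n)^-1)) @[n --> \oo] --> (1 : R).
  have cN : - (e_ n * (u_ n)^-1) @[n --> \oo] --> (0 : R) by rewrite -oppr0; exact: cvgN.
  have -> : (1 : R) = expR 0 by rewrite expR0.
  exact: (@cvg_comp _ _ _ (fun n => - (e_ n * (u_ n)^-1)) (@expR R) _ _ _ cN (@continuous_expR R 0)).
have c1 : expR (- (e_ n * (u_ n)^-1)) + (e_ n * (u_ n)^-1) * expR (- (e_ n * (u_ n)^-1)) @[n --> \oo] --> (1 : R).
  have -> : (1 : R) = 1 + 0 * 1 by rewrite mul0r addr0.
  by apply: cvgD => //; apply: cvgM.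
apply: cvg_trans c1; apply: near_eq_cvg.
have /cvgr_gt/(_ _ u0) := cu; apply: filterS => n un.
by rewrite /dsoftcut /flat un expr0 invr1 mul1r expr1 mulrA.
Qed.

(** [b] inverts the flux map: [|b| r = (|k| r)^(1 / (p - 1))], so that for [|x| = r] the vector
    [b x] has flux [k x]. *)
Lemma rpow_flux (R : realType) (p r k : R) : 1 < p -> 0 < r ->
  let b := (r ^+ 2) `^ (((p - 1)^-1 - 1) / 2) * rpow (p - 1)^-1 0 k in
  (`|b| * r) `^ (p - 2) * b = k.
Proof.
move=> p1 r0 b; have q0 : 0 < p - 1 by rewrite subr_gt0.
have [k0|k0] := eqVneq k 0; first by rewrite /b /rpow k0 mul0r !mulr0.
have m0 : 0 < `|k| * r by rewrite mulr_gt0// normr_gt0.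
have bE : b = (`|k| * r) `^ ((p - 1)^-1 - 1) * k.
  rewrite /b /rpow addr0 mulrCA mulrC; congr (_ * _).
  rewrite -(real_normK (num_real k)) -powRM ?sqr_ge0//.
  have -> : r ^+ 2 * `|k| ^+ 2 = (`|k| * r) `^ 2.
    by rewrite powR_mulrn ?(ltW m0)// exprMn mulrC.
  by rewrite -powRrM; congr (_ `^ _); field; rewrite gt_eqF.
have bn : `|b| * r = (`|k| * r) `^ (p - 1)^-1.
  rewrite bE normrM (ger0_norm (powR_ge0 _ _)) -mulrA.
  rewrite -[X in _ * X](powRr1 (ltW m0)) -powRD ?subrK//.
  by rewrite (gt_eqF m0) implybT.
rewrite bn bE mulrA -powRrM -powRD; last by rewrite (gt_eqF m0) implybT.
have -> : (p - 1)^-1 * (p - 2) + ((p - 1)^-1 - 1) = 0 by field; rewrite gt_eqF.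
by rewrite powRr0 mul1r.
Qed.

Lemma divergence_arith (R : realType) (N : nat) (a b c d f : R) : N%:R != 0 :> R ->
  N%:R^-1 * (a * (b * d) - 1) * f *+ N + c +
    2 * f * (N%:R^-1 * (a * (- (N%:R / 2) * b))) * d = - f + c.
Proof. by move=> n0; rewrite -mulr_natl; field. Qed.

Section radial_field.
Context {R : realType} {N : nat}.
Notation V := 'rV[R]_N.
Notation mu := (@lebesgue_rV R N).
Notation e_ i := (delta_mx ord0 i : V).
Implicit Types (x : V) (phi : V -> R).

Definition sqn x : R := dotv x x.

Lemma sqnE x : sqn x = enorm x ^+ 2. Proof. by rewrite enorm_sq. Qed.

Lemma is_derive_sqn i x : is_derive x (e_ i) sqn (2 * x ord0 i).
Proof.
apply/is_derive_lineP.
have ee : dotv (e_ i) (e_ i) = 1.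
  rewrite /dotv (bigD1 i)//= big1 ?addr0 => [|j ji]; first by rewrite !mxE !eqxx mulr1.
  by rewrite !mxE (negbTE ji) andbF mulr0.
have ex : dotv (e_ i) x = x ord0 i.
  rewrite /dotv (bigD1 i)//= big1 ?addr0 => [|j ji]; first by rewrite !mxE !eqxx mul1r.
  by rewrite !mxE (negbTE ji) andbF mul0r.
rewrite (_ : (fun h => _) = (fun h : R => dotv x x + (2 * x ord0 i * h + h * h))); last first.
  apply/funext => h; rewrite /sqn dotvDl !dotvDr !dotvZl !dotvZr ee (dotvC x) ex; ring.
have i0 := is_derive_id (0 : R) (1 : R).
have := is_derive_add (is_derive_const (dotv x x) 0 (1 : R))
  (is_derive_add (is_derive_prod (is_derive_const (2 * x ord0 i) (0 : R) 1) i0) (is_derive_prod i0 i0)).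
by move/is_derive_eq; apply; ring.
Qed.

Lemma Ck_sqn k : Ck k sqn.
Proof. by apply: Ck_sum => j; apply: CkM; exact: Ck_coord. Qed.

(** Meant for coefficients that are singular at the origin, multiplied by functions that vanish near
    every point outside the annulus. *)
Lemma cont_mul_singular (k f : V -> R) : continuous f ->
  (forall x, {for x, continuous k} \/ \forall y \near x, f y = 0) ->
  continuous (fun x => k x * f x).
Proof.
move=> cf H x; have [ck|f0] := H x; first exact: cont_at_mul ck (cf x).
apply: (@continuous_near_eq _ _ (fun=> 0)); last exact: cont_cst.
by apply: filterS f0 => y ->; rewrite mulr0.
Qed.

Lemma test_near0 Om phi x : test_function Om phi -> ~ Om x -> \forall y \near x, phi y = 0.
Proof.
move=> [_ _ sub] Ox.
have : nbhs x (~` closure [set x | phi x != 0]).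
  apply: open_nbhs_nbhs; split; first by apply: closed_openC; exact: closed_closure.
  by move=> /sub.
apply: filterS => y Hy; apply/eqP/negPn/negP => py; apply: Hy.
exact: (@subset_closure _ [set x | phi x != 0]).
Qed.

Lemma cont_integrable (Om : set V) (f : V -> R) M : measurable Om ->
  (forall x, Om x -> forall i, `|x ord0 i| <= M) -> continuous f ->
  mu.-integrable Om (EFin \o f).
Proof.
move=> mOm OmM cf.
have [C HC] : exists C : R, forall x, Om x -> `|f x| <= C.
  have [S0|/set0P S0] := eqVneq [set x : V | forall i, `|x ord0 i| <= M] set0.
    by exists 0 => x /OmM Ox; have : [set x : V | forall i, `|x ord0 i| <= M] x by []; rewrite S0.
  have cf' : continuous (fun x => `|f x|).
    by apply: (@cont_comp R _ (@Num.norm R R)) => //; exact: norm_continuous.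
  have [c _ Hc] := compact_EVT_max S0 (@bounded_closed_cube R N M) (continuous_subspaceT cf').
  by exists `|f c| => x /OmM Ox; apply: Hc; exact/mem_set.
apply: (measurable_bounded_integrable mOm (bounded_measure_lty mOm OmM)).
  by apply: measurable_funTS; exact: continuous_measurable_rV.
exists C; split; first exact: num_real.
by move=> k ck x /HC/= fC; exact: le_trans fC (ltW ck).
Qed.


Lemma cont_at_sub (T : topologicalType) (f g : T -> R) (x : T) : continuous_at x f -> continuous_at x g ->
  continuous_at x (fun y => f y - g y).
Proof. by move=> cf cg; apply: cvgB. Qed.

(** * The radial field, its potential and approximating test functions *)

Section torsion_field.
Variables (p r0 r1 s : R) (i0 : 'I_N).
Hypotheses (p1 : 1 < p) (r00 : 0 < r0) (rr : r0 < r1).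
Let lo := r0 ^+ 2.
Let hi := r1 ^+ 2.
Let nu : R := N%:R / 2.
Let be : R := (p - 1)^-1.
Let n0 : 0 < (N%:R : R). Proof. by rewrite ltr0n; apply: leq_trans (ltn_ord i0). Qed.
Let lo0 : 0 < lo. Proof. by rewrite exprn_gt0. Qed.
Let lohi : lo < hi. Proof. by rewrite ltr_pXn2r// ?nnegrE ltW// (lt_trans r00 rr). Qed.
Let nu0 : 0 < nu. Proof. by rewrite divr_gt0. Qed.
Let be0 : 0 < be. Proof. by rewrite invr_gt0 subr_gt0. Qed.
Hypothesis sI : lo < s < hi.
Let s0 : 0 < s. Proof. by case/andP: sI => + _; exact: lt_trans. Qed.
Notation Om := (annulus r0 r1 (0 : V)).
Notation Kap := (kap nu N%:R s).
Notation Rad := (rslope lo nu be N%:R s).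
Notation Prof := (prof lo nu be N%:R s).

Lemma annulus0P x : Om x <-> lo < sqn x < hi.
Proof.
rewrite annulusP// subr0 sqnE /lo /hi; have r10 : 0 <= r1 by rewrite ltW// (lt_trans r00).
rewrite !ltr_pXn2r ?nnegrE ?enorm_ge0 ?(ltW r00)//.
by split => [[-> ->//]|/andP[]].
Qed.

Let OmM x : Om x -> forall j : 'I_N, `|x ord0 j| <= r1.
Proof. by move=> Ox j; exact: annulus_bounded Ox. Qed.

Let mOm : measurable Om. Proof. exact: measurable_annulus. Qed.

(** By the chain rule, the gradient of the function that takes [x] to [Prof d (sqn x)]. *)
Definition rfield (d : R) x : V := (2 * Rad d (sqn x)) *: x.

Lemma rfield_flux x v : lo <= sqn x ->
  enorm (rfield 0 x) `^ (p - 2) * dotv (rfield 0 x) v = Kap (sqn x) * dotv x v.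
Proof.
move=> lx; have sx0 : 0 < sqn x by exact: lt_le_trans lx.
have ex0 : 0 < enorm x.
  rewrite lt_neqAle enorm_ge0 andbT eq_sym; apply: contraTneq sx0 => e0.
  by rewrite sqnE e0 expr0n/= ltxx.
rewrite /rfield enormZ dotvZl mulrA; congr (_ * _).
have cE : clampr lo 0 (sqn x) = sqn x.
  have := clampr_itv lo (sqn x) (lexx 0).
  rewrite subr0 max_r; last by apply: le_trans lx; rewrite ler_pdivrMr// ler_peMr ?(ltW lo0)// ler1n.
  by rewrite -eq_le => /eqP.
have -> : 2 * Rad 0 (sqn x) = sqn x `^ ((be - 1) / 2) * rpow be 0 (Kap (sqn x)).
  by rewrite /rslope cE mulrA divff// mul1r.
have := rpow_flux (Kap (sqn x)) p1 ex0.
by rewrite -sqnE.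
Qed.

Lemma is_derive_kap i x : 0 < sqn x ->
  is_derive x (e_ i) (fun x => Kap (sqn x))
    (N%:R^-1 * (s `^ nu * (- nu * sqn x `^ (- nu - 1))) * (2 * x ord0 i)).
Proof.
move=> sx0.
have D0 : is_derive (sqn x) 1 (fun t : R => t `^ (- nu)) (- nu * sqn x `^ (- nu - 1)).
  exact: is_derive1_powR.
have c (k : R) := is_derive_const k (sqn x) (1 : R).
have D1 := is_derive_prod (c N%:R^-1) (is_deriveB (is_derive_prod (c (s `^ nu)) D0) (c 1)).
have D2 : is_derive (sqn x) 1 Kap (N%:R^-1 * (s `^ nu * (- nu * sqn x `^ (- nu - 1)))).
  by apply: (is_derive_eq (D1 : is_derive (sqn x) 1 Kap _)); rewrite !mulr0 !addr0 subr0.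
exact: is_derive_comp_line D2 (is_derive_sqn i x).
Qed.

Let dK i x := N%:R^-1 * (s `^ nu * (- nu * sqn x `^ (- nu - 1))) * (2 * x ord0 i).

Let sqn_gt0 x : Om x -> 0 < sqn x.
Proof. by move=> /annulus0P/andP[+ _]; exact: lt_trans. Qed.

Let cpow (a : R) x : 0 < sqn x -> {for x, continuous (fun x => sqn x `^ a)}.
Proof.
move=> sx0; apply: (@continuous_comp _ _ _ sqn (fun t : R => t `^ a)).
  exact: (Ck_sqn 0).
exact: continuous_powR_pos.
Qed.

Let cKap x : 0 < sqn x -> {for x, continuous (fun x => Kap (sqn x))}.
Proof.
move=> sx0; have cst (k : R) : continuous_at x (fun _ : V => k) by exact: cont_cst.
exact: (cont_at_mul (cst _) (cont_at_sub (cont_at_mul (cst _) (cpow (a := - nu) sx0)) (cst _))).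
Qed.

Let cdK i x : 0 < sqn x -> {for x, continuous (dK i)}.
Proof.
move=> sx0; have cst (k : R) : continuous_at x (fun _ : V => k) by exact: cont_cst.
have cc : continuous_at x (fun y : V => y ord0 i) by exact: coord_continuous.
exact: (cont_at_mul (cont_at_mul (cst _) (cont_at_mul (cst _) (cont_at_mul (cst _) (cpow (a := - nu - 1) sx0))))
  (cont_at_mul (cst _) cc)).
Qed.

(** The divergence theorem for [phi] times the field [Kap (sqn x) x], whose divergence is [-1]:
    [F i] is the [i]th component, and its derivative in direction [i] has integral [0]. The
    singularity at the origin is harmless, as [phi] vanishes near every point outside the
    annulus. *)
Lemma field_by_parts phi : test_function Om phi ->
  \int[mu]_(x in Om) phi x = \int[mu]_(x in Om) (Kap (sqn x) * dotv x (grad phi x)).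
Proof.
move=> t.
have cphi := test_Cc t; have cd i := test_partial_Cc i t.
pose f1 i x := x ord0 i * phi x.
pose f2 i x := phi x + x ord0 i * partial i phi x.
pose F i x := Kap (sqn x) * f1 i x.
pose dF i x := Kap (sqn x) * f2 i x + f1 i x * dK i x.
have Cf1 i : Cc (f1 i) by apply: Cc_mul => //; exact: coord_continuous.
have Cf2 i : Cc (f2 i) by apply: Cc_add => //; apply: Cc_mul => //; exact: coord_continuous.
have nOm x : ~ 0 < sqn x -> ~ Om x by move=> nx /sqn_gt0.
have f10 i x : ~ Om x -> \forall y \near x, f1 i y = 0.
  by move=> Ox; apply: filterS (test_near0 t Ox) => y py; rewrite /f1 py mulr0.
have f20 i x : ~ Om x -> \forall y \near x, f2 i y = 0.
  move=> Ox; apply: filterS (nbhs_interior (test_near0 t Ox)) => y py.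
  by rewrite /f2 (partial_near0 _ py) (nbhs_singleton py) mulr0 addr0.
have sing (k f : V -> R) : (forall x, 0 < sqn x -> {for x, continuous k}) ->
    (forall x, ~ Om x -> \forall y \near x, f y = 0) -> Cc f -> Cc (fun x => k x * f x).
  move=> ck fn [cf bf]; split; last by apply: bsupp_common bf _ => x ->; rewrite mulr0.
  apply: cont_mul_singular => // x; have [sx|/nOm Ox] := pselect (0 < sqn x).
    by left; exact: ck.
  by right; exact: fn.
have CF i : Cc (F i) by exact: (sing _ _ cKap (f10 i) (Cf1 i)).
have CdF i : Cc (dF i).
  apply: Cc_add; first exact: (sing _ _ cKap (f20 i) (Cf2 i)).
  rewrite (_ : (fun x => f1 i x * dK i x) = (fun x => dK i x * f1 i x)).
    exact: (sing _ _ (@cdK i) (f10 i) (Cf1 i)).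
  by apply/funext => x; rewrite mulrC.
have DF i x : is_derive x (e_ i) (F i) (dF i x).
  have [sx|/nOm Ox] := pselect (0 < sqn x).
    have d1 := is_derive_prod (is_derive_coord i i x) (test_is_derive i x t).
    have := is_derive_prod (is_derive_kap i sx) d1.
    by move/is_derive_eq; apply; rewrite /dF /f2 eqxx mulr1 [phi x + _]addrC.
  have -> : dF i x = 0.
    by rewrite /dF (nbhs_singleton (f10 i x Ox)) (nbhs_singleton (f20 i x Ox)) mulr0 mul0r addr0.
  apply: near_eq_is_derive (is_derive_const 0 x (e_ i)).
  by apply: filterS (f10 i x Ox) => y fy; rewrite /F fy mulr0.
have I0 i : \int[mu]_(x in Om) dF i x = 0.
  rewrite Rintegral_outside; first exact: (Rintegral_partial0 (CF i) (CdF i) (DF i)).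
  by move=> x Ox; rewrite /dF (nbhs_singleton (f10 i x Ox)) (nbhs_singleton (f20 i x Ox)) mulr0 mul0r addr0.
have [_] := integrable_sum_ord mOm OmM (fun i => Cc_integrableS mOm (CdF i)).
rewrite big1 => [|i _]; last exact: I0.
have E x : Om x -> \sum_i dF i x = - phi x + Kap (sqn x) * dotv x (grad phi x).
  move=> Ox; have sx := sqn_gt0 Ox.
  rewrite big_split/= /f1 /f2.
  under eq_bigr do rewrite mulrDr.
  rewrite big_split/= sumr_const card_ord.
  have -> : \sum_(i < N) Kap (sqn x) * (x ord0 i * partial i phi x) = Kap (sqn x) * dotv x (grad phi x).
    by rewrite -mulr_sumr; congr (_ * _); apply: eq_bigr => i _; rewrite mxE.
  have -> : \sum_(i < N) x ord0 i * phi x * dK i x =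
      2 * phi x * (N%:R^-1 * (s `^ nu * (- nu * sqn x `^ (- nu - 1)))) * sqn x.
    by rewrite /sqn /dotv mulr_sumr; apply: eq_bigr => i _; rewrite /dK; ring.
  have Es : sqn x `^ (- nu) = sqn x `^ (- nu - 1) * sqn x.
    rewrite -[X in _ * X](powRr1 (ltW sx)) -powRD ?subrK//.
    by rewrite (gt_eqF sx) implybT.
  rewrite {1}/kap Es; apply: divergence_arith.
  by rewrite gt_eqF.
have sphi := Cc_integrableS mOm cphi.
move=> I0'.
have iq : mu.-integrable Om (EFin \o (fun x => Kap (sqn x) * dotv x (grad phi x))).
  apply: Cc_integrableS => //; apply: sing => [x|x Ox|]; first exact: cKap.
    apply: filterS (nbhs_interior (test_near0 t Ox)) => y py.
    by rewrite grad0 => [|j]; [rewrite dotvC dotv0l|exact: partial_near0].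
  apply: (@test_grad_Cc R N p Om phi (fun x v => dotv x v)) => //.
    by apply: continuous_dotv; [exact: cont_id|exact: test_grad_continuous t].
  by move=> x; rewrite dotvC dotv0l.
have I1 : \int[mu]_(x in Om) (-1 * phi x + 1 * (Kap (sqn x) * dotv x (grad phi x))) = 0.
  rewrite -[RHS]I0'; apply: eq_Rintegral => x /set_mem Ox.
  by rewrite mulN1r mul1r E.
have I2 : \int[mu]_(x in Om) (-1 * phi x + 1 * (Kap (sqn x) * dotv x (grad phi x))) =
  -1 * \int[mu]_(x in Om) phi x + 1 * \int[mu]_(x in Om) (Kap (sqn x) * dotv x (grad phi x)).
  exact: Rintegral_lin.
rewrite I2 mulN1r mul1r addrC in I1; apply/eqP; rewrite eq_sym -subr_eq0; exact/eqP.
Qed.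

Lemma rfield_by_parts phi : test_function Om phi ->
  \int[mu]_(x in Om) phi x =
  \int[mu]_(x in Om) (enorm (rfield 0 x) `^ (p - 2) * dotv (rfield 0 x) (grad phi x)).
Proof.
move=> /field_by_parts ->; apply: eq_Rintegral => x /set_mem/annulus0P/andP[lx _].
by rewrite rfield_flux// ltW.
Qed.

Lemma continuous_rfield d : 0 <= d -> continuous (rfield d).
Proof.
move=> d0; apply: continuous_rV => j.
rewrite (_ : (fun t : V => _) = (fun t : V => 2 * Rad d (sqn t) * t ord0 j)); last first.
  by apply/funext => t; rewrite mxE.
apply: cont_mul; last exact: coord_continuous.
apply: cont_mul; first exact: cont_cst.
by apply: cont_comp; [exact: continuous_rslope|exact: (Ck_sqn 0)].
Qed.

Let rfield_mcoord d : 0 <= d -> mcoord Om (rfield d).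
Proof.
move=> d0 i; apply: measurable_funTS; apply: continuous_measurable_rV.
by apply: continuous_coord; exact: continuous_rfield.
Qed.

Let p0 : 0 < p. Proof. exact: lt_trans ltr01 p1. Qed.

Let rfield_integrable : mu.-integrable Om (EFin \o (fun x => enorm (rfield 0 x) `^ p)).
Proof.
apply: (cont_integrable mOm OmM).
by apply: cont_compose (continuous_enorm_powR p0); exact: continuous_rfield.
Qed.

Let Gam := \int[mu]_(x in Om) (enorm (rfield 0 x) `^ p).

Let flux_integrable_test phi : test_function Om phi -> mu.-integrable Om
  (EFin \o (fun x => enorm (rfield 0 x) `^ (p - 2) * dotv (rfield 0 x) (grad phi x))).
Proof.
move=> t; apply: (flux_integrable p1 mOm); first exact: rfield_mcoord.
- exact: test_grad_mcoord t.
- exact: rfield_integrable.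
- exact: test_grad_integrable t.
Qed.

Let dirichletOm phi : test_function Om phi ->
  dirichlet p phi = \int[mu]_(x in Om) (enorm (grad phi x) `^ p).
Proof.
move=> t; apply/esym/Rintegral_outside => x Ox.
rewrite (grad0 (phi := phi)) ?enorm0 ?powR0 ?gt_eqF// => i.
exact: test_partial_out t Ox.
Qed.

Let intOm phi : test_function Om phi -> \int[mu]_x phi x = \int[mu]_(x in Om) phi x.
Proof. by move=> t; apply/esym/Rintegral_outside => x Ox; exact: (test_out t Ox). Qed.

(** The gradient inequality at the field [rfield 0] bounds the energy of every test function from
    below, once [rfield_by_parts] has rewritten the linear term. The functions [phin] below show
    that the bound is approached. *)
Lemma radial_energy_lower : p^-1 * Gam - Gam <= torsion_energy p Om.
Proof.
apply: lb_le_inf; first exact: (energy_has_inf i0 p1 OmM).1.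
move=> _ [phi t <-]; rewrite energyE (dirichletOm t) (intOm t).
have iF := flux_integrable_test t.
have P x : Om x -> enorm (rfield 0 x) `^ p <= 1 * enorm (grad phi x) `^ p +
    - p * (1 * (enorm (rfield 0 x) `^ (p - 2) * dotv (rfield 0 x) (grad phi x)) +
    -1 * enorm (rfield 0 x) `^ p).
  move=> _; have := gradient_inequality (rfield 0 x) (grad phi x) p1.
  rewrite dotvDr dotvNr mulrDr mulrN flux_self//.
  by rewrite !mul1r mulN1r mulNr lerBrDr.
have iD := integrable_lin mOm 1 (-1) iF rfield_integrable.
have := le_Rintegral_lin mOm (test_grad_integrable p1 mOm t) iD rfield_integrable P.
have -> : \int[mu]_(x in Om) (1 * (enorm (rfield 0 x) `^ (p - 2) * dotv (rfield 0 x) (grad phi x)) +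
    -1 * enorm (rfield 0 x) `^ p) = 1 * \int[mu]_(x in Om) phi x + -1 * Gam.
  by rewrite (rfield_by_parts t); exact: Rintegral_lin.
by move=> H; exact: (solution_arith p0 H).
Qed.

Lemma Ck_rslope k d : 0 < d -> Ck k (fun x => Rad d (sqn x)).
Proof.
move=> d0.
have cl : Ck k (fun x => clampr lo d (sqn x)).
  apply: CkD; first exact: Ck_const.
  by apply: Ck_softcut => //; apply: CkD; [exact: Ck_sqn|exact: Ck_const].
have cK : Ck k (fun x => Kap (clampr lo d (sqn x))).
  apply: CkZ; apply: CkD; last exact: Ck_const.
  by apply: CkZ; apply: Ck_powR => // x; exact: clampr_gt0.
apply: CkZ; apply: CkM; first by apply: Ck_powR => // x; exact: clampr_gt0.
apply: CkM => //; apply: Ck_powR => [x|]; first by rewrite ltr_wpDl// sqr_ge0.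
by apply: CkD; [exact: CkM|exact: Ck_const].
Qed.

Let sqn_gtN1 x : -1 < sqn x.
Proof. by apply: lt_le_trans (dotv_ge0 x); rewrite oppr_lt0. Qed.

Lemma smooth_prof d : 0 < d -> smooth (fun x => Prof d (sqn x)).
Proof.
move=> d0 k; apply: CkW.
apply: (@Ck_comp R N k (Prof d) (Rad d) sqn) => [x||].
- by apply: is_derive_prof => //; exact: ltW.
- exact: Ck_rslope.
- exact: Ck_sqn.
Qed.

Hypothesis Prof_hi : Prof 0 hi = 0.

(** Outside the annulus the profile is nonpositive, so the maximum extends it by [0]. *)
Definition radial_torsion x : R := Num.max (Prof 0 (sqn x)) 0.

(** At most [1], as [rslope_bounded] asks, and at most [hi - s], so that the regularized profile
    still decreases beyond [hi]. *)
Let dn (n : nat) : R := Num.min 1 (hi - s) * n.+1%:R^-1.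
Let En (n : nat) : R :=
  2 * \int[@lebesgue_measure R]_(t in `[-1, hi]) `|Rad (dn n) t - Rad 0 t|.
(** Strictly above the uniform error [En n] of the regularized profile on [[lo, hi]], so that the
    cut at this level vanishes from [hi] on and has compact support in the annulus. *)
Let en (n : nat) : R := En n + n.+1%:R^-1.
Let phin (n : nat) (x : V) : R := softcut (en n) (Prof (dn n) (sqn x) - en n).

Let min0 : 0 < Num.min 1 (hi - s).
Proof. by rewrite lt_min ltr01 subr_gt0; case/andP: sI. Qed.

Let dn_gt0 n : 0 < dn n.
Proof. by rewrite mulr_gt0// invr_gt0 ltr0n. Qed.

Let dn_le n : dn n <= Num.min 1 (hi - s).
Proof. by rewrite ger_pMr// invf_le1 ?ltr0n// ler1n. Qed.

Let dn01 n : 0 <= dn n <= 1.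
Proof. by rewrite (ltW (dn_gt0 n))/=; apply: le_trans (dn_le n) _; rewrite ge_min lexx. Qed.

Let dn_hi n : s + dn n <= hi.
Proof. by rewrite -lerBrDl; apply: le_trans (dn_le n) _; rewrite ge_min lexx orbT. Qed.

Let cvg_dn : dn n @[n --> \oo] --> (0 : R).
Proof. by rewrite -[X in _ --> X](mulr0 (Num.min 1 (hi - s))); apply: cvgMr; exact: cvg_harmonic. Qed.

Let cvg_En : En n @[n --> \oo] --> (0 : R).
Proof. exact: (prof_dist_cvg0 lo0 lohi nu0 be0 n0 sI dn01 cvg_dn). Qed.

Let En_ge0 n : 0 <= En n.
Proof. by rewrite mulr_ge0// Rintegral_ge0. Qed.

Let en_gt0 n : 0 < en n.
Proof. by rewrite ltr_wpDl ?En_ge0// invr_gt0 ltr0n. Qed.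

Let cvg_en : en n @[n --> \oo] --> (0 : R).
Proof. by rewrite -[X in _ --> X](addr0 0); apply: cvgD cvg_En _; exact: cvg_harmonic. Qed.

Let En_lt n : En n < en n.
Proof. by rewrite ltrDl invr_gt0 ltr0n. Qed.

Let ls : lo < s. Proof. by case/andP: sI. Qed.

Let Prof_dist n t : lo <= t <= hi -> `|Prof (dn n) t - Prof 0 t| <= En n.
Proof. exact: (prof_dist nu N%:R lo0 lohi be0 sI (dn01 n)). Qed.

Let Prof_n_lo n t : -1 < t <= lo -> Prof (dn n) t <= 0.
Proof. exact: (prof_approx_lo lo0 nu0 be0 n0 ls (ltW (dn_gt0 n))). Qed.

Let Prof_n_hi n t : hi <= t -> Prof (dn n) t < en n.
Proof.
move=> ht; apply: le_lt_trans (En_lt n).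
apply: le_trans (prof_approx_hi lo0 lohi nu0 be0 n0 ls (ltW (dn_gt0 n)) (dn_hi n) ht) _.
have hh : lo <= hi <= hi by rewrite lexx ltW.
by have := Prof_dist n hh; rewrite Prof_hi subr0; apply: le_trans; exact: ler_norm.
Qed.

Let phin_near n x : `|phin n x - radial_torsion x| <= 3 * en n.
Proof.
have [H1 H2 H3 H4] := prof_bounds lo0 nu0 be0 n0 sI Prof_hi.
have [l|l] := leP (sqn x) lo.
  have t1 : -1 < sqn x <= lo by rewrite sqn_gtN1.
  rewrite /phin softcut_le0; last by rewrite subr_le0 (le_trans (Prof_n_lo n t1))// ltW.
  by rewrite /radial_torsion max_r ?H1// subrr normr0 mulr_ge0// ltW.
have [h|h] := leP hi (sqn x).
  rewrite /phin softcut_le0; last by rewrite subr_le0 ltW// Prof_n_hi.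
  by rewrite /radial_torsion max_r ?H2// subrr normr0 mulr_ge0// ltW.
apply: softcut_dist => //; apply: le_trans (ltW (En_lt n)).
by apply: Prof_dist; rewrite !ltW.
Qed.

Let phin_test n : test_function Om (phin n).
Proof.
pose K := [set x : V | en n <= Prof (dn n) (sqn x)] `&` [set x : V | sqn x <= hi].
have csq : continuous sqn by exact: (Ck_sqn 0).
have cP : continuous (fun x => Prof (dn n) (sqn x)) by exact: (smooth_prof (dn_gt0 n) 0).
have out x : en n <= Prof (dn n) (sqn x) -> lo < sqn x < hi.
  move=> ePn; rewrite !ltNge; apply/andP; split; apply/negP => h.
    have t1 : -1 < sqn x <= lo by rewrite sqn_gtN1.
    by have := le_trans ePn (Prof_n_lo n t1); rewrite leNgt en_gt0.
  by have := Prof_n_hi n h; rewrite ltNge ePn.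
have cB : compact [set x : V | sqn x <= hi].
  have sub : [set x : V | sqn x <= hi] `<=` [set x : V | forall j, `|x ord0 j| <= r1].
    move=> x /= xh j; apply: le_trans (coord_le_enorm x j) _.
    by rewrite -(@ler_pXn2r _ 2) ?nnegrE ?enorm_ge0 ?(ltW (lt_trans r00 rr))// -sqnE.
  by apply: (subclosed_compact _ (@bounded_closed_cube R N r1) sub); exact: closed_fun_le.
apply: (@test_intro R N Om _ K).
- move=> k; apply: Ck_softcut => //; apply: CkD; last exact: Ck_const.
  exact: smooth_prof (dn_gt0 n) k.
- apply: (subclosed_compact _ cB); last by move=> x [].
  by apply: closedI; [exact: closed_fun_ge|exact: closed_fun_le].
- by move=> x [/out xx _]; exact/annulus0P.
- move=> x px; have e1 : en n <= Prof (dn n) (sqn x).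
    by apply: contraNT px; rewrite -ltNge => /ltW h; rewrite /phin softcut_le0// subr_le0.
  by split => //=; case/andP: (out x e1) => _ /ltW.
Qed.

Let phin_grad n x : grad (phin n) x =
  dsoftcut (en n) (Prof (dn n) (sqn x) - en n) *: rfield (dn n) x.
Proof.
apply/rowP => j; rewrite !mxE.
have d0 := ltW (dn_gt0 n).
have d1 := is_derive_comp_line (is_derive_prof nu N%:R lo0 be0 s0 d0 (sqn_gtN1 x)) (is_derive_sqn j x).
have d2 : is_derive x (e_ j) (fun x => Prof (dn n) (sqn x) - en n)
    (Rad (dn n) (sqn x) * (2 * x ord0 j) - 0).
  exact: is_deriveB d1 (is_derive_const (en n) x (e_ j)).
have d3 := @is_derive_comp_line R _ (softcut (en n)) (fun x : V => Prof (dn n) (sqn x) - en n) _ _ _ _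
  (is_derive_softcut (Prof (dn n) (sqn x) - en n) (en_gt0 n)) d2.
rewrite (is_derive_partial (g := fun=> _) d3) subr0.
by rewrite mulrCA mulrA.
Qed.

Let Prof_cvg x : Om x -> Prof (dn n) (sqn x) @[n --> \oo] --> Prof 0 (sqn x).
Proof.
move=> /annulus0P/andP[l h]; have lh : lo <= sqn x <= hi by rewrite !ltW.
apply/cvgrPdist_le => e e0; have /cvgr0Pnorm_le/(_ _ e0) := cvg_En.
apply: filterS => n; rewrite ger0_norm ?En_ge0// => /(le_trans _); apply.
by rewrite distrC; exact: Prof_dist.
Qed.

Let rfield_cvg x : rfield (dn n) x @[n --> \oo] --> rfield 0 x.
Proof.
apply: cvgZl; apply: cvgMr.
apply: (rslope_cvg lo0 be0) => //; [by move=> n; case/andP: (dn01 n)|exact: cvg_cst|].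
by apply: clampr_cvg0 => // n; case/andP: (dn01 n).
Qed.

Let grad_cvg x : Om x -> grad (phin n) x @[n --> \oo] --> rfield 0 x.
Proof.
move=> Ox; have lh := annulus0P x; have /lh/andP[l h] := Ox.
have [_ _ H3 _] := prof_bounds lo0 nu0 be0 n0 sI Prof_hi.
have P0 : 0 < Prof 0 (sqn x) by apply: H3; rewrite l.
have cu : Prof (dn n) (sqn x) - en n @[n --> \oo] --> Prof 0 (sqn x).
  by rewrite -[X in _ --> X]subr0; apply: cvgB; [exact: Prof_cvg|exact: cvg_en].
have c1 := dsoftcut_cvg1 P0 en_gt0 cvg_en cu.
rewrite -[X in _ --> X]scale1r; under eq_fun do rewrite phin_grad.
by apply: cvgZ.
Qed.

Let rfield_bounded : exists2 B : R, 0 <= B & forall d x, 0 <= d <= 1 -> Om x -> enorm (rfield d x) <= B.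
Proof.
have [C HC] := rslope_bounded lo0 lohi nu0 be0 n0.
have r10 : 0 <= r1 by rewrite ltW// (lt_trans r00).
exists (2 * `|C| * r1) => [|d x dI Ox]; first by rewrite !mulr_ge0.
have /annulus0P/andP[_ xh] := Ox.
rewrite /rfield enormZ normrM ger0_norm//; apply: ler_pM; rewrite ?enorm_ge0 ?mulr_ge0//.
  rewrite ler_pM2l//; apply: le_trans (ler_norm C).
  by apply: HC => //; [rewrite !ltW//; case/andP: sI|exact: ltW].
by have /(annulusP _ _ _ r00)[/ltW] := Ox.
Qed.

Let phin_energy_cvg : energy p (phin n) @[n --> \oo] --> p^-1 * Gam - Gam.
Proof.
(* With the linear term rewritten as a flux integral only gradients occur, so their pointwise
   convergence and a uniform bound on the annulus suffice. *)
pose T x (v : V) := p^-1 * enorm v `^ p + -1 * (enorm (rfield 0 x) `^ (p - 2) * dotv (rfield 0 x) v).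
have iA n := test_grad_integrable p1 mOm (phin_test n).
have iB n := flux_integrable_test (phin_test n).
have E n : energy p (phin n) = \int[mu]_(x in Om) T x (grad (phin n) x).
  have -> : \int[mu]_(x in Om) T x (grad (phin n) x) =
    p^-1 * \int[mu]_(x in Om) (enorm (grad (phin n) x) `^ p) + -1 * \int[mu]_(x in Om)
      (enorm (rfield 0 x) `^ (p - 2) * dotv (rfield 0 x) (grad (phin n) x)).
    exact: (Rintegral_lin mOm _ _ (iA n) (iB n)).
  by rewrite energyE (dirichletOm (phin_test n)) (intOm (phin_test n)) (rfield_by_parts (phin_test n)) mulN1r.
have [B B0 HB] := rfield_bounded.
have gB n x : Om x -> enorm (grad (phin n) x) <= B.
  move=> Ox; rewrite phin_grad enormZ; have /andP[h0 h1] := dsoftcut_itv (Prof (dn n) (sqn x) - en n) (en_gt0 n).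
  rewrite ger0_norm//; apply: le_trans (HB _ _ (dn01 n) Ox).
  by rewrite ler_piMl ?enorm_ge0.
have I01 : 0 <= (0 : R) <= 1 by rewrite lexx ler01.
have TB n x : Om x -> `|T x (grad (phin n) x)| <= p^-1 * B `^ p + B `^ (p - 1) * B.
  move=> Ox; apply: le_trans (ler_normD _ _) _; rewrite mulN1r normrN; apply: lerD.
    rewrite ger0_norm ?mulr_ge0 ?powR_ge0 ?invr_ge0 ?(ltW p0)//.
    rewrite ler_wpM2l ?invr_ge0 ?(ltW p0)//.
    by apply: ge0_ler_powR; rewrite ?nnegrE ?enorm_ge0 ?(ltW p0)// gB.
  apply: le_trans (flux_le _ _ p1) _; apply: ler_pM; rewrite ?powR_ge0 ?enorm_ge0 ?gB//.
  by apply: ge0_ler_powR; rewrite ?nnegrE ?enorm_ge0 ?subr_ge0 ?(ltW p1) ?HB.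
have iC : mu.-integrable Om (EFin \o (fun=> p^-1 * B `^ p + B `^ (p - 1) * B)).
  by apply: integrable_const => //; exact: (bounded_measure_lty mOm OmM).
have mT n : measurable_fun Om (fun x => T x (grad (phin n) x)).
  exact: (integrable_measurable (integrable_lin mOm p^-1 (-1) (iA n) (iB n))).
have cT x : Om x -> T x (grad (phin n) x) @[n --> \oo] --> T x (rfield 0 x).
  move=> Ox; have ctT : continuous (T x).
    apply: cont_add; first by apply: cont_mul; [exact: cont_cst|exact: continuous_enorm_powR].
    apply: cont_mul; first exact: cont_cst.
    apply: cont_mul; first exact: cont_cst.
    by apply: continuous_dotv; [exact: cst_continuous|exact: cont_id].
  exact: (@cvg_comp _ _ _ (fun n => grad (phin n) x) (T x) _ _ _ (grad_cvg Ox) (ctT _)).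
have [_ cI] := dominated_Rintegral mOm mT cT iC TB.
have EL : \int[mu]_(x in Om) T x (rfield 0 x) = p^-1 * Gam - Gam.
  have -> : \int[mu]_(x in Om) T x (rfield 0 x) =
    \int[mu]_(x in Om) (p^-1 * enorm (rfield 0 x) `^ p + -1 * enorm (rfield 0 x) `^ p).
    by apply: eq_Rintegral => x _; rewrite /T flux_self.
  have -> : \int[mu]_(x in Om) (p^-1 * enorm (rfield 0 x) `^ p + -1 * enorm (rfield 0 x) `^ p) =
    p^-1 * Gam + -1 * Gam by exact: Rintegral_lin.
  by rewrite mulN1r.
rewrite EL in cI; have -> : (fun n => energy p (phin n)) = (fun n => \int[mu]_(x in Om) T x (grad (phin n) x)).
  by apply/funext => n; exact: E.
exact: cI.
Qed.

(** The energies of [phin] converge to the lower bound of [radial_energy_lower], so these functions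
    are minimizing, while staying uniformly close to [radial_torsion]. *)
Lemma radial_minimizing eta : 0 < eta -> exists phi, [/\ test_function Om phi,
  forall x, 0 <= phi x, energy p phi <= torsion_energy p Om + eta &
  forall x, `|phi x - radial_torsion x| <= eta].
Proof.
move=> eta0.
have eta3 : 0 < eta / 3 by rewrite divr_gt0.
have [n1 _ H1] : \forall n \near \oo, `|0 - en n| < eta / 3.
  by have /cvgrPdist_lt/(_ _ eta3) := cvg_en.
have [n2 _ H2] : \forall n \near \oo, `|p^-1 * Gam - Gam - energy p (phin n)| < eta.
  by have /cvgrPdist_lt/(_ _ eta0) := phin_energy_cvg.
pose n := maxn n1 n2.
exists (phin n); split; first exact: phin_test.
- by move=> x; exact: softcut_ge0.
- have := H2 n (leq_maxr _ _); rewrite /= distrC => /(le_lt_trans (ler_norm _)).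
  rewrite ltrBlDl => /ltW/le_trans; apply; rewrite lerD2r.
  exact: radial_energy_lower.
- move=> x; apply: le_trans (phin_near n x) _.
  have := H1 n (leq_maxl _ _); rewrite /= sub0r normrN ger0_norm ?(ltW (en_gt0 n))//.
  by rewrite ltr_pdivlMr// mulrC => /ltW.
Qed.

Lemma continuous_radial_torsion : continuous radial_torsion.
Proof.
apply: (@cont_comp R _ (fun t : R => Num.max t 0)).
  by move=> t; apply: continuous_max; [exact: cvg_id|exact: cst_continuous].
move=> x; apply: (@continuous_comp _ _ _ sqn (Prof 0)); first exact: (Ck_sqn 0).
have D := is_derive_prof nu N%:R lo0 be0 s0 (lexx 0) (sqn_gtN1 x).
by apply: differentiable_continuous; apply/derivable1_diffP; case: D.
Qed.

Lemma radial_torsion_max x : [/\ sqn x = s -> radial_torsion x = radial_torsion (Num.sqrt s *: e_ i0) &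
  sqn x != s -> radial_torsion x < radial_torsion (Num.sqrt s *: e_ i0)].
Proof.
have [_ _ H3 H4] := prof_bounds lo0 nu0 be0 n0 sI Prof_hi.
have P0 : 0 < Prof 0 s := H3 s sI.
have ee : sqn (Num.sqrt s *: e_ i0) = s.
  rewrite /sqn dotvZl dotvZr mulrA -expr2 sqr_sqrtr ?(ltW s0)// /dotv (bigD1 i0)//= big1 ?addr0 => [|j ji].
    by rewrite !mxE !eqxx mulr1 mulr1.
  by rewrite !mxE (negbTE ji) andbF mulr0.
split; rewrite /radial_torsion ee; first by move=> ->.
move=> xs; rewrite [ltRHS]max_l ?(ltW P0)// gt_max P0 andbT.
exact: H4.
Qed.

End torsion_field.

(* The constant [s] selected by [prof_root] is the squared radius of the sphere on which the
   torsion function of the concentric annulus attains its maximum. *)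
Lemma radial_torsion_exists p r0 r1 (i0 : 'I_N) : 1 < p -> 0 < r0 -> r0 < r1 ->
  exists (u : V -> R) (a m : R), [/\ continuous u, r0 < a < r1,
    forall x, enorm x = a -> u x = m, forall x, enorm x != a -> u x < m &
    forall eta, 0 < eta -> exists phi, [/\ test_function (annulus r0 r1 (0 : V)) phi,
      forall x, 0 <= phi x, energy p phi <= torsion_energy p (annulus r0 r1 (0 : V)) + eta &
      forall x, `|phi x - u x| <= eta]].
Proof.
move=> p1 r00 rr; have r10 : 0 < r1 by exact: lt_trans rr.
have n0 : 0 < (N%:R : R) by rewrite ltr0n; apply: leq_trans (ltn_ord i0).
have lo0 : 0 < r0 ^+ 2 by rewrite exprn_gt0.
have lohi : r0 ^+ 2 < r1 ^+ 2 by rewrite ltr_pXn2r// ?nnegrE ltW.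
have be0 : 0 < (p - 1)^-1 by rewrite invr_gt0 subr_gt0.
have nu0 : 0 < N%:R / 2 :> R by rewrite divr_gt0.
have [s sI Ps] := prof_root lo0 lohi nu0 be0 n0.
have s0 : 0 < s by case/andP: sI => + _; exact: lt_trans.
have sq x : enorm x = Num.sqrt s <-> sqn x = s.
  rewrite sqnE; split => [->|<-]; first by rewrite sqr_sqrtr ?ltW.
  by rewrite sqrtr_sqr ger0_norm ?enorm_ge0.
exists (radial_torsion p r0 s), (Num.sqrt s), (radial_torsion p r0 s (Num.sqrt s *: e_ i0)); split.
- exact: (@continuous_radial_torsion p r0 r1 s p1 r00 sI).
- case/andP: sI => ls sh; rewrite -(ger0_norm (ltW r00)) -(ger0_norm (ltW r10)) -!sqrtr_sqr.
  by rewrite !ltr_sqrt ?ls ?sh// exprn_gt0.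
- by move=> x /sq; have [H _] := @radial_torsion_max p r0 r1 s i0 p1 r00 sI Ps x.
- move=> x xs; have [_] := @radial_torsion_max p r0 r1 s i0 p1 r00 sI Ps x; apply.
  by apply: contra_neq xs => /sq.
- move=> eta eta0.
  exact: (@radial_minimizing p r0 r1 s i0 p1 r00 rr sI Ps eta eta0).
Qed.

End radial_field.

(** * Strict monotonicity *)

Lemma Rintegral_ge_measure d (T : measurableType d) (R : realType)
    (mu : {measure set T -> \bar R}) (B : set T) (f : T -> R) (c v : R) : measurable B ->
  mu B = v%:E -> mu.-integrable setT (EFin \o f) -> (forall x, 0 <= f x) ->
  (forall x, B x -> c <= f x) -> c * v <= \int[mu]_x f x.
Proof.
move=> mB Bv fi f0 cf.
have fB : mu.-integrable B (EFin \o f) by exact: integrableS fi.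
have cB : mu.-integrable B (EFin \o (fun=> c)) by apply: integrable_const => //; rewrite Bv ltry.
apply: (@le_trans _ _ (\int[mu]_(x in B) f x)); last exact: ge0_Rintegral_subset.
have -> : c * v = \int[mu]_(x in B) c by rewrite Rintegral_cst// Bv.
exact: le_Rintegral.
Qed.

(** Approximation and smoothing cost [2 * eta] on the direct path and [3 * eta] on the path in two
    steps, and continuity costs [delta] at each end: [4 * delta - 2 * delta - 5 * eta] is still at
    least [delta]. *)
Lemma gap_arith (R : realType) (delta eta m M0 u1 u2 u3 p1 p2 p3 w psi1 psi2 : R) :
  5 * eta <= delta -> 4 * delta <= m - M0 ->
  u1 < M0 + delta -> u2 < M0 + delta -> m - delta < u3 ->
  `|p1 - u1| <= eta -> `|p2 - u2| <= eta -> `|p3 - u3| <= eta ->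
  `|psi1 - Num.max p1 p2| <= eta -> p3 - eta <= w -> w - eta <= psi2 ->
  delta <= psi2 - psi1.
Proof.
move=> h1 h2 h3 h4 h5; rewrite !ler_norml => /andP[_ a1] /andP[_ a2] /andP[a3 _] /andP[_ a4] a5 a6.
have : Num.max p1 p2 <= M0 + delta + eta by rewrite ge_max; apply/andP; split; lra.
lra.
Qed.

Lemma energy_chain3 (R : realType) (j2 jw j0 I0 I1 e d : R) : j2 <= jw + e -> jw <= j0 + e ->
  j0 <= I0 + e -> I0 <= I1 -> 3 * e <= d -> j2 <= I1 + d.
Proof. lra. Qed.

Lemma energy_chain2 (R : realType) (j1 j0 I0 I1 e d : R) : j1 <= j0 + e ->
  j0 <= I0 + e -> I0 <= I1 -> 0 < e -> 3 * e <= d -> j1 <= I1 + d.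
Proof. lra. Qed.

Section strictness.
Context {R : realType} {N : nat}.
Notation V := 'rV[R]_N.
Notation mu := (@lebesgue_rV R N).
Notation e_ i := (delta_mx ord0 i : V).

Lemma axis_coord (i j : 'I_N) (t : R) : (t *: e_ i) ord0 j = if j == i then t else 0.
Proof. by rewrite !mxE eqxx/=; case: eqP => _; rewrite ?mulr1 ?mulr0. Qed.

Lemma enorm_axis (i : 'I_N) (t : R) : enorm (t *: e_ i) = `|t|.
Proof.
rewrite /enorm /dotv (bigD1 i)//= big1 ?addr0 => [|j ji].
  by rewrite axis_coord eqxx -expr2 sqrtr_sqr.
by rewrite axis_coord (negbTE ji) mulr0.
Qed.

Lemma flip_axis (i : 'I_N) (h t : R) : flip i h (t *: e_ i) = (h - t) *: e_ i.
Proof. by apply/rowP => j; rewrite flipE !axis_coord; case: eqP. Qed.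

Lemma max_close_ge (a b c e : R) : `|a - Num.max b c| <= e -> b - e <= a /\ c - e <= a.
Proof.
rewrite ler_norml => /andP[h _].
have h1 : b <= Num.max b c by rewrite le_max lexx.
have h2 : c <= Num.max b c by rewrite le_max lexx orbT.
by split; lra.
Qed.

Lemma axis_polarization p r0 r1 (i : 'I_N) (t t' : R) phi eta : 1 < p -> 0 < r0 -> 0 < eta ->
  `|t'| < `|t| -> test_function (annulus r0 r1 (t' *: e_ i)) phi -> (forall x, 0 <= phi x) ->
  exists psi, [/\ test_function (annulus r0 r1 (t *: e_ i)) psi, forall x, 0 <= psi x,
    energy p psi <= energy p phi + eta &
    forall x : V, 0 <= (t + t') * (t + t' - 2 * x ord0 i) ->
       `|psi x - Num.max (phi x) (phi (flip i (t + t') x))| <= eta].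
Proof.
move=> p1 r00 eta0 tt' tphi phi0.
have [||||psi [h1 h2 h3 h4 _]] := @annulus_polarization R N r0 r1 i (t *: e_ i) (t' *: e_ i) r00 _ _ p phi eta p1 eta0.
- by rewrite !axis_coord eqxx.
- by move=> j ji; rewrite !axis_coord (negbTE ji).
- by [].
- by [].
by exists psi; split => //; rewrite !axis_coord eqxx in h4.
Qed.

(** Turns a property that holds near one point into one on a set of positive finite measure, so that
    a pointwise gap shows up in an integral. *)
Lemma near_cube (x : V) (P : V -> Prop) : (\forall y \near x, P y) ->
  exists (B : set V) (v : R), [/\ measurable B, 0 < v, mu B = v%:E & B `<=` P].
Proof.
move=> /nbhs_ballP[r /= r0 rP].
have rr : - r <= r by rewrite ge0_cp// ltW.
have [mB vB] := @lebesgue_rV_box R N (- r) r rr.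
set B := [set y : V | _] in mB vB.
pose f (j : 'I_N) (t : R) := t + - x ord0 j.
have mf j : measurable_fun [set: measurableTypeR R] (f j : measurableTypeR R -> measurableTypeR R).
  exact: measurable_fun_translation.
exists (coordwise f @^-1` B), ((r - - r) ^+ N); split.
- by rewrite -[X in measurable X]setTI; exact: measurable_coordwise.
- by rewrite exprn_gt0// opprK addr_gt0.
- rewrite lebesgue_rV_coordwise// => j A mA; exact: lebesgue_measure_translation.
- move=> y By; apply: rP; rewrite ball_rVE// => j.
  have := By j; rewrite mxE /f => /andP[h1 h2].
  by rewrite distrC ltr_norml h1.
Qed.

Lemma torsion_energy_strict p r0 r1 (i : 'I_N) (t : R) : 1 < p -> 0 < r0 -> r0 < r1 -> t != 0 ->
  torsion_energy p (annulus r0 r1 (t *: e_ i)) < torsion_energy p (annulus r0 r1 (0 : V)).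
Proof.
move=> p1 r00 rr t0; rewrite ltNge; apply/negP => Ile.
have [u [a [m [cu /andP[ra _] um um' Hu]]]] := @radial_torsion_exists R N p r0 r1 i p1 r00 rr.
have a0 : 0 < a by exact: lt_trans ra.
have T0 : 0 < `|t| by rewrite normr_gt0.
have Tn0 : `|t| != 0 by rewrite gt_eqF.
have t2 : 0 < t * t by rewrite -expr2 exprn_even_gt0.
(* The point [xs = - q t e_i] lies on the axis, opposite to the hole, at distance [a - k |t|] from
   the origin. The mirror between [0] and [t] sends it to distance [a + (1 - k) |t|], the one
   between [0] and [k t] to distance exactly [a]. So the direct polarization meets two values below
   [m], and the detour meets [m]. The two terms of the minimum give [k < 1] and [q >= 0]. *)
pose k := Num.min 2^-1 (a / `|t|).
have k0 : 0 < k by rewrite lt_min invr_gt0 ltr0n divr_gt0.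
have k1 : k < 1 by rewrite gt_min invf_lt1// ltr1n.
have kT : k <= a / `|t| by rewrite ge_min lexx orbT.
pose q := a / `|t| - k.
have q0 : 0 <= q by rewrite subr_ge0.
pose z := - q * t.
pose xs : V := z *: e_ i.
have u1 : u xs < m.
  apply: um'; rewrite enorm_axis /z normrM normrN (ger0_norm q0) /q mulrBl divfK//.
  by rewrite lt_eqF// ltrBlDr ltrDl mulr_gt0.
have u2 : u (flip i t xs) < m.
  apply: um'; rewrite flip_axis enorm_axis.
  have -> : t - z = (1 + q) * t by rewrite /z; ring.
  have q1 : 0 <= 1 + q by rewrite addr_ge0.
  have E : (1 + q) * `|t| = a + (`|t| - k * `|t|).
    by rewrite mulrDl [q * _]mulrBl divfK// mul1r addrCA.
  by rewrite normrM (ger0_norm q1) E gt_eqF// ltrDl subr_gt0 gtr_pMl.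
have u3 : u (flip i (k * t) xs) = m.
  apply: um; rewrite flip_axis enorm_axis.
  have -> : k * t - z = a / `|t| * t by rewrite /z /q; ring.
  by rewrite normrM ger0_norm ?divr_ge0 ?(ltW a0)// divfK.
pose M0 := Num.max (u xs) (u (flip i t xs)).
have Mm : M0 < m by rewrite gt_max u1 u2.
pose delta := (m - M0) / 4.
have d0 : 0 < delta by rewrite divr_gt0// subr_gt0.
have cuf h : continuous (fun x => u (flip i h x)).
  by apply: cont_compose cu; exact: continuous_flip.
have sidec h : continuous (fun x : V => h * (h - 2 * x ord0 i)).
  apply: cont_mul; first exact: cont_cst.
  apply: cont_sub; first exact: cont_cst.
  by apply: cont_mul; [exact: cont_cst|exact: coord_continuous].
(* [xs] is strictly on the origin's side of all three mirrors, so only maxima occur near it; each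
   [h] is a positive multiple of [t]. *)
have side h l : 0 < l -> h = l * t -> 0 < h * (h - 2 * xs ord0 i).
  move=> l0 ->; rewrite /xs axis_coord eqxx /z.
  have -> : l * t * (l * t - 2 * (- q * t)) = t * t * (l * (l + 2 * q)) by ring.
  apply: (mulr_gt0 t2); rewrite pmulr_rgt0//.
  by rewrite ltr_pwDl// mulr_ge0.
pose P x := [/\ u x < M0 + delta, u (flip i t x) < M0 + delta, m - delta < u (flip i (k * t) x),
  0 < t * (t - 2 * x ord0 i) & 0 < k * t * (k * t - 2 * x ord0 i) /\
  0 < (t + k * t) * (t + k * t - 2 * x ord0 i)].
have nP : \forall x \near xs, P x.
  have h1 : u xs < M0 + delta by rewrite ltr_pwDr// le_max lexx.
  have h2 : u (flip i t xs) < M0 + delta by rewrite ltr_pwDr// le_max lexx orbT.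
  have h3 : m - delta < u (flip i (k * t) xs) by rewrite u3 gtrBl.
  have s1 : 0 < t * (t - 2 * xs ord0 i) by apply: (side _ 1) => //; rewrite mul1r.
  have s2 : 0 < k * t * (k * t - 2 * xs ord0 i) by exact: (side _ k).
  have s3 : 0 < (t + k * t) * (t + k * t - 2 * xs ord0 i).
    by apply: (side _ (1 + k)); [exact: addr_gt0|rewrite mulrDl mul1r].
  have /cvgr_lt/(_ _ h1) n1 := cu xs.
  have /cvgr_lt/(_ _ h2) n2 := cuf t xs.
  have /cvgr_gt/(_ _ h3) n3 := cuf (k * t) xs.
  have /cvgr_gt/(_ _ s1) n4 := sidec t xs.
  have /cvgr_gt/(_ _ s2) n5 := sidec (k * t) xs.
  have /cvgr_gt/(_ _ s3) n6 := sidec (t + k * t) xs.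
  near=> x; split; [near: x; exact: n1|near: x; exact: n2|near: x; exact: n3|near: x; exact: n4|].
  by split; near: x; [exact: n5|exact: n6].
have [B [v [mB v0 Bv BP]]] := near_cube nP.
(* Half of what a gap of [delta] on [B] contributes to the integral of the [p]th power. *)
pose e := delta `^ p * v / 2.
have e0 : 0 < e by rewrite divr_gt0// mulr_gt0// powR_gt0.
pose Om := annulus r0 r1 (t *: e_ i).
have mOm : measurable Om by exact: measurable_annulus.
have OmM x : Om x -> forall j : 'I_N, `|x ord0 j| <= r1 by move=> Ox j; exact: annulus_bounded Ox.
have [d dd0 Hd] := minimizing_dist i p1 OmM e0.
(* [5 * eta <= delta] is the budget of [gap_arith]; [3 * eta <= d] covers one approximation and up
   to two polarizations. *)
pose eta := Num.min (delta / 5) (d / 3).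
have eta0 : 0 < eta by rewrite lt_min (divr_gt0 d0)// (divr_gt0 dd0).
have eta1 : 5 * eta <= delta by rewrite mulrC -ler_pdivlMr// ge_min lexx.
have eta2 : 3 * eta <= d by rewrite mulrC -ler_pdivlMr// ge_min lexx orbT.
have [phi [tphi phi0 J0 phiu]] := Hu eta eta0.
have tphi' : test_function (annulus r0 r1 (0 *: e_ i)) phi by rewrite scale0r.
have l1 : `|(0 : R)| < `|t| by rewrite normr0.
have l2 : `|(0 : R)| < `|k * t| by rewrite normr0 normrM mulr_gt0// gtr0_norm.
have l3 : `|k * t| < `|t| by rewrite normrM (gtr0_norm k0) gtr_pMl.
have [psi1 [tp1 _ J1 C1]] := axis_polarization p1 r00 eta0 l1 tphi' phi0.
have [w [tw w0 Jw Cw]] := axis_polarization p1 r00 eta0 l2 tphi' phi0.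
have [psi2 [tp2 _ J2 C2]] := axis_polarization p1 r00 eta0 l3 tw w0.
have gap x : B x -> delta <= psi2 x - psi1 x.
  move=> /BP[g1 g2 g3 s1 [s2 s3]].
  have := C1 x; rewrite addr0 => /(_ (ltW s1)) D1.
  have := Cw x; rewrite addr0 => /(_ (ltW s2))/max_close_ge[_ Dw].
  have /max_close_ge[D2 _] := C2 x (ltW s3).
  apply: (gap_arith eta1 _ g1 g2 g3 (phiu _) (phiu _) (phiu _) D1 Dw D2).
  by rewrite /delta mulrC divfK.
have [||D _] := Hd psi2 psi1 tp2 tp1.
- exact: (energy_chain3 J2 Jw J0 Ile eta2).
- exact: (energy_chain2 J1 J0 Ile eta0 eta2).
have tB := test_sub tp2 tp1.
have E : \int[mu]_(x in Om) (`|psi2 x - psi1 x| `^ p) = \int[mu]_x (`|psi2 x - psi1 x| `^ p).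
  apply: Rintegral_outside => x Ox; rewrite (test_out tp2 Ox) (test_out tp1 Ox) subrr normr0 powR0//.
  by rewrite gt_eqF// (lt_trans ltr01 p1).
rewrite E in D.
have iF := test_powR_integrable p1 measurableT (test_sub_set (@subsetT _ _) tB).
have Fge x : B x -> delta `^ p <= `|psi2 x - psi1 x| `^ p.
  move=> /gap g; apply: ge0_ler_powR; rewrite ?nnegrE ?(ltW d0) ?(ltW (lt_trans ltr01 p1))//.
  exact: le_trans g (ler_norm _).
have H := @Rintegral_ge_measure _ _ R mu B (fun x => `|psi2 x - psi1 x| `^ p) (delta `^ p) v mB Bv iF
  (fun x => powR_ge0 _ _) Fge.
have := le_trans H D; rewrite /e leNgt => /negP; apply.
by rewrite ltr_pdivrMr// mulr_natr mulr2n ltrDl mulr_gt0// powR_gt0.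
Unshelve. all: by end_near.
Qed.

End strictness.

Theorem theorem6p1 (R : realType) (N : nat) (p r0 r1 : R)
  (hN : (1 <= N)%N) (hp : 1 < p) (hr0 : 0 < r0) (hr : r0 < r1) :
  annuli r0 r1 (annulus r0 r1 (0 : 'rV[R]_N)) /\
  forall Om : set 'rV[R]_N, annuli r0 r1 Om ->
    torsional_rigidity p (annulus r0 r1 (0 : 'rV[R]_N))
      <= torsional_rigidity p Om /\
    (torsional_rigidity p Om =
       torsional_rigidity p (annulus r0 r1 (0 : 'rV[R]_N)) ->
     Om = annulus r0 r1 (0 : 'rV[R]_N)).
Proof.
have i0 : 'I_N := Ordinal hN.
have q0 : 0 < p / (p - 1) by rewrite divr_gt0 ?subr_gt0// (lt_trans ltr01 hp).
have TE (c : 'rV[R]_N) : torsional_rigidity p (annulus r0 r1 c) =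
    - (p / (p - 1)) * torsion_energy p (annulus r0 r1 c).
  apply: (@torsional_rigidityE R N p _ r1 i0 hp); first exact: measurable_annulus.
  by move=> x Ox j; exact: annulus_bounded Ox.
split; first exact: annuli_centered.
move=> _ [c _ ->].
have le0 : torsion_energy p (annulus r0 r1 c) <= torsion_energy p (annulus r0 r1 (0 : 'rV[R]_N)).
  by apply: torsion_energy_chain => // j; right; rewrite mxE.
rewrite !TE !mulNr lerN2 ler_pM2l//; split => // /oppr_inj/(mulfI (lt0r_neq0 q0)) Ec.
have [->|/rV0Pn[i ci]] := eqVneq c 0; first exact: erefl.
exfalso.
(* The centre travels from [0] to the axis point [c_i e_i], where the energy drops strictly, and
   from there to [c], where it cannot rise. *)
have le1 : torsion_energy p (annulus r0 r1 c) <=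
    torsion_energy p (annulus r0 r1 (c ord0 i *: (delta_mx ord0 i : 'rV[R]_N))).
  apply: torsion_energy_chain => // j; rewrite axis_coord.
  by have [->|_] := eqVneq j i; [left|right].
have lt1 := torsion_energy_strict i hp hr0 hr ci.
by have := le_lt_trans le1 lt1; rewrite Ec ltxx.
Qed.
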